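(* Suppose that there exist three positive constants $K_2$, $\alpha>1$ and $R_0>1$ such that $$\langle b(t,x),x\rangle\le-K_2|x|^2(\log|x|)^\alpha,\qquad t\in I,\ |x|\ge R_0.$$ Then $G(t,s)$ is ultrabounded.
   Context: Setting. $I$ is an open right halfline, and for $t\in I$, $(\mathcal A(t)\zeta)(x)=\mathrm{Tr}(Q(t)D^2\zeta(x))+\langle b(t,x),\nabla\zeta(x)\rangle$, $x\in\mathbb R^d$, where $Q=[q_{ij}]$ and $b=(b_1,\dots,b_d)$. Standing assumptions: (i) for some $\theta\in(0,1)$, $q_{ij}\in C^{\theta/2}_{\rm loc}(I)$ and $b_i\in C^{\theta/2,\theta}_{\rm loc}(I\times\mathbb R^d)$ (locally parabolic H\''older); (ii) $Q(t)$ is symmetric and there are $0<\eta_0<\Lambda$ with $\eta_0|\xi|^2\le\langle Q(t)\xi,\xi\rangle\le\Lambda|\xi|^2$ for all $t\in I$, $\xi\in\mathbb R^d$; (iii) there are a positive $\varphi\in C^2(\mathbb R^d)$ with $\varphi(x)\to+\infty$ as $|x|\to+\infty$ and constants $a,\gamma>0$ with $(\mathcal A(t)\varphi)(x)\le a-\gamma\varphi(x)$ for all $(t,x)\in I\times\mathbb R^d$; (iv) the first order spatial derivatives of $b_i$ exist and belong to $C^{\theta/2,\theta}_{\rm loc}(I\times\mathbb R^d)$, and there is $r_0<0$ with $\langle\nabla_xb(t,x)\xi,\xi\rangle\le r_0|\xi|^2$ for all $(t,x)\in I\times\mathbb R^d$, $\xi\in\mathbb R^d$. For $s\in I$ and $f\in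 C_b(\mathbb R^d)$, $G(\cdot,s)f\in C_b([s,+\infty)\times\mathbb R^d)\cap C^{1+\theta/2,2+\theta}_{\rm loc}((s,+\infty)\times\mathbb R^d)$ denotes the unique bounded classical solution of $D_tu=\mathcal A(t)u$ in $(s,+\infty)\times\mathbb R^d$, $u(s,\cdot)=f$. Under these assumptions there is a unique family $\{\mu_t:t\in I\}$ of Borel probability measures which is tight (for every $\varepsilon>0$ there is $R>0$ with $\mu_t(B(0,R))\ge1-\varepsilon$ for all $t\in I$) and satisfies $\int G(t,s)f\,d\mu_t=\int f\,d\mu_s$ for all $t>s$ in $I$, $f\in C_b(\mathbb R^d)$ (the tight evolution system of measures). $G(t,s)$ extends to a contraction from $L^p(\mathbb R^d,\mu_s)$ to $L^p(\mathbb R^d,\mu_t)$ for every $p\in[1,+\infty)$, still denoted $G(t,s)$. $\|G(t,s)\|_{p\to\infty}$ is the operator norm from $L^p(\mathbb R^d,\mu_s)$ to $L^\infty(\mathbb R^d)$. $G(t,s)$ is called ultrabounded if it maps $L^p(\mathbb R^d,\mu_s)$ into $L^\infty(\mathbb R^d)$ for every $p>1$ and $t>s$ in $I$, and (for each such $p$) there is a decreasing function $C_{p,\infty}:(0,+\infty)\to(0,+\infty)$ with $\lim_{r\to0^+}C_{p,\infty}(r)=+\infty$ and $\|G(t,s)\|_{p\to\infty}\le C_{p,\infty}(t-s)$ for all $s<t$ in $I$. *)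

(* Defs.v *)
From HB Require Import structures.
From mathcomp Require Import all_boot all_order all_algebra.
From mathcomp Require Import all_classical all_reals all_analysis.

Set Implicit Arguments.
Unset Strict Implicit.
Unset Printing Implicit Defensive.

Import Order.TTheory GRing.Theory Num.Theory.
Import numFieldNormedType.Exports.

Local Open Scope classical_set_scope.
Local Open Scope ring_scope.

Definition open_right_halfline (R : realType) (I : set R) : Prop :=
  exists c : R, I = [set t | c < t].

(* Points of R^d are row vectors.  The library norm on 'rV[R]_d is the sup
   norm, hence the separate Euclidean norm [enorm]; both give the same
   topology. *)
Section euclidean.
Context {R : realType} {d : nat}.
Implicit Types (x y : 'rV[R]_d) (A : 'M[R]_d).

Definition dot x y : R := \sum_(i < d) x ord0 i * y ord0 i.

Definition enorm x : R := Num.sqrt (dot x x).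

Definition eball (r : R) : set 'rV[R]_d := [set x | enorm x < r].

Definition mulmv A x : 'rV[R]_d := (A *m x^T)^T.

End euclidean.

(* R^d with its Borel sigma-algebra; convertible to 'rV[R]_d. *)
Notation borel_rV R d := (g_sigma_algebraType (@open 'rV[R]_d)).

Section space_derivatives.
Context {R : realType} {d : nat}.
Implicit Types (f : 'rV[R]_d -> R) (x : 'rV[R]_d) (i j : 'I_d).

Definition partial i f x : R := 'D_(delta_mx ord0 i) f x.

Definition partial_derivable i f x : Prop :=
  derivable f x (delta_mx ord0 i).

Definition grad f x : 'rV[R]_d := \row_i partial i f x.

Definition hessian f x : 'M[R]_d := \matrix_(i, j) partial i (partial j f) x.

Definition twice_derivable f : Prop :=
  (forall i x, partial_derivable i f x) /\
  (forall i j x, partial_derivable i (partial j f) x).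

Definition C2 f : Prop :=
  [/\ twice_derivable f,
      continuous f,
      forall i, continuous (partial i f)
    & forall i j, continuous (partial i (partial j f))].

Definition Cb f : Prop :=
  continuous f /\ exists M : R, forall x, `|f x| <= M.

End space_derivatives.

Section function_spaces.
Context {R : realType} {d : nat}.
Implicit Types (J : set R) (u : R -> 'rV[R]_d -> R).

(* C^e_loc(J), for 0 < e < 1 *)
Definition holder_loc (e : R) J (f : R -> R) : Prop :=
  forall K : set R, compact K -> K `<=` J ->
  exists M : R, forall t s, K t -> K s -> `|f t - f s| <= M * `|t - s| `^ e.

(* C^{theta/2, theta}_loc(J x R^d), for 0 < theta < 1 *)
Definition parabolic_holder_loc (theta : R) J u : Prop :=
  forall K : set (R * 'rV[R]_d), compact K -> K `<=` J `*` setT ->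
  exists M : R, forall t x s y, K (t, x) -> K (s, y) ->
    `|u t x - u s y|
      <= M * (`|t - s| `^ (theta / 2) + enorm (x - y) `^ theta).

Definition time_deriv u (t : R) (x : 'rV[R]_d) : R := derive1 (u ^~ x) t.

Definition derivable12 J u : Prop :=
  (forall t x, J t -> derivable (u ^~ x) t 1) /\
  (forall t, J t -> twice_derivable (u t)).

Definition continuous_on J u : Prop :=
  {within J `*` setT, continuous (fun z : R * 'rV[R]_d => u z.1 z.2)}.

(* C^{1,2}(J x R^d), for J open *)
Definition C12 J u : Prop :=
  [/\ derivable12 J u,
      continuous_on J u,
      continuous_on J (time_deriv u),
      forall i, continuous_on J (fun t => partial i (u t))
    & forall i j, continuous_on J (fun t => partial i (partial j (u t)))].

(* C^{1+theta/2, 2+theta}_loc(J x R^d), for J open and 0 < theta < 1 *)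
Definition parabolic_holder2_loc (theta : R) J u : Prop :=
  [/\ derivable12 J u,
      parabolic_holder_loc theta J u,
      parabolic_holder_loc theta J (time_deriv u),
      forall i, parabolic_holder_loc theta J (fun t => partial i (u t))
    & forall i j,
        parabolic_holder_loc theta J (fun t => partial i (partial j (u t)))].

(* C_b(J x R^d) *)
Definition Cb_on J u : Prop :=
  continuous_on J u /\
  exists M : R, forall t x, J t -> `|u t x| <= M.

End function_spaces.

Section evolution.
Context {R : realType} {d : nat}.
Variables (I : set R) (theta : R).
Variables (Q : R -> 'M[R]_d) (b : R -> 'rV[R]_d -> 'rV[R]_d).

Definition Aop (t : R) (zeta : 'rV[R]_d -> R) (x : 'rV[R]_d) : R :=
  \tr (Q t *m hessian zeta x) + dot (b t x) (grad zeta x).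

Definition coeff_regular : Prop :=
  (forall i j, holder_loc (theta / 2) I (fun t => Q t i j)) /\
  (forall i, parabolic_holder_loc theta I (fun t x => b t x ord0 i)).

Definition uniformly_elliptic : Prop :=
  (forall t, I t -> (Q t)^T = Q t) /\
  exists eta0 Lambda : R,
    [/\ 0 < eta0, eta0 < Lambda
      & forall t xi, I t ->
          eta0 * enorm xi ^+ 2 <= dot (mulmv (Q t) xi) xi
            <= Lambda * enorm xi ^+ 2].

Definition lyapunov_condition : Prop :=
  exists phi : 'rV[R]_d -> R,
    [/\ C2 phi,
        forall x, 0 < phi x,
        forall M : R, exists r : R, forall x, r <= enorm x -> M <= phi x
      & exists a gamma : R,
          [/\ 0 < a, 0 < gamma
            & forall t x, I t -> Aop t phi x <= a - gamma * phi x]].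

Definition drift_jacobian (t : R) (x : 'rV[R]_d) : 'M[R]_d :=
  \matrix_(i, j) partial j (fun y => b t y ord0 i) x.

Definition dissipative_drift : Prop :=
  [/\ forall t x i j, I t -> partial_derivable j (fun y => b t y ord0 i) x,
      forall i j, parabolic_holder_loc theta I
        (fun t x => drift_jacobian t x i j)
    & exists r0 : R, r0 < 0 /\
        forall t x xi, I t ->
          dot (mulmv (drift_jacobian t x) xi) xi <= r0 * enorm xi ^+ 2].

Definition standing_assumptions : Prop :=
  [/\ 0 < theta < 1, coeff_regular, uniformly_elliptic,
      lyapunov_condition & dissipative_drift].

Definition bounded_classical_solution (s : R) (f : 'rV[R]_d -> R)
    (u : R -> 'rV[R]_d -> R) : Prop :=
  [/\ Cb_on [set t | s <= t] u,
      C12 [set t | s < t] u,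
      forall t x, s < t -> time_deriv u t x = Aop t (u t) x
    & forall x, u s x = f x].

(* [G t s f] is G(t,s)f for f in C_b(R^d); its values for other arguments are
   irrelevant. *)
Definition is_evolution_operator
    (G : R -> R -> ('rV[R]_d -> R) -> 'rV[R]_d -> R) : Prop :=
  forall s f, I s -> Cb f ->
    [/\ bounded_classical_solution s f (fun t => G t s f),
        parabolic_holder2_loc theta [set t | s < t] (fun t => G t s f)
      & forall v, bounded_classical_solution s f v ->
          forall t x, s <= t -> v t x = G t s f x].

End evolution.

Section evolution_measures.
Context {R : realType} {d : nat}.
Variables (I : set R) (mu : R -> probability (borel_rV R d) R).
Local Notation V := (borel_rV R d).

Definition tight : Prop :=
  forall eps : R, 0 < eps -> exists r : R, 0 < r /\
    forall t, I t ->
      ((1 - eps)%:E <= mu t (eball r))%E.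

Definition invariant_family
    (G : R -> R -> ('rV[R]_d -> R) -> 'rV[R]_d -> R) : Prop :=
  forall s t f, I s -> I t -> s < t -> Cb f ->
    (\int[mu t]_(x in [set: V]) (G t s f x)%:E =
     \int[mu s]_(x in [set: V]) (f x)%:E)%E.

Definition tight_evolution_system
    (G : R -> R -> ('rV[R]_d -> R) -> 'rV[R]_d -> R) : Prop :=
  tight /\ invariant_family G.

(* Elements of L^p are handled through representatives in [Lfun].  Since Cb is
   dense in L^p(m) for finite p, [E] is determined up to m'-null sets. *)
Definition is_Lp_extension (p : R) (m m' : probability V R)
    (T : ('rV[R]_d -> R) -> 'rV[R]_d -> R) (E : (V -> R) -> V -> R) : Prop :=
  [/\ forall f, f \in Lfun m p%:E -> E f \in Lfun m' p%:E,
      forall (c : R) f g, f \in Lfun m p%:E -> g \in Lfun m p%:E ->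
        {ae m', forall x, E (fun y => c * f y + g y) x = c * E f x + E g x},
      forall f, f \in Lfun m p%:E ->
        ('N[m']_(p%:E)[EFin \o E f] <= 'N[m]_(p%:E)[EFin \o f])%E
    & forall f, Cb f -> {ae m', forall x, E f x = T f x}].

Definition extends_to_Lp (G : R -> R -> ('rV[R]_d -> R) -> 'rV[R]_d -> R)
    (GL : R -> R -> (V -> R) -> V -> R) : Prop :=
  forall p s t, 1 <= p -> I s -> I t -> s < t ->
    is_Lp_extension p (mu s) (mu t) (G t s) (GL t s).

Definition opnorm_Lp_Loo (p : R) (m m' : probability V R)
    (E : (V -> R) -> V -> R) : \bar R :=
  ereal_sup [set 'N[m']_(+oo%E)[EFin \o E f]%E | f in
    [set f | f \in Lfun m p%:E /\ ('N[m]_(p%:E)[EFin \o f] <= 1)%E]].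

(* L^oo(R^d) is taken with respect to mu t, the measure modulo which G(t,s)f is
   defined; every mu t is equivalent to the Lebesgue measure, so this is the
   usual L^oo(R^d) with the same norm. *)
Definition ultrabounded (GL : R -> R -> (V -> R) -> V -> R) : Prop :=
  forall p : R, 1 < p ->
    (forall s t, I s -> I t -> s < t ->
       forall f, f \in Lfun (mu s) p%:E -> GL t s f \in Lfun (mu t) +oo%E) /\
    exists C : R -> R,
      [/\ forall r : R, 0 < r -> 0 < C r,
          forall r1 r2 : R, 0 < r1 -> r1 < r2 -> C r2 < C r1,
          C r @[r --> 0^'+] --> +oo
        & forall s t, I s -> I t -> s < t ->
            (opnorm_Lp_Loo p (mu s) (mu t) (GL t s) <= (C (t - s))%:E)%E].

End evolution_measures.

(* Main.v *)
Require Import Defs.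
From mathcomp Require Import all_boot all_order all_algebra.
From mathcomp Require Import all_classical all_reals all_analysis.
From mathcomp Require Import measurable_realfun ess_sup_inf ring lra.

Set Implicit Arguments.
Unset Strict Implicit.
Unset Printing Implicit Defensive.

Import Order.TTheory GRing.Theory Num.Theory.
Import numFieldNormedType.Exports.

Local Open Scope classical_set_scope.
Local Open Scope ring_scope.

(** Why the theorem holds.  It is enough to bound [G(t,s) phi] uniformly in
    space by a constant depending on [p] and on a lower bound of [t - s], for
    [phi] bounded and Lipschitz with [L^p(mu s)] norm under control.  Such
    functions are dense, [G(t,s)] contracts [L^1], and a bound that is uniform
    along an approximating sequence survives in the limit almost everywhere
    ([Lp_lipschitz_approximation], [ae_bound_of_lipschitz]).  The bound itself
    ([Lipschitz_uniform_bound]) is obtained in two time steps, both by the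
    maximum principle.

    First half of the time interval: a dimension-free Harnack inequality
    [u(r,x)^p <= v(r,y) exp (c |x - y|^2 / (r - s))], where [u] is
    [+- G(.,s) phi], truncated below at 1, and [v = G(.,s) (|phi| + 1)^p]
    ([harnack_log]).  Doubling the variables, one looks at a maximum of
    [p ln u(x) - ln v(y) - h |x - y|^2].  The second derivatives in the
    directions [(w, w)] do not see [|x - y|^2], dissipativity makes the drift
    contribution nonpositive, and since [p > 1] the two logarithms leave the
    negative term [- 4 (1 - 1/p) h^2 <Q (x - y), x - y>], which pays for the
    time derivative of [h = c / (t - s)].  Integrating in [y] against [mu r] on
    a ball with half of the mass (a radius that tightness makes independent of
    [r]) and using invariance gives [ln |u(r,x)| <= k + delta |x|^2]
    ([integrated_harnack]).

    Second half: the superquadratic drift removes the growth in [x].  One looks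
    for a supersolution [exp (k + M (tau - r) + h(tau) |x|^2)] with [h] equal to
    [delta] at the initial time and to 0 at the final one.  Where the drift
    [- 2 K2 h |x|^2 (ln |x|)^alpha] dominates [|h'| |x|^2] nothing is needed;
    elsewhere [ln |x|] is at most a constant times [(|h'| / h)^(1/alpha)], and
    the constant [M] has to absorb [|h'| exp (C (|h'| / h)^(1/alpha))].  For
    [h = c0 exp (- (t - tau)^(-n))] this stays bounded as [tau] tends to [t]
    precisely when [(n + 1) / alpha < n], which can be arranged because
    [alpha > 1] ([drift_dominates], [barrier_constant]).  At the final time
    only [k + M (t - r)] is left ([come_down]).  Near the origin the drift is
    not bounded uniformly in time, so [|x|^2] is replaced there by a function
    that is locally constant ([huber]).

    At every maximum the trace of [Q] against a Hessian is a sum of second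
    derivatives along lines, because [Q] is a sum of rank-one matrices
    ([psd_sum_rank1]); the calculus is therefore one-dimensional. *)

(** * Quadratic forms *)

Section dot_product.
Context {R : realType} {d : nat}.
Implicit Types (x y z : 'rV[R]_d) (A Q : 'M[R]_d) (a : R).

Lemma dotC x y : dot x y = dot y x.
Proof. by apply: eq_bigr => i _; rewrite mulrC. Qed.

Lemma dotDl x y z : dot (x + y) z = dot x z + dot y z.
Proof.
by rewrite /dot -big_split; apply: eq_bigr => i _; rewrite mxE mulrDl.
Qed.

Lemma dotZl a x y : dot (a *: x) y = a * dot x y.
Proof. by rewrite /dot mulr_sumr; apply: eq_bigr => i _; rewrite mxE mulrA. Qed.

Lemma dotNl x y : dot (- x) y = - dot x y.
Proof. by rewrite -scaleN1r dotZl mulN1r. Qed.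

Lemma dotBl x y z : dot (x - y) z = dot x z - dot y z.
Proof. by rewrite dotDl dotNl. Qed.

Lemma dotDr x y z : dot x (y + z) = dot x y + dot x z.
Proof. by rewrite dotC dotDl !(dotC _ x). Qed.

Lemma dotZr a x y : dot x (a *: y) = a * dot x y.
Proof. by rewrite dotC dotZl dotC. Qed.

Lemma dotNr x y : dot x (- y) = - dot x y.
Proof. by rewrite dotC dotNl dotC. Qed.

Lemma dotBr x y z : dot x (y - z) = dot x y - dot x z.
Proof. by rewrite dotDr dotNr. Qed.

Lemma dot0l x : dot 0 x = 0.
Proof. by rewrite -(scale0r 0) dotZl mul0r. Qed.

Lemma dot_ge0 x : 0 <= dot x x.
Proof. by apply: sumr_ge0 => i _; rewrite -expr2 sqr_ge0. Qed.

Lemma dot_delta x i : dot x (delta_mx ord0 i) = x ord0 i.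
Proof.
rewrite /dot (bigD1 i)//= mxE !eqxx mulr1 big1 ?addr0// => j ji.
by rewrite mxE eqxx (negbTE ji) mulr0.
Qed.

Lemma enorm_sqr x : enorm x ^+ 2 = dot x x.
Proof. by rewrite sqr_sqrtr ?dot_ge0. Qed.

Lemma mulmvE A x i : mulmv A x ord0 i = \sum_j A i j * x ord0 j.
Proof. by rewrite /mulmv !mxE; apply: eq_bigr => j _; rewrite !mxE. Qed.

Lemma mulmvDl A B x : mulmv (A + B) x = mulmv A x + mulmv B x.
Proof. by rewrite /mulmv mulmxDl linearD. Qed.

Lemma mulmvDr A x y : mulmv A (x + y) = mulmv A x + mulmv A y.
Proof. by rewrite /mulmv linearD/= mulmxDr linearD. Qed.

Lemma mulmvZl a A x : mulmv (a *: A) x = a *: mulmv A x.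
Proof. by rewrite /mulmv -scalemxAl linearZ. Qed.

Lemma mulmvZr a A x : mulmv A (a *: x) = a *: mulmv A x.
Proof. by rewrite /mulmv linearZ/= -scalemxAr linearZ. Qed.

Lemma dot_mulmv_sym Q x y : Q^T = Q -> dot (mulmv Q x) y = dot (mulmv Q y) x.
Proof.
move=> Qsym; rewrite /dot.
under eq_bigr do rewrite mulmvE mulr_suml.
rewrite exchange_big; apply: eq_bigr => j _.
rewrite mulmvE mulr_suml; apply: eq_bigr => i _.
by rewrite -[in LHS]Qsym mxE mulrAC.
Qed.

Lemma mulmv_delta A i j : mulmv A (delta_mx ord0 i) ord0 j = A j i.
Proof.
rewrite mulmvE (bigD1 i)//= mxE !eqxx mulr1 big1 ?addr0// => k ki.
by rewrite mxE eqxx (negbTE ki) mulr0.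
Qed.

Lemma mulmv_rank1 x y : mulmv (x^T *m x) y = dot x y *: x.
Proof.
apply/rowP => i; rewrite mulmvE mxE /dot mulr_suml; apply: eq_bigr => j _.
by rewrite !mxE big_ord_recl big_ord0 addr0 !mxE; ring.
Qed.

Lemma tr_rank1 x A : \tr (x^T *m x *m A) = dot (mulmv A x) x.
Proof.
rewrite -mulmxA mxtrace_mulC /mxtrace big_ord_recl big_ord0 addr0.
rewrite -mulmxA mxE; apply: eq_bigr => i _; rewrite /mulmv !mxE.
by rewrite mulrC.
Qed.

Definition psd Q := forall x, 0 <= dot (mulmv Q x) x.

Lemma psd_diag_eq0 Q i j : Q^T = Q -> psd Q -> Q i i = 0 -> Q i j = 0.
Proof.
move=> Qsym Qpsd Qii.
pose e k : 'rV[R]_d := delta_mx ord0 k.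
have H t : 0 <= 2 * t * Q i j + Q j j.
  have := Qpsd (t *: e i + e j).
  rewrite mulmvDr mulmvZr !dotDl !dotDr !dotZl !dotZr !dot_delta !mulmv_delta.
  rewrite Qii (_ : Q j i = Q i j); first by lra.
  by rewrite -[in LHS]Qsym mxE.
apply/eqP; apply: contraT => Qij.
have := H (- (Q j j + 1) / (2 * Q i j)).
rewrite (_ : 2 * _ * _ = - (Q j j + 1)); first by lra.
by field.
Qed.

(** Each step of this Cholesky-type elimination subtracts a rank-one form that
    clears one diagonal entry without disturbing the entries already cleared;
    a positive semidefinite matrix with zero diagonal vanishes. *)
Lemma psd_sum_rank1 Q : Q^T = Q -> psd Q ->
  exists ws : seq 'rV[R]_d, Q = \sum_(w <- ws) w^T *m w.
Proof.
have [n] := ubnP #|[set i | Q i i != 0]%SET|.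
elim: n Q => // n IH Q; rewrite ltnS => Qn Qsym Qpsd.
have [i Qii|Q0] := pickP [pred i | Q i i != 0]; last first.
  exists [::]; rewrite big_nil; apply/matrixP => i j; rewrite mxE.
  by apply: psd_diag_eq0 => //; apply/eqP; have /= := Q0 i; case: eqP.
rewrite /= in Qii.
have Qii_gt0 : 0 < Q i i.
  rewrite lt_def Qii/=; have := Qpsd (delta_mx ord0 i).
  by rewrite dot_delta mulmv_delta.
pose r := row i Q.
pose w := (Num.sqrt (Q i i))^-1 *: r.
have ww : w^T *m w = (Q i i)^-1 *: (r^T *m r).
  apply/matrixP => j k; rewrite !mxE !big_ord_recl !big_ord0 !mxE !addr0.
  rewrite mulrACA -invfM -expr2 sqr_sqrtr ?ltW//.
have rE x : dot r x = mulmv Q x ord0 i.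
  by rewrite mulmvE; apply: eq_bigr => j _; rewrite mxE.
pose Q' := Q - w^T *m w.
have Q'E j k : Q' j k = Q j k - (Q i i)^-1 * (Q i j * Q i k).
  by rewrite /Q' ww !mxE big_ord_recl big_ord0 addr0 !mxE.
have Q'sym : Q'^T = Q'.
  apply/matrixP => j k; rewrite mxE !Q'E; congr (_ - _ * _).
    by rewrite -[in LHS]Qsym mxE.
  exact: mulrC.
have Q'psd : psd Q'.
  move=> x; pose t := dot r x / Q i i.
  have := Qpsd (x - t *: delta_mx ord0 i).
  rewrite mulmvDr -scaleNr mulmvZr !dotDl !dotDr !dotZl !dotZr !dot_delta.
  rewrite mulmv_delta (dot_mulmv_sym _ _ Qsym) dot_delta -rE.
  have -> : dot (mulmv Q' x) x = dot (mulmv Q x) x - (Q i i)^-1 * dot r x ^+ 2.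
    rewrite /Q' ww -scaleNr mulmvDl dotDl mulmvZl dotZl mulmv_rank1 dotZl.
    by rewrite mulNr expr2.
  rewrite /t; set q := Q i i in Qii *; set c := dot r x.
  move=> H; apply: le_trans H _; rewrite le_eqVlt; apply/orP; left; apply/eqP.
  by field.
have diag0 j : Q j j = 0 -> Q' j j = 0.
  move=> Qjj; have Qij : Q i j = 0 by rewrite -Qsym mxE psd_diag_eq0.
  by rewrite Q'E Qjj Qij !mulr0 subr0.
have [] := IH Q' _ Q'sym Q'psd.
  apply: leq_trans Qn; apply: proper_card; apply/properP; split.
    apply/fintype.subsetP => j; rewrite !inE; apply: contra => /eqP Qjj.
    by apply/eqP/diag0.
  exists i; rewrite !inE ?Qii// negbK Q'E; apply/eqP; field.
  exact: Qii.
move=> ws Q'ws; exists (w :: ws).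
by rewrite big_cons -Q'ws /Q' addrC subrK.
Qed.

Lemma tr_sum_rank1 Q A (ws : seq 'rV[R]_d) : Q = \sum_(w <- ws) w^T *m w ->
  \tr (Q *m A) = \sum_(w <- ws) dot (mulmv A w) w.
Proof.
move=> ->; rewrite mulmx_suml raddf_sum.
by apply: eq_bigr => w _; rewrite /= tr_rank1.
Qed.

Lemma dot_sum_rank1 Q x (ws : seq 'rV[R]_d) : Q = \sum_(w <- ws) w^T *m w ->
  dot (mulmv Q x) x = \sum_(w <- ws) dot w x ^+ 2.
Proof.
move=> ->.
elim: ws => [|w ws IH]; rewrite ?big_nil ?big_cons.
  by rewrite /mulmv mul0mx trmx0 dot0l.
by rewrite mulmvDl dotDl IH mulmv_rank1 dotZl expr2.
Qed.

Lemma tr_le Q (L : R) : (forall x, dot (mulmv Q x) x <= L * dot x x) ->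
  \tr Q <= L * d%:R.
Proof.
move=> QL; rewrite /mxtrace.
apply: (@le_trans _ _ (\sum_(i < d) L)); last first.
  by rewrite sumr_const card_ord mulr_natr.
apply: ler_sum => i _; have := QL (delta_mx ord0 i).
by rewrite !dot_delta mulmv_delta mxE !eqxx mulr1.
Qed.

End dot_product.

(** * Calculus along lines *)

Section one_variable.
Context {R : realType}.
Implicit Types (F : R -> R) (s t c : R).

(** A positive second derivative would make the first one positive just to the
    right of the critical point. *)
Lemma max_second_order F (F1 : R -> R) c :
  (\forall s \near (0 : R), is_derive (s : R) 1 F (F1 s)) -> is_derive (0 : R) 1 F1 c ->
  (\forall s \near (0 : R), F s <= F 0) -> F1 0 = 0 /\ c <= 0.
Proof.
move=> dF dF1 maxF.
have [e /= e0 He] : exists2 e : R, 0 < e &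
    forall s, `|s| < e -> is_derive (s : R) 1 F (F1 s) /\ F s <= F 0.
  have [e /= e0 He] := (nbhs_ballP _ _).1 (filterI dF maxF).
  exists e => // s se; apply: He.
  by rewrite /ball/= sub0r normrN.
have seE s : s \in `](-e), e[%R -> `|s| < e by rewrite in_itv/= ltr_norml.
have F10 : F1 0 = 0.
  have d0 : is_derive (0 : R) 1 F 0.
    apply: (@derive1_at_max R F (-e) e 0).
    - by lra.
    - by move=> s /seE /He[[]].
    - by rewrite in_itv/=; lra.
    - by move=> s /seE /He[].
  have [d1 _] : is_derive (0 : R) 1 F (F1 0) /\ F 0 <= F 0.
    by apply: He; rewrite normr0.
  have /= <- := @derive_val _ _ _ _ _ _ _ d1.
  by rewrite (@derive_val _ _ _ _ _ _ _ d0).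
split=> //; rewrite leNgt; apply/negP => c0.
have [dF1' dF1c] := dF1.
have /cvgrPdist_lt/(_ c c0)/nbhs_ballP[e' /= e'0 He'] : (fun h : R => h^-1 *:
    (F1 (h *: (1 : R) + 0) - F1 0)) @ (0 : R)^' --> c.
  by rewrite -dF1c; exact: dF1'.
have F1pos s : 0 < s -> s < e' -> 0 < F1 s.
  move=> s0 se'.
  have := He' s; rewrite /ball/= sub0r normrN gtr0_norm// => /(_ se').
  rewrite gt_eqF// => /(_ isT); rewrite addr0 F10 subr0 [s *: 1]mulr1.
  rewrite ltr_distlC subrr => /andP[+ _].
  by rewrite [_ *: _]mulrC pmulr_lgt0// invr_gt0.
pose m := Num.min e e' / 2.
have m0 : 0 < m by rewrite divr_gt0// lt_min e0 e'0.
have [me me'] : m < e /\ m < e'.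
  by rewrite /m minEle; case: ifPn; rewrite -?ltNge => h; split; lra.
have [s||x xm] := @MVT R F F1 0 m m0.
- by rewrite in_itv/= => /andP[s0 sm]; apply: (He s _).1; rewrite gtr0_norm//; lra.
- apply: continuous_in_subspaceT => s; rewrite inE/= in_itv/= => /andP[s0 sm].
  apply: differentiable_continuous; apply/derivable1_diffP.
  by have [[]] : is_derive (s : R) 1 F (F1 s) /\ F s <= F 0
    by apply: He; rewrite ger0_norm//; lra.
have /andP[x0 xm'] : 0 < x < m by move: xm; rewrite in_itv.
rewrite subr0 => FE.
have : 0 < F m - F 0 by rewrite FE mulr_gt0// F1pos//; lra.
have : F m <= F 0 by apply: (He m _).2; rewrite gtr0_norm.
lra.
Qed.

Lemma left_max_derive_ge0 F t c a : a < t -> is_derive (t : R) 1 F c ->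
  (forall s, a < s -> s <= t -> F s <= F t) -> 0 <= c.
Proof.
move=> at_ [dF dFc] maxF; rewrite leNgt; apply/negP => c0.
have /cvgrPdist_lt/(_ (- c))/= : (fun h : R => h^-1 *:
    (F (h *: (1 : R) + t) - F t)) @ (0 : R)^' --> c.
  by rewrite -dFc; exact: dF.
rewrite oppr_gt0 => /(_ c0)/nbhs_ballP[e /= e0 He].
pose h := Num.min e (t - a) / 2.
have h0 : 0 < h by rewrite divr_gt0// lt_min e0 subr_gt0.
have [he ha] : h < e /\ h < t - a.
  by rewrite /h minEle; case: ifPn; rewrite -?ltNge => ?; split; lra.
have := He (- h); rewrite /ball/= sub0r normrN normrN gtr0_norm// => /(_ he).
rewrite oppr_eq0 gt_eqF// => /(_ isT); rewrite [- h *: 1]mulr1.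
rewrite ltr_distlC => /andP[_].
have : F (- h + t) <= F t by apply: maxF; lra.
move=> H /=; apply/negP; rewrite -leNgt addrN.
by apply: mulr_le0; rewrite ?invr_le0 ?subr_le0//; lra.
Qed.

Lemma is_derive_ln_comp (f : R -> R) s (df : R) : 0 < f s -> is_derive (s : R) 1 f df ->
  is_derive (s : R) 1 (@ln R \o f) (df / f s).
Proof.
move=> fs df_; have dl := @is_derive1_ln R _ fs.
have := @is_derive1_comp R (@ln R) f s _ _ dl df_.
by rewrite mulrC.
Qed.

End one_variable.

Section lines.
Context {R : realType} {d : nat}.
Implicit Types (f : 'rV[R]_d -> R) (x w a : 'rV[R]_d) (i : 'I_d).

Lemma is_derive_line f x w s D : is_derive (x + s *: w) w f D ->
  is_derive (s : R) 1 (fun t : R => f (x + t *: w)) D.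
Proof.
move=> [df dfD].
have E : (fun h : R => h^-1 *: (f (x + (h *: (1 : R) + s) *: w) - f (x + s *: w)))
    = (fun h => h^-1 *: (f (h *: w + (x + s *: w)) - f (x + s *: w))).
  apply/funext => h; congr (_ *: (f _ - _)).
  by rewrite [h *: (1 : R)]mulr1 scalerDl addrCA.
by split; rewrite /derivable /derive /comp/= E.
Qed.

Lemma is_derive_add_coord f x a i c A :
  (forall y, partial_derivable i f y) -> {for x, continuous (partial i f)} ->
  is_derive x a f A ->
  is_derive x (c *: delta_mx ord0 i + a) f (c * partial i f x + A).
Proof.
move=> df cf [dfa dfaA].
set e := delta_mx ord0 i : 'rV[R]_d.
suff H : (fun h : R => h^-1 *: (f (h *: (c *: e + a) + x) - f x)) @ (0 : R)^' -->
    c * partial i f x + A.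
  by split; [apply/cvg_ex; exists (c * partial i f x + A)|exact: cvg_lim].
have -> : (fun h : R => h^-1 *: (f (h *: (c *: e + a) + x) - f x)) =
    (fun h => h^-1 *: (f (h *: (c *: e + a) + x) - f (h *: a + x))) \+
    (fun h => h^-1 *: (f (h *: a + x) - f x)).
  by apply/funext => h /=; rewrite -scalerDr addrA subrK.
apply: cvgD; last by rewrite -dfaA; exact: dfa.
have mvt h : exists2 t, `|t| <= `|h * c| &
    h != 0 -> h^-1 *: (f (h *: (c *: e + a) + x) - f (h *: a + x)) =
    c * partial i f (h *: a + x + t *: e).
  pose g t := f (h *: a + x + t *: e).
  have dg t : is_derive (t : R) 1 g (partial i f (h *: a + x + t *: e)).
    apply: (@is_derive_line f (h *: a + x) e t).
    exact: (derivableP (df (h *: a + x + t *: e))).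
  have cg : continuous g.
    by move=> t; apply: differentiable_continuous; apply/derivable1_diffP; case: (dg t).
  have g0 : g 0 = f (h *: a + x) by rewrite /g scale0r addr0.
  have gc : g (h * c) = f (h *: (c *: e + a) + x).
    by rewrite /g scalerDr scalerA; congr f; rewrite addrC addrA.
  have [hc|hc] := leP 0 (h * c).
    have [t|t tin tE] := @MVT_segment R g _ 0 (h * c) hc (fun s _ => dg s).
      exact: continuous_subspaceT.
    exists t; first by rewrite ger0_norm ?(itvP tin)// ger0_norm ?(itvP tin).
    move=> h0; rewrite -gc -g0 tE subr0.
    set P := partial _ _ _; rewrite -[_ *: _]/(h^-1 * (P * (h * c))).
    by rewrite mulrCA mulKf// mulrC.
  have [t|t tin tE] := @MVT_segment R g _ (h * c) 0 (ltW hc) (fun s _ => dg s).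
    exact: continuous_subspaceT.
  exists t; first by rewrite ler0_norm ?(itvP tin)// ltr0_norm// lerN2 (itvP tin).
  move=> h0; rewrite -gc -g0 -opprB tE sub0r mulrN opprK.
  set P := partial _ _ _; rewrite -[_ *: _]/(h^-1 * (P * (h * c))).
  by rewrite mulrCA mulKf// mulrC.
apply/cvgrPdist_le => eps eps0.
have c1 : 0 < `|c| + 1 by rewrite ltr_wpDl.
have /cvgrPdist_le/(_ (eps / (`|c| + 1))) := cf.
rewrite divr_gt0// => /(_ isT)/nbhs_ballP[del /= del0 Hdel].
pose K := `|a| + `|c| * `|e| + 1.
have K0 : 0 < K by rewrite ltr_wpDl// addr_ge0// mulr_ge0.
apply/nbhs_ballP; exists (del / K) => /=; first by rewrite divr_gt0.
move=> h; rewrite /ball/= sub0r normrN ltr_pdivlMr// => hdel h0.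
have [t tle ->//] := mvt h.
rewrite -mulrBr normrM.
apply: (@le_trans _ _ (`|c| * (eps / (`|c| + 1)))); last first.
  rewrite mulrA ler_pdivrMr// mulrC ler_pM2l//; lra.
rewrite ler_wpM2l//; apply: Hdel.
rewrite -ball_normE /ball_/= addrAC opprD addrCA subrr addr0 normrN.
apply: le_lt_trans hdel; apply: (le_trans (ler_normD _ _)).
rewrite !normrZ /K mulrDr mulr1 mulrDr.
have : `|t| * `|e| <= `|h| * (`|c| * `|e|).
  by rewrite mulrA ler_wpM2r// -normrM.
have : 0 <= `|h| by [].
lra.
Qed.

(** The coordinates of the direction are added one at a time, so only the
    mean value theorem along coordinate lines is needed. *)
Lemma is_derive_grad f x w :
  (forall i y, partial_derivable i f y) ->
  (forall i, {for x, continuous (partial i f)}) ->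
  is_derive x w f (dot (grad f x) w).
Proof.
move=> df cf.
have wE : w = \sum_(i <- enum 'I_d) w ord0 i *: delta_mx ord0 i.
  by rewrite big_enum -row_sum_delta.
have -> : dot (grad f x) w = \sum_(i <- enum 'I_d) w ord0 i * partial i f x.
  by rewrite /dot big_enum; apply: eq_bigr => i _; rewrite mxE mulrC.
rewrite {1}wE; elim: (enum 'I_d) => [|i r IH].
  by rewrite !big_nil; exact: is_derive0.
by rewrite !big_cons; apply: is_derive_add_coord.
Qed.

Lemma C2_second_derivative f x w :
  twice_derivable f -> (forall i, continuous (partial i f)) ->
  (forall i j, continuous (partial i (partial j f))) ->
  is_derive x w (fun y => dot (grad f y) w) (dot (mulmv (hessian f x) w) w).
Proof.
move=> [_ d2f] _ cf2.
have -> : (fun y => dot (grad f y) w) =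
    \sum_(j < d) (fun y => w ord0 j *: partial j f y).
  apply/funext => y; rewrite fct_sumE; apply: eq_bigr => j _.
  by rewrite mxE mulrC.
have -> : dot (mulmv (hessian f x) w) w =
    \sum_(j < d) (w ord0 j *: dot (grad (partial j f) x) w).
  rewrite /dot; under eq_bigr do rewrite mulmvE mulr_suml.
  rewrite exchange_big; apply: eq_bigr => j _ /=.
  rewrite scaler_sumr; apply: eq_bigr => i _; rewrite !mxE /=.
  by rewrite [RHS]mulrC mulrAC.
apply: is_derive_sum => j; apply: is_deriveZ.
by apply: is_derive_grad => // i; exact: cf2.
Qed.

End lines.

Section jets.
Context {R : realType}.
Implicit Types (F G : R -> R) (b c k : R).

(** Second-order data at 0, closed under the operations that build the test
    functions of the maximum principle along a line. *)
Definition jet2 F b c := exists F' : R -> R,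
  [/\ \forall s \near (0 : R), is_derive (s : R) 1 F (F' s), F' 0 = b
    & is_derive (0 : R) 1 F' c].

Lemma jet2_max F b c : jet2 F b c -> (forall s, F s <= F 0) ->
  b = 0 /\ c <= 0.
Proof.
move=> [F' [dF <- dF']] maxF.
have maxF0 : \forall s \near (0 : R), F s <= F 0 by exact: (filterE _ maxF).
exact: max_second_order dF dF' maxF0.
Qed.

Lemma jet2D F G b c b' c' : jet2 F b c -> jet2 G b' c' ->
  jet2 (fun s => F s + G s) (b + b') (c + c').
Proof.
move=> [F' [dF <- dF']] [G' [dG <- dG']]; exists (F' + G'); split.
- by move: dF dG; apply: filterS2 => s dFs dGs; exact: is_deriveD.
- by [].
- exact: is_deriveD.
Qed.

Lemma jet2Z k F b c : jet2 F b c -> jet2 (fun s => k * F s) (k * b) (k * c).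
Proof.
move=> [F' [dF <- dF']]; exists (k *: F'); split.
- by move: dF; apply: filterS => s dFs; exact: is_deriveZ.
- by [].
- exact: is_deriveZ.
Qed.

Lemma jet2N F b c : jet2 F b c -> jet2 (fun s => - F s) (- b) (- c).
Proof.
move=> [F' [dF <- dF']]; exists (- F'); split.
- by move: dF; apply: filterS => s dFs; exact: is_deriveN.
- by [].
- exact: is_deriveN.
Qed.

Lemma jet2B F G b c b' c' : jet2 F b c -> jet2 G b' c' ->
  jet2 (fun s => F s - G s) (b - b') (c - c').
Proof. by move=> jF jG; apply: jet2D => //; exact: jet2N. Qed.

Lemma jet2_quadratic a b c : jet2 (fun s => a + b * s + c * s ^+ 2) b (2 * c).
Proof.
have dlin (u v s : R) : is_derive (s : R) 1 (fun s : R => u + v * s) v.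
  have := @is_deriveD R R R _ _ s 1 _ _ (is_derive_cst u s 1)
    (@is_deriveZ R R R _ v s 1 _ (is_derive_id s 1)).
  by rewrite add0r [v *: 1]mulr1.
exists (fun s => b + 2 * c * s); split.
- apply: filterE => s.
  have dX : is_derive (s : R) 1 (c *: (fun s : R => s ^+ 2)) (2 * c * s).
    have := @is_deriveZ R R R _ c s 1 _ (@is_deriveX R R id 2 s 1 1 (is_derive_id s 1)).
    rewrite [X in is_derive _ _ _ X](_ : _ = 2 * c * s) => [//|].
    by rewrite /GRing.scale/=; ring.
  have := @is_deriveD R R R _ _ _ _ _ _ (dlin a b s) dX.
  by [].
- by rewrite mulr0 addr0.
- exact: dlin.
Qed.

Lemma jet2_ln F b c : 0 < F 0 -> jet2 F b c ->
  jet2 (fun s => ln (F s)) (b / F 0) (c / F 0 - (b / F 0) ^+ 2).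
Proof.
move=> F0 [F' [dF <- dF']].
have dF0 : is_derive (0 : R) 1 F (F' 0) by apply: nbhs_singleton dF.
have cF : {for (0 : R), continuous F}.
  by apply: differentiable_continuous; apply/derivable1_diffP; case: dF0.
have Fpos : \forall s \near (0 : R), 0 < F s.
  exact: (cvgr_gt (F 0) cF).
exists (F' * (fun s => (F s)^-1)); split.
- by move: dF Fpos; apply: filterS2 => s dFs Fs; exact: is_derive_ln_comp.
- by [].
have F0neq : F 0 != 0 by rewrite gt_eqF.
have := @is_deriveM R R _ _ _ _ _ _ dF' (@is_deriveV R F 0 _ 1 F0neq dF0).
rewrite [X in is_derive _ _ _ X](_ : _ = c / F 0 - (F' 0 / F 0) ^+ 2)//.
by rewrite /GRing.scale/=; field.
Qed.

End jets.

(** * Solutions and existence of penalized maxima *)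

Section penalized_maximum.
Context {R : realType} {d : nat}.
Local Notation V := 'rV[R]_d.
Implicit Types (x y w : V) (t s T eps C : R) (J : set R).

Lemma continuous_on_cvg J (u : R -> V -> R) t x (S : Type) (F : set_system S)
    (tau : S -> R) (xi : S -> V) : Filter F ->
  continuous_on J u -> J t -> (\forall a \near F, J (tau a)) ->
  tau @ F --> t -> xi @ F --> x -> u (tau a) (xi a) @[a --> F] --> u t x.
Proof.
move=> FF /subspace_continuousP cu Jt Jtau ctau cxi.
have /= := cu (t, x) (conj Jt I).
apply: cvg_trans => A /= uA.
have H : \forall a \near F, (J `*` [set: V]) (tau a, xi a) ->
    A (u (tau a) (xi a)).
  exact: (@cvg_pair _ _ _ F (nbhs t) (nbhs x) FF _ _ tau xi ctau cxi _ uA).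
by move: H Jtau; apply: filterS2 => a /= H Ja; exact: H.
Qed.

Lemma abs_coord_sqr_le x i : x ord0 i ^+ 2 <= dot x x.
Proof.
rewrite /dot (bigD1 i)//= -expr2 lerDl.
by apply: sumr_ge0 => j _; rewrite -expr2 sqr_ge0.
Qed.

Lemma cvg_coord (S : Type) (F : set_system S) (f : S -> V) x i : Filter F ->
  f @ F --> x -> f a ord0 i @[a --> F] --> x ord0 i.
Proof. by move=> FF cf A /(@coord_continuous R 1 d ord0 i x) /cf. Qed.

Lemma cvg_dot (S : Type) (F : set_system S) (f g : S -> V) x y : Filter F ->
  f @ F --> x -> g @ F --> y -> dot (f a) (g a) @[a --> F] --> dot x y.
Proof.
move=> FF cf cg; apply: cvg_big => [|i _]; first exact: add_continuous.
by apply: cvgM; exact: cvg_coord.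
Qed.

(** Continuity up to the ends of the time interval, stated through arbitrary
    filters so that it composes without subspace topologies. *)
Definition continuous_slab2 s T (Phi : R -> V -> V -> R) : Prop :=
  forall (S : Type) (F : set_system S) tau xi eta t x y, Filter F ->
  s <= t <= T -> (\forall a \near F, s <= tau a <= T) ->
  tau @ F --> t -> xi @ F --> x -> eta @ F --> y ->
  Phi (tau a) (xi a) (eta a) @[a --> F] --> Phi t x y.

Definition continuous_slab s T (Phi : R -> V -> R) : Prop :=
  forall (S : Type) (F : set_system S) tau xi t x, Filter F ->
  s <= t <= T -> (\forall a \near F, s <= tau a <= T) ->
  tau @ F --> t -> xi @ F --> x -> Phi (tau a) (xi a) @[a --> F] --> Phi t x.

(** The penalization keeps the values far away below the value at the origin, so
    the supremum is a maximum over a compact set. *)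
Lemma penalized_max2 s T eps C (Phi : R -> V -> V -> R) :
  s <= T -> 0 < eps ->
  continuous_slab2 s T Phi ->
  (forall t x y, s <= t -> t <= T ->
     Phi t x y <= C - eps * (dot x x + dot y y)) ->
  exists t x y, [/\ s <= t, t <= T & forall t' x' y', s <= t' -> t' <= T ->
     Phi t' x' y' <= Phi t x y].
Proof.
move=> sT eps0 cPhi Phi_le.
pose rho := `|C - Phi s 0 0| / eps + 1.
have rho_ge1 : 1 <= rho by rewrite lerDr divr_ge0// ltW.
pose B : set V := [set v | forall i, v ord0 i \in `[-rho, rho]].
have cB : compact B.
  apply: (@rV_compact R d (fun=> `[-rho, rho]%classic)) => _.
  exact: segment_compact.
pose K : set (R * (V * V)) := `[s, T] `*` (B `*` B).
have cK : compact K.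
  by apply: compact_setX; [exact: segment_compact|exact: compact_setX].
have B0 : B 0 by move=> i; rewrite mxE in_itv/=; lra.
have Ks0 : K (s, (0, 0)) by split => //=; rewrite in_itv/= lexx sT.
have far x : ~ B x -> C - eps * dot x x < Phi s 0 0.
  move=> /existsNP[i /negP]; rewrite in_itv/= -ler_norml -ltNge => xi.
  have rho_sqr : rho <= dot x x.
    apply: le_trans (abs_coord_sqr_le x i).
    rewrite -real_normK ?num_real//.
    have : rho * 1 <= rho * rho by rewrite ler_wpM2l//; lra.
    have : rho * rho <= `|x ord0 i| ^+ 2 by rewrite expr2 ler_pM//; lra.
    lra.
  have : eps * rho <= eps * dot x x by rewrite ler_wpM2l// ltW.
  rewrite /rho mulrDr mulrCA divff ?gt_eqF// !mulr1.
  have := ler_norm (C - Phi s 0 0).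
  lra.
have [||[t [x y]]] := @compact_EVT_max _ R
    (fun z : R * (V * V) => Phi z.1 z.2.1 z.2.2) K _ cK.
- by exists (s, (0, 0)).
- apply/subspace_continuousP => -[t [x y]] [/=]; rewrite in_itv/= => /andP[st tT] _.
  have FF : Filter (within K (nbhs (t, (x, y)))) by exact: within_filter.
  apply: cPhi; first by rewrite st tT.
  - have : within K (nbhs (t, (x, y))) K by exact: withinT.
    by apply: filterS => z [/=]; rewrite in_itv.
  - by apply: cvg_within_filter; exact: cvg_fst.
  - by apply: cvg_within_filter; apply: cvg_comp cvg_snd cvg_fst.
  - by apply: cvg_within_filter; apply: cvg_comp cvg_snd cvg_snd.
rewrite inE => -[/=]; rewrite in_itv/= => /andP[st tT] _ tmax.
exists t, x, y; split => // t' x' y' st' tT'.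
have [Kz|nK] := pselect (K (t', (x', y'))).
  by have := tmax (t', (x', y')); rewrite inE; exact.
have := tmax (s, (0, 0)); rewrite inE => /(_ Ks0)/=.
have := Phi_le t' x' y' st' tT'.
have [Bx|/far] := pselect (B x').
  have [By|/far] := pselect (B y').
    by exfalso; apply: nK; split => //=; rewrite in_itv/= st' tT'.
  have : 0 <= eps * dot x' x' by rewrite mulr_ge0 ?dot_ge0 ?ltW.
  lra.
have : 0 <= eps * dot y' y' by rewrite mulr_ge0 ?dot_ge0 ?ltW.
lra.
Qed.

Lemma penalized_max s T eps C (Phi : R -> V -> R) :
  s <= T -> 0 < eps ->
  continuous_slab s T Phi ->
  (forall t x, s <= t -> t <= T -> Phi t x <= C - eps * dot x x) ->
  exists t x, [/\ s <= t, t <= T & forall t' x', s <= t' -> t' <= T ->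
     Phi t' x' <= Phi t x].
Proof.
move=> sT eps0 cPhi Phi_le.
have [||t [x [y [st tT tmax]]]] := @penalized_max2 s T eps C
    (fun t x y => Phi t x - eps * dot y y) sT eps0.
- move=> S F tau xi eta t x y FF tin taun ctau cxi ceta; apply: cvgB.
    exact: cPhi.
  by apply: cvgMl_tmp; exact: cvg_dot.
- move=> t x y st tT; have := Phi_le t x st tT; lra.
exists t, x; split => // t' x' st' tT'.
by have := tmax t' x' y st' tT'; lra.
Qed.

End penalized_maximum.

Section smooth_solutions.
Context {R : realType} {d : nat}.
Local Notation V := 'rV[R]_d.
Variables (Q : R -> 'M[R]_d) (b : R -> V -> V).
Implicit Types (x y w : V) (t s : R) (u : R -> V -> R).

(** What the maximum principle uses of a bounded classical solution: the
    derivatives [ut], [g], [H] enter only through derivatives along lines. *)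
Definition line_solution s u (ut : R -> V -> R) (g : R -> V -> V)
    (H : R -> V -> 'M[R]_d) : Prop :=
  [/\ Cb_on [set t | s <= t] u,
      forall t x, s < t -> is_derive t 1 (u ^~ x) (ut t x),
      forall t x w, s < t -> is_derive x w (u t) (dot (g t x) w),
      forall t x w, s < t -> is_derive x w (fun y => dot (g t y) w)
        (dot (mulmv (H t x) w) w)
    & forall t x, s < t -> ut t x = \tr (Q t *m H t x) + dot (b t x) (g t x)].

Lemma continuous_on_open_slice J (u : R -> V -> R) t : open J -> J t ->
  continuous_on J u -> continuous (u t).
Proof.
move=> oJ Jt cu x.
apply: (@continuous_on_cvg R d J u t x V (nbhs x) (fun=> t) id _ cu Jt).
- exact: filterE.
- exact: cvg_cst.
- exact: cvg_id.
Qed.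

Lemma classical_line_solution s f u :
  bounded_classical_solution Q b s f u ->
  exists ut g H, line_solution s u ut g H.
Proof.
move=> [Cu [[dt dx] cu _ cu1 cu2] eqn _].
have oJ : open [set t | s < t] by exact: open_gt.
exists (time_deriv u), (fun t => grad (u t)), (fun t => hessian (u t)).
split => //.
- move=> t x st; rewrite /time_deriv derive1E.
  by apply: derivableP; exact: dt.
- move=> t x w st; apply: is_derive_grad.
    exact: (dx t st).1.
  by move=> i; apply: (continuous_on_open_slice oJ _ (cu1 i)).
- move=> t x w st; apply: C2_second_derivative; first exact: dx.
    by move=> i; exact: (continuous_on_open_slice oJ _ (cu1 i)).
  by move=> i j; exact: (continuous_on_open_slice oJ _ (cu2 i j)).
Qed.

Lemma line_solutionN s u ut g H : line_solution s u ut g H ->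
  line_solution s (fun t x => - u t x) (fun t x => - ut t x)
    (fun t x => - g t x) (fun t x => - H t x).
Proof.
move=> [[cu [M uM]] dt d1 d2 eqn]; split.
- split; first by move=> z; apply: continuousN; exact: cu.
  by exists M => t x st; rewrite normrN; exact: uM.
- by move=> t x st; apply: is_deriveN; exact: dt.
- by move=> t x w st; rewrite dotNl; apply: is_deriveN; exact: d1.
- move=> t x w st; rewrite -scaleN1r mulmvZl dotZl mulN1r.
  have -> : (fun y => dot (- g t y) w) = - (fun y => dot (g t y) w).
    by apply/funext => y; rewrite dotNl.
  by apply: is_deriveN; exact: d2.
- by move=> t x st; rewrite eqn// mulmxN linearN/= dotNr opprD.
Qed.

Lemma line_solution_jet2 s u ut g H t x w : line_solution s u ut g H -> s < t ->
  jet2 (fun a => u t (x + a *: w)) (dot (g t x) w) (dot (mulmv (H t x) w) w).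
Proof.
move=> [_ _ d1 d2 _] st; exists (fun a => dot (g t (x + a *: w)) w); split.
- by apply: filterE => a; apply: is_derive_line; exact: d1.
- by rewrite scale0r addr0.
- have := @is_derive_line _ _ (fun y => dot (g t y) w) x w 0 _.
  by rewrite scale0r addr0; apply; exact: d2.
Qed.

Lemma jet2_dot x w : jet2 (fun a : R => dot (x + a *: w) (x + a *: w))
  (2 * dot x w) (2 * dot w w).
Proof.
have -> : (fun a : R => dot (x + a *: w) (x + a *: w)) =
    (fun a => dot x x + (2 * dot x w) * a + dot w w * a ^+ 2).
  apply/funext => a; rewrite dotDl !dotDr !dotZl !dotZr (dotC w x); ring.
exact: jet2_quadratic.
Qed.

End smooth_solutions.

(** * Consequences of the standing assumptions *)

Section coefficients.
Context {R : realType} {d : nat}.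
Local Notation V := 'rV[R]_d.
Variables (I : set R) (theta : R) (Q : R -> 'M[R]_d) (b : R -> V -> V).
Hypothesis I_halfline : open_right_halfline I.

Lemma halfline_ge s t : I s -> s <= t -> I t.
Proof. by case: I_halfline => c -> /=; exact: lt_le_trans. Qed.

Lemma holder_slice_continuous (u : R -> V -> R) t : 0 < theta ->
  parabolic_holder_loc theta I u -> I t -> continuous (u t).
Proof.
move=> th0 hu It.
suff H (x : V) : {for x, continuous (u t)} by move=> x; exact: H.
pose B : set V := [set v | forall i, v ord0 i \in `[x ord0 i - 1, x ord0 i + 1]].
have cK : compact ([set t] `*` B).
  apply: compact_setX; first exact: compact_set1.
  apply: (@rV_compact R d (fun i => `[x ord0 i - 1, x ord0 i + 1]%classic)) => i.
  exact: segment_compact.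
have [|M HM] := hu _ cK; first by move=> [t' y] [/= -> _].
have Bx : B x by move=> i; rewrite in_itv/=; lra.
apply/(@cvgrPdist_le _ _ _ (nbhs x) (nbhs_filter x)) => eps eps0.
have M1 : 0 < `|M| + 1 by rewrite ltr_wpDl.
pose del := (eps / (`|M| + 1)) `^ theta^-1.
have e1 : 0 < eps / (`|M| + 1) by rewrite divr_gt0.
have del0 : 0 < del by rewrite powR_gt0.
have near0 : \forall y \near x, dot (x - y) (x - y) < Num.min 1 (del ^+ 2).
  have cB : x - y @[y --> x] --> x - x.
    apply: (@cvgB R V _ (nbhs x) _ (fun=> x) (fun y => y)); first exact: cvg_cst.
    exact: cvg_id.
  have c := @cvg_dot R d V (nbhs x) _ _ _ _ (nbhs_filter x) cB cB.
  have lt0 : dot (x - x) (x - x) < Num.min 1 (del ^+ 2).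
    by rewrite subrr dot0l lt_min ltr01/= exprn_gt0.
  have H := @cvgr_lt R V (nbhs x) (nbhs_filter x) _ _ c _ lt0.
  exact: H.
apply: (@filterS _ (nbhs x) _ _ _ _ near0) => y; rewrite lt_min => /andP[y1 ydel].
have By : B y.
  move=> i; have := le_lt_trans (abs_coord_sqr_le (x - y) i) y1.
  rewrite !mxE -[ltRHS](expr1n _ 2) -real_normK ?num_real//.
  by rewrite ltr_pXn2r ?nnegrE// ltr_norml in_itv/= => /andP[]; lra.
apply: le_trans (HM t x t y _ _) _ => //.
rewrite subrr normr0 powR0 ?add0r; last by rewrite gt_eqF// divr_gt0.
apply: (@le_trans _ _ (`|M| * (eps / (`|M| + 1)))); last first.
  by rewrite mulrA ler_pdivrMr// mulrC ler_pM2l//; lra.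
have exy : enorm (x - y) `^ theta <= eps / (`|M| + 1).
  have -> : eps / (`|M| + 1) = del `^ theta.
    by rewrite /del -powRrM mulVf ?gt_eqF// powRr1// ltW.
  apply: ge0_ler_powR; [exact: ltW|by rewrite nnegrE sqrtr_ge0|
    by rewrite nnegrE ltW|].
  have : enorm (x - y) <= Num.sqrt (del ^+ 2) by rewrite ler_wsqrtr// ltW.
  by rewrite sqrtr_sqr ger0_norm// ltW.
apply: (@le_trans _ _ (`|M| * enorm (x - y) `^ theta)).
  by rewrite ler_wpM2r ?powR_ge0// ler_norm.
by rewrite ler_wpM2l.
Qed.

(** Mean value theorem along the segment from [y] to [x]; the continuity of the
    Jacobian makes the drift differentiable along lines. *)
Lemma drift_strictly_monotone : 0 < theta -> dissipative_drift I theta b ->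
  exists2 kappa, 0 < kappa & forall t x y, I t ->
    dot (b t x - b t y) (x - y) <= - kappa * dot (x - y) (x - y).
Proof.
move=> th0 [db hJ [r0 [r00 Hr0]]]; exists (- r0); first by rewrite oppr_gt0.
move=> t x y It; rewrite opprK; set z := x - y.
pose phi a := dot (b t (y + a *: z)) z.
have dphi (a : R) : is_derive (a : R) 1 phi (dot (mulmv (drift_jacobian b t (y + a *: z)) z) z).
  apply: (@is_derive_line R d (fun v => dot (b t v) z) y z a).
  have -> : (fun v => dot (b t v) z) =
      \sum_(i < d) (fun v => z ord0 i *: b t v ord0 i).
    by apply/funext => v; rewrite fct_sumE; apply: eq_bigr => i _; rewrite mulrC.
  have -> : dot (mulmv (drift_jacobian b t (y + a *: z)) z) z = \sum_(i < d)
      (z ord0 i *: dot (grad (fun v => b t v ord0 i) (y + a *: z)) z).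
    rewrite /dot; apply: eq_bigr => i _; rewrite mulmvE mulrC; congr (_ * _).
    by apply: eq_bigr => j _; rewrite !mxE.
  apply: is_derive_sum => i; apply: is_deriveZ.
  apply: is_derive_grad => [j v|j]; first exact: db.
  have := @holder_slice_continuous (fun t x => drift_jacobian b t x i j) t th0
    (hJ i j) It.
  rewrite (_ : (fun _ => _) = partial j (fun v => b t v ord0 i)); first exact.
  by apply/funext => v; rewrite mxE.
have [|c _ cE] := @MVT R phi _ 0 1 ltr01 (fun a _ => dphi a).
  apply: continuous_subspaceT => a.
  by apply: differentiable_continuous; apply/derivable1_diffP; case: (dphi a).
have -> : dot (b t x - b t y) z = phi 1 - phi 0.
  by rewrite /phi scale1r scale0r addr0 /z (addrC y) subrK dotBl.
by rewrite cE subr0 mulr1 -enorm_sqr; exact: Hr0.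
Qed.

(** Strict monotonicity reduces the claim to the boundedness of [b t 0], which
    holds on compact time intervals only: [C] depends on the interval. *)
Lemma drift_coercive s T : 0 < theta -> dissipative_drift I theta b ->
  (forall i, parabolic_holder_loc theta I (fun t x => b t x ord0 i)) -> I s ->
  exists C kappa, [/\ 0 <= C, 0 < kappa & forall t x, s <= t -> t <= T ->
    dot (b t x) x <= C - kappa * dot x x].
Proof.
move=> th0 /(drift_strictly_monotone th0)[k k0 Hk] hb Is.
have bd0 i : exists B, forall t, s <= t -> t <= T -> b t 0 ord0 i ^+ 2 <= B.
  have cK : compact (`[s, T]%classic `*` [set (0 : V)]).
    by apply: compact_setX; [exact: segment_compact|exact: compact_set1].
  have [|M HM] := hb i _ cK.
    move=> [t y] [/=]; rewrite in_itv/= => /andP[st _] _; split => //=.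
    exact: halfline_ge st.
  pose e := `|b s 0 ord0 i| + `|M| * (`|T - s| `^ (theta / 2)).
  exists (e ^+ 2) => t st tT.
  rewrite -real_normK ?num_real// ler_pXn2r ?nnegrE//; last first.
    by rewrite addr_ge0// mulr_ge0// powR_ge0.
  have := HM t 0 s 0; rewrite subrr.
  have -> : enorm (0 : V) = 0 by rewrite /enorm dot0l sqrtr0.
  rewrite powR0 ?addr0 ?gt_eqF// => H.
  have : `|b t 0 ord0 i - b s 0 ord0 i| <= `|M| * (`|T - s| `^ (theta / 2)).
    apply: (le_trans (H _ _)) => //.
    - by split => //=; rewrite in_itv/= st.
    - by split => //=; rewrite in_itv/= lexx (le_trans st).
    apply: (@le_trans _ _ (`|M| * `|t - s| `^ (theta / 2))).
      by rewrite ler_wpM2r ?powR_ge0// ler_norm.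
    rewrite ler_wpM2l//; apply: ge0_ler_powR; rewrite ?nnegrE//.
      by rewrite divr_ge0// ltW.
    by rewrite !ger0_norm; lra.
  have := ler_normD (b t 0 ord0 i - b s 0 ord0 i) (b s 0 ord0 i).
  by rewrite subrK /e; lra.
have {bd0}/boolp.choice[B HB] := bd0.
pose S := \sum_i `|B i|.
exists (S / (2 * k)), (k / 2); split.
- by rewrite divr_ge0 ?mulr_ge0 ?sumr_ge0// ltW.
- by rewrite divr_gt0.
move=> t x st tT.
have It : I t by exact: halfline_ge st.
have := Hk t x 0 It; rewrite subr0 dotBl.
have a2 : dot (b t 0) (b t 0) <= S.
  apply: ler_sum => i _; rewrite -expr2; apply: le_trans (ler_norm _).
  exact: HB.
have := dot_ge0 (b t 0 - k *: x).
rewrite dotBl !dotBr !dotZl !dotZr (dotC x (b t 0)).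
set A := dot (b t 0) (b t 0) in a2 *; set c := dot (b t 0) x.
set X := dot x x => H1 H2.
have H3 : 2 * k * c <= S + k * (k * X) by lra.
have -> : S / (2 * k) - k / 2 * X = (S + k * (k * X)) / (2 * k) - k * X.
  by field; rewrite gt_eqF.
have : c <= (S + k * (k * X)) / (2 * k).
  by rewrite ler_pdivlMr ?mulr_gt0// mulrC.
lra.
Qed.

Lemma elliptic_bounds : uniformly_elliptic I Q ->
  exists eta0 Lambda, [/\ 0 < eta0, 0 < Lambda & forall t, I t ->
    [/\ exists ws : seq V, Q t = \sum_(w <- ws) w^T *m w,
        \tr (Q t) <= Lambda * d%:R,
        forall x, eta0 * dot x x <= dot (mulmv (Q t) x) x
      & forall x, dot (mulmv (Q t) x) x <= Lambda * dot x x]].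
Proof.
move=> [Qsym [eta0 [L [e0 eL HQ]]]]; exists eta0, L; split => //; first lra.
move=> t It.
have HQ1 x : eta0 * dot x x <= dot (mulmv (Q t) x) x.
  by have := HQ t x It; rewrite enorm_sqr => /andP[].
have HQ2 x : dot (mulmv (Q t) x) x <= L * dot x x.
  by have := HQ t x It; rewrite enorm_sqr => /andP[].
split => //; last exact: tr_le.
apply: psd_sum_rank1; first exact: Qsym.
by move=> x; apply: le_trans (HQ1 x); rewrite mulr_ge0 ?dot_ge0// ltW.
Qed.

End coefficients.

Section admissible_coefficients.
Context {R : realType} {d : nat}.
Local Notation V := 'rV[R]_d.
Implicit Types (x y w z xi zeta : V) (Q A : 'M[R]_d) (ws : seq V).

(** Summing a second-order test over the directions [w] of a decomposition of
    [Q] turns it into an inequality between the traces. *)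
Lemma trace_test Q ws A B xi zeta (a b c1 c2 e : R) :
  Q = \sum_(w <- ws) w^T *m w ->
  (forall w, a * dot (mulmv A w) w + b * dot (mulmv B w) w <=
     c1 * dot w xi ^+ 2 + c2 * dot w zeta ^+ 2 + e * dot w w) ->
  a * \tr (Q *m A) + b * \tr (Q *m B) <=
    c1 * dot (mulmv Q xi) xi + c2 * dot (mulmv Q zeta) zeta + e * \tr Q.
Proof.
move=> QE H.
have -> : \tr Q = \sum_(w <- ws) dot w w.
  rewrite -[Q in LHS]mulmx1 (tr_sum_rank1 _ QE).
  by apply: eq_bigr => w _; rewrite /mulmv mul1mx trmxK.
rewrite !(tr_sum_rank1 _ QE) !(dot_sum_rank1 _ QE) !mulr_sumr -!big_split/=.
exact: ler_sum.
Qed.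

Lemma quad_young_le Q ws z x (a e k : R) : Q = \sum_(w <- ws) w^T *m w ->
  0 < k -> dot (mulmv Q (a *: z + e *: x)) (a *: z + e *: x) <=
    (1 + k) * a ^+ 2 * dot (mulmv Q z) z +
    (1 + k^-1) * e ^+ 2 * dot (mulmv Q x) x.
Proof.
move=> QE k0; rewrite !(dot_sum_rank1 _ QE) !mulr_sumr -!big_split/=.
apply: ler_sum => w _; rewrite dotDr !dotZr.
set A := dot w z; set B := dot w x.
have := sqr_ge0 (k * a * A - e * B).
rewrite -(pmulr_rge0 (x := k^-1)) ?invr_gt0//.
rewrite (_ : k^-1 * _ = k * (a * A) ^+ 2 - 2 * (a * A) * (e * B)
  + k^-1 * (e * B) ^+ 2); first by lra.
by field; rewrite gt_eqF.
Qed.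

Lemma quad_young_ge Q ws z x (a e k : R) : Q = \sum_(w <- ws) w^T *m w ->
  0 < k -> (1 - k) * a ^+ 2 * dot (mulmv Q z) z +
    (1 - k^-1) * e ^+ 2 * dot (mulmv Q x) x <=
    dot (mulmv Q (a *: z + e *: x)) (a *: z + e *: x).
Proof.
move=> QE k0; rewrite !(dot_sum_rank1 _ QE) !mulr_sumr -!big_split/=.
apply: ler_sum => w _; rewrite dotDr !dotZr.
set A := dot w z; set B := dot w x.
have := sqr_ge0 (k * a * A + e * B).
rewrite -(pmulr_rge0 (x := k^-1)) ?invr_gt0//.
rewrite (_ : k^-1 * _ = k * (a * A) ^+ 2 + 2 * (a * A) * (e * B)
  + k^-1 * (e * B) ^+ 2); first by lra.
by field; rewrite gt_eqF.
Qed.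

(** The bounds on the coefficients used on a time interval; [C] and [kappa]
    may depend on the interval, [eta0] and [Lambda] will not. *)
Definition admissible (Q : R -> 'M[R]_d) (b : R -> V -> V)
    (s T eta0 Lambda C kappa : R) : Prop :=
  [/\ 0 < eta0, 0 < Lambda, 0 <= C, 0 < kappa &
   forall t, s <= t -> t <= T ->
   [/\ (exists ws : seq V, Q t = \sum_(w <- ws) w^T *m w) /\
       \tr (Q t) <= Lambda * d%:R,
       forall x, eta0 * dot x x <= dot (mulmv (Q t) x) x,
       forall x, dot (mulmv (Q t) x) x <= Lambda * dot x x,
       forall x, dot (b t x) x <= C - kappa * dot x x
     & forall x y, dot (b t x - b t y) (x - y) <= 0]].

End admissible_coefficients.

(** * Minimum principle and Harnack inequality *)

Section maximum_principles.
Context {R : realType} {d : nat}.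
Local Notation V := 'rV[R]_d.
Variables (Q : R -> 'M[R]_d) (b : R -> V -> V) (s T eta0 Lambda C kappa : R).
Hypothesis coeffs : admissible Q b s T eta0 Lambda C kappa.
Implicit Types (t : R) (x y w : V) (u v : R -> V -> R).

Lemma line_solution_slab u ut g H : line_solution Q b s u ut g H ->
  continuous_slab s T u.
Proof.
move=> [[cu _] _ _ _ _] S F tau xi t x FF /andP[st _] taun ctau cxi.
apply: (@continuous_on_cvg R d [set t | s <= t] u t x S F tau xi FF cu st) => //.
by apply: filterS taun => a /andP[].
Qed.

(** At a minimum of [v + eps |x|^2 + eps L (t - s)] after the initial time, the
    operator applied to the penalization is smaller than [eps L]. *)
Lemma min_principle v vt g H c : line_solution Q b s v vt g H ->
  (forall x, c <= v s x) -> forall t x, s <= t -> t <= T -> c <= v t x.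
Proof.
move=> sol v0 t1 x1 st1 t1T; rewrite leNgt; apply/negP => vc.
have [_ L0 C0 k0 HQb] := coeffs.
have [[_ [M HM]] dt d1 d2 eqn] := sol.
pose L := 2 * Lambda * d%:R + 2 * C + 1.
have L_gt0 : 0 < L.
  have : 0 <= Lambda * d%:R by rewrite mulr_ge0// ltW.
  by rewrite /L; lra.
pose E := dot x1 x1 + L * (t1 - s) + 1.
have E0 : 0 < E.
  have : 0 <= L * (t1 - s) by rewrite mulr_ge0 ?subr_ge0// ltW.
  by have := dot_ge0 x1; rewrite /E; lra.
pose eps := (c - v t1 x1) / E.
have eps0 : 0 < eps by rewrite divr_gt0// subr_gt0.
have epsE : eps * E = c - v t1 x1 by rewrite /eps divfK// gt_eqF.
pose Phi t x := - v t x - eps * dot x x - eps * L * (t - s).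
have [||t [x [st tt1 tmax]]] := @penalized_max R d s t1 eps M Phi st1 eps0.
- move=> S F tau xi t x FF tin taun ctau cxi.
  have tin' : s <= t <= T by case/andP: tin => -> /le_trans->.
  have taun' : \forall a \near F, s <= tau a <= T.
    by apply: filterS taun => a /andP[-> /le_trans->].
  apply: cvgB; first apply: cvgB.
  - by apply: cvgN; exact: (line_solution_slab sol).
  - by apply: cvgMl_tmp; exact: cvg_dot.
  - by apply: cvgMl_tmp; apply: cvgB => //; exact: cvg_cst.
- move=> t x st tt1; rewrite /Phi.
  have : 0 <= eps * L * (t - s) by rewrite mulr_ge0 ?subr_ge0// mulr_ge0// ltW.
  have := HM t x st; rewrite ler_norml; lra.
have Phi1 : - c < Phi t1 x1.
  have : eps * (dot x1 x1 + L * (t1 - s)) < c - v t1 x1.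
    by rewrite -epsE ltr_pM2l// /E; lra.
  by rewrite /Phi; lra.
have Phi_tx : - c < Phi t x.
  by apply: lt_le_trans Phi1 _; exact: tmax.
have {}st : s < t.
  rewrite lt_def st andbT; apply/eqP => ts; move: Phi_tx; rewrite ts /Phi.
  have := v0 x; have : 0 <= eps * dot x x by rewrite mulr_ge0 ?dot_ge0// ltW.
  lra.
have [[[ws Qws] trQ] _ _ bx _] := HQb t (ltW st) (le_trans tt1 t1T).
have jet w := jet2B (jet2N (line_solution_jet2 x w sol st))
  (jet2Z eps (jet2_dot x w)).
have maxw w : - dot (g t x) w - eps * (2 * dot x w) = 0 /\
    - dot (mulmv (H t x) w) w - eps * (2 * dot w w) <= 0.
  apply: (jet2_max (jet w)) => a.
  have := tmax t (x + a *: w) (ltW st) tt1; rewrite /Phi !scale0r !addr0; lra.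
have time_ge0 : 0 <= - vt t x - eps * L.
  apply: (@left_max_derive_ge0 R (fun tau => - v tau x - (eps * L) * tau) t _ s) => //.
    have dv := dt t x st.
    have := @is_deriveB R R R _ _ t 1 _ _ (@is_deriveN R R R _ t 1 _ dv)
      (@is_deriveZ R R R id (eps * L) t 1 _ (is_derive_id t 1)).
    by rewrite [_ *: 1]mulr1.
  move=> tau stau taut.
  have := tmax tau x (ltW stau) (le_trans taut tt1); rewrite /Phi; lra.
have tr_le0 : (-1) * \tr (Q t *m H t x) + 0 * \tr (Q t *m H t x) <=
    0 * dot (mulmv (Q t) 0) 0 + 0 * dot (mulmv (Q t) 0) 0 + 2 * eps * \tr (Q t).
  apply: (trace_test Qws) => w; have [_] := maxw w; lra.
have gb := (maxw (b t x)).1.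
have := eqn t x st; have := bx x; rewrite (dotC x) (dotC (g t x)) in gb *.
have : 0 <= kappa * dot x x by rewrite mulr_ge0 ?dot_ge0// ltW.
move=> kx bxx eqt.
have e1 : eps * \tr (Q t) <= eps * (Lambda * d%:R) by rewrite ler_pM2l.
have e2 : eps * dot (b t x) x <= eps * C by rewrite ler_pM2l//; lra.
have : eps * L = 2 * (eps * (Lambda * d%:R)) + 2 * (eps * C) + eps.
  by rewrite /L; ring.
lra.
Qed.

End maximum_principles.

(** The weight in Young's inequality that leaves half of the convexity gap
    [1 - 1/p]. *)
Definition young_gap (R : realType) (p : R) := (p - 1) / (2 * (p + 1)).

(** The [c] for which [h = c / t] solves [- h' = 2 * eta0 * (1 - 1/p) * h ^ 2]. *)
Definition harnack_const (R : realType) (eta0 p : R) :=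
  p / (2 * eta0 * (p - 1)).

Lemma young_gap_gt0 (R : realType) (p : R) : 1 < p -> 0 < young_gap p.
Proof. by move=> p1; apply: divr_gt0; lra. Qed.

Lemma harnack_const_gt0 (R : realType) (eta0 p : R) : 0 < eta0 -> 1 < p ->
  0 < harnack_const eta0 p.
Proof.
move=> e0 p1; apply: divr_gt0; first lra.
by rewrite !mulr_gt0 ?subr_gt0.
Qed.

(** Larger than what the operator produces, per unit of [eps], on the spatial
    penalization of the doubled variables. *)
Definition penalty_rate (R : realType) (d : nat) (Lambda C : R) :=
  4 * Lambda * d%:R + 4 * C + 1.

(** The leading terms, of order [h ^ 2], cancel exactly by the choice of the
    Harnack constant and of the weight in Young's inequality. *)
Lemma doubling_leading_terms (R : realType) (p eta0 h qz Z : R) :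
  1 < p -> 0 < eta0 -> eta0 * Z <= qz ->
  p^-1 * ((1 + young_gap p) * (2 * h) ^+ 2 * qz)
    - (1 - young_gap p) * (2 * h) ^+ 2 * qz
    + h ^+ 2 / harnack_const eta0 p * Z <= 0.
Proof.
move=> p1 e0 Zq.
have [pn pp1 pm1 en] : [/\ p != 0, p + 1 != 0, p - 1 != 0 & eta0 != 0].
  by split; rewrite gt_eqF//; lra.
have -> : p^-1 * ((1 + young_gap p) * (2 * h) ^+ 2 * qz)
    - (1 - young_gap p) * (2 * h) ^+ 2 * qz
    = - (2 * h ^+ 2 * ((p - 1) / p)) * qz.
  by rewrite /young_gap; field; rewrite pn pp1.
have -> : h ^+ 2 / harnack_const eta0 p * Z
    = 2 * h ^+ 2 * ((p - 1) / p) * (eta0 * Z).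
  by rewrite /harnack_const; field; rewrite pm1 pn en.
have H : 0 <= 2 * h ^+ 2 * ((p - 1) / p).
  by apply: mulr_ge0; [rewrite mulr_ge0// sqr_ge0|apply: divr_ge0; lra].
have := ler_wpM2l H Zq; lra.
Qed.

Lemma doubling_penalty_terms (R : realType) (p k eps kappa Lambda qx qy X Y : R) :
  1 < p -> 0 < k -> 0 <= qx -> 0 <= qy -> qx <= Lambda * X -> qy <= Lambda * Y ->
  0 < eps -> 0 <= X -> 0 <= Y -> 4 * eps * (1 + k^-1) * Lambda <= 2 * kappa ->
  p^-1 * ((1 + k^-1) * (2 * eps) ^+ 2 * qx)
    - (1 - k^-1) * (- (2 * eps)) ^+ 2 * qy <= eps * (2 * kappa * (X + Y)).
Proof.
move=> p1 k0 qx0 qy0 qxX qyY eps0 X0 Y0 small.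
have ki : 0 < k^-1 by rewrite invr_gt0.
have c0 : 0 <= (1 + k^-1) * (2 * eps) ^+ 2 by rewrite mulr_ge0 ?sqr_ge0//; lra.
have H1 : p^-1 * ((1 + k^-1) * (2 * eps) ^+ 2 * qx) <=
    (1 + k^-1) * (2 * eps) ^+ 2 * qx.
  by rewrite ler_piMl ?mulr_ge0// ?invf_le1//; lra.
have H2 : 0 <= (2 * eps) ^+ 2 * qy by rewrite mulr_ge0 ?sqr_ge0.
have H3 := ler_wpM2l c0 (lerD qxX qyY).
have H4 : eps * (X + Y) * (4 * eps * (1 + k^-1) * Lambda) <=
    eps * (X + Y) * (2 * kappa).
  by rewrite ler_wpM2l// mulr_ge0 ?addr_ge0// ltW.
rewrite sqrrN; move: (k^-1) => ki' in H1 H2 H3 H4 *; lra.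
Qed.

Lemma is_derive_doubling (R : realType) (f g : R -> R) (t s eta p k m df dg : R) :
  0 < f t -> 0 < g t -> 0 < t - s + eta ->
  is_derive (t : R) 1 f df -> is_derive (t : R) 1 g dg ->
  is_derive (t : R) 1
    (fun r => p * ln (f r) - ln (g r) - k * (r - s + eta)^-1 - m * r)
    (p * (df / f t) - dg / g t + k / (t - s + eta) ^+ 2 - m).
Proof.
move=> f0 g0 h0 df_ dg_.
have du := is_derive_ln_comp f0 df_.
have dv := is_derive_ln_comp g0 dg_.
have dlin : is_derive (t : R) 1 (fun r : R => r - s + eta) 1.
  have -> : (fun r : R => r - s + eta) = shift (eta - s).
    by apply/funext => r /=; lra.
  exact: is_derive_shift.
have neq0 : t - s + eta != 0 by rewrite gt_eqF.
have dinv := @is_deriveV R (fun r => r - s + eta) t 1 1 neq0 dlin.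
have := @is_deriveB R R R _ _ t 1 _ _ (@is_deriveB R R R _ _ t 1 _ _
  (@is_deriveB R R R _ _ t 1 _ _ (@is_deriveZ R R R _ p t 1 _ du) dv)
  (@is_deriveZ R R R _ k t 1 _ dinv))
  (@is_deriveZ R R R id m t 1 _ (is_derive_id t 1)).
set D1 := (X in is_derive _ _ _ X -> _) => H.
have -> : p * (df / f t) - dg / g t + k / (t - s + eta) ^+ 2 - m = D1.
  rewrite /D1 /GRing.scale/= !mulr1 mulrN opprK; ring.
exact: H.
Qed.

Section harnack.
Context {R : realType} {d : nat}.
Local Notation V := 'rV[R]_d.
Variables (Q : R -> 'M[R]_d) (b : R -> V -> V) (s T eta0 Lambda C kappa : R).
Hypothesis coeffs : admissible Q b s T eta0 Lambda C kappa.
Implicit Types (t : R) (x y w : V).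

Variables (u v ut vt : R -> V -> R) (gu gv : R -> V -> V)
  (Hu Hv : R -> V -> 'M[R]_d).
Hypothesis solu : line_solution Q b s u ut gu Hu.
Hypothesis solv : line_solution Q b s v vt gv Hv.
Lemma ln_le_max1 (a : R) : ln a <= ln (Num.max a 1).
Proof.
have [a1|a1] := leP a 1; first by rewrite ln1 ln_le0.
by [].
Qed.

(** The synchronous coupling in analytic form: second derivatives are taken
    along the diagonal directions [(w, w)], which do not see [x - y]; the
    convexity gap [1 - 1/p] of the logarithm pays for the explosion of
    [h = c / (t - s + eta)], because [c] is chosen so that
    [- h' = 2 * eta0 * (1 - 1/p) * h ^ 2]. *)
Lemma doubling_bound (p K eta eps : R) :
  (forall t x, s <= t -> t <= T -> 1 <= v t x) -> 1 < p -> 0 <= K ->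
  (forall x y,
     p * ln (Num.max (u s x) 1) - ln (v s y) <= K * enorm (x - y)) ->
  let k0 := young_gap p in let c := harnack_const eta0 p in
  let L := penalty_rate d Lambda C in
  0 < eta -> 0 < eps ->
  4 * eps * (1 + k0^-1) * Lambda <= 2 * kappa ->
  forall t x y, s <= t -> t <= T ->
  p * ln (Num.max (u t x) 1) - ln (v t y)
    - c / (t - s + eta) * dot (x - y) (x - y) - eps * (dot x x + dot y y)
    - eps * L * (t - s) <= K ^+ 2 * eta / (4 * c).
Proof.
move=> v_ge1 p_gt1 K_ge0 init k0 c L eta_gt0 eps0 eps_small t1 x1 y1 st1 t1T.
have [e0 L0 C0 kap0 HQb] := coeffs.
have k0_gt0 : 0 < k0 by exact: young_gap_gt0.
have c_gt0 : 0 < c by exact: harnack_const_gt0.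
have L_gt0 : 0 < L.
  have : 0 <= Lambda * d%:R by rewrite mulr_ge0// ltW.
  by rewrite /L /penalty_rate; lra.
rewrite leNgt; apply/negP => Phi1.
have [[_ [M HM]] dtu _ _ equ] := solu.
have [_ dtv _ _ eqv] := solv.
have p0 : 0 < p by lra.
set A0 := K ^+ 2 * eta / (4 * c) in Phi1.
have A0_ge0 : 0 <= A0.
  by rewrite /A0 divr_ge0// mulr_ge0 ?sqr_ge0// ltW.
pose Phi t x y := p * ln (Num.max (u t x) 1) - ln (v t y)
    - c / (t - s + eta) * dot (x - y) (x - y) - eps * (dot x x + dot y y)
    - eps * L * (t - s).
have max1_gt0 (a : R) : 0 < Num.max a 1 by rewrite lt_max ltr01 orbT.
have h_gt0 t : s <= t -> 0 < c / (t - s + eta).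
  by move=> st; apply: divr_gt0 => //; move: eta_gt0 st; lra.
have [||t [x [y [st tt1 tmax]]]] := @penalized_max2 R d s t1 eps
    (p * ln (Num.max M 1)) Phi st1 eps0.
- move=> S F tau xi zet t x y FF tin taun ctau cxi czet.
  have tin' : s <= t <= T by case/andP: tin => -> /le_trans->.
  have taun' : \forall a \near F, s <= tau a <= T.
    by apply: filterS taun => a /andP[-> /le_trans->].
  have cz : xi a - zet a @[a --> F] --> x - y by exact: cvgB.
  have ctaus : tau a - s @[a --> F] --> t - s.
    by apply: cvgB => //; exact: cvg_cst.
  have cu : p * ln (Num.max (u (tau a) (xi a)) 1) @[a --> F]
      --> p * ln (Num.max (u t x) 1).
    apply: cvgMl_tmp.
    have cu := line_solution_slab solu FF tin' taun' ctau cxi.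
    have cmax : Num.max (u (tau a) (xi a)) 1 @[a --> F] --> Num.max (u t x) 1.
      rewrite maxr_absE; under eq_fun => a do rewrite maxr_absE.
      apply: cvgMr_tmp; apply: cvgD; first by apply: cvgD => //; exact: cvg_cst.
      by apply: cvg_norm; apply: cvgB => //; exact: cvg_cst.
    by apply: (cvg_comp _ _ cmax); exact: continuous_ln.
  have cv : ln (v (tau a) (zet a)) @[a --> F] --> ln (v t y).
    have cv := line_solution_slab solv FF tin' taun' ctau czet.
    apply: (cvg_comp _ _ cv); apply: continuous_ln.
    by case/andP: tin' => st tT; rewrite (lt_le_trans ltr01)// v_ge1.
  have ch : c / (tau a - s + eta) @[a --> F] --> c / (t - s + eta).
    apply: cvgMl_tmp; apply: cvgV.
      by case/andP: tin => st _; rewrite gt_eqF//; lra.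
    by apply: cvgD => //; exact: cvg_cst.
  have cd := cvg_dot FF cz cz.
  have ce := cvgD (cvg_dot FF cxi cxi) (cvg_dot FF czet czet).
  apply: cvgB; last by apply: cvgMl_tmp; exact: ctaus.
  apply: cvgB; last by apply: cvgMl_tmp; exact: ce.
  by apply: cvgB; [exact: cvgB|exact: cvgM].
- move=> t x y st tt1; rewrite /Phi.
  have : 0 <= eps * L * (t - s) by rewrite mulr_ge0 ?subr_ge0// mulr_ge0// ltW.
  have : 0 <= c / (t - s + eta) * dot (x - y) (x - y).
    by rewrite mulr_ge0 ?dot_ge0// ltW// h_gt0.
  have : 0 <= ln (v t y) by rewrite ln_ge0// v_ge1// (le_trans tt1).
  have : p * ln (Num.max (u t x) 1) <= p * ln (Num.max M 1).
    rewrite ler_pM2l// ler_ln ?posrE// ge_max !le_max lexx orbT andbT.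
    by have := HM t x st; rewrite ler_norml => /andP[_ ->].
  lra.
have {Phi1} Phi_tx : A0 < Phi t x y by apply: lt_le_trans Phi1 _; exact: tmax.
have tT := le_trans tt1 t1T.
have {}st : s < t.
  rewrite lt_def st andbT; apply/eqP => ts; move: Phi_tx; rewrite ts /Phi.
  rewrite subrr add0r mulr0.
  have := init x y.
  have : 0 <= eps * (dot x x + dot y y).
    by rewrite mulr_ge0 ?addr_ge0 ?dot_ge0// ltW.
  rewrite -(enorm_sqr (x - y)); set n := enorm (x - y).
  have := sqr_ge0 (c / eta * n - K / 2).
  (* complete the square: K n <= c / eta * n ^ 2 + A0 *)
  have ec0 : 0 < eta / c by apply: divr_gt0.
  rewrite -(pmulr_rge0 _ ec0).
  rewrite (_ : eta / c * _ = c / eta * n ^+ 2 - K * n + A0); first by lra.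
  by rewrite /A0; field; rewrite !gt_eqF.
pose h := c / (t - s + eta).
pose z := x - y.
have h0 : 0 < h by by apply: h_gt0; exact: ltW.
have [[[ws Qws] trQ] Qge Qle bx bxy] := HQb t (ltW st) tT.
have v1 : 1 <= v t y by apply: v_ge1 => //; exact: ltW.
have v0 : 0 < v t y by exact: lt_le_trans ltr01 v1.
have tse : 0 < t - s + eta by rewrite addr_gt0// subr_gt0.
have u1 : 1 < u t x.
  rewrite ltNge; apply/negP => u1; move: Phi_tx; rewrite /Phi max_r// ln1 mulr0.
  have : 0 <= ln (v t y) by rewrite ln_ge0.
  have : 0 <= h * dot z z by rewrite mulr_ge0 ?dot_ge0// ltW.
  have : 0 <= eps * (dot x x + dot y y).
    by rewrite mulr_ge0 ?addr_ge0 ?dot_ge0// ltW.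
  have : 0 <= eps * L * (t - s) by rewrite mulr_ge0 ?subr_ge0 ?ltW// mulr_gt0.
  rewrite /h /z; lra.
have u0 : 0 < u t x by exact: lt_trans ltr01 u1.
have maxu : Num.max (u t x) 1 = u t x by rewrite max_l// ltW.
(* replacing ln (max u 1) by ln u only lowers the functional off the maximum *)
have jetu w : jet2 (fun a => ln (u t (x + a *: w))) (dot (gu t x) w / u t x)
    (dot (mulmv (Hu t x) w) w / u t x - (dot (gu t x) w / u t x) ^+ 2).
  have := jet2_ln _ (line_solution_jet2 x w solu st).
  by rewrite scale0r addr0; exact.
have jetv w : jet2 (fun a => ln (v t (y + a *: w))) (dot (gv t y) w / v t y)
    (dot (mulmv (Hv t y) w) w / v t y - (dot (gv t y) w / v t y) ^+ 2).
  have := jet2_ln _ (line_solution_jet2 y w solv st).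
  by rewrite scale0r addr0; exact.
have gradu w : p * (dot (gu t x) w / u t x) - h * (2 * dot z w)
    - eps * (2 * dot x w) = 0.
  apply: (proj1 (jet2_max (jet2B (jet2B (jet2Z p (jetu w)) (jet2Z h (jet2_dot z w)))
    (jet2Z eps (jet2_dot x w)) ) _)) => a.
  have := tmax t (x + a *: w) y (ltW st) tt1.
  rewrite /Phi; have -> : x + a *: w - y = z + a *: w by rewrite addrAC.
  rewrite !scale0r !addr0 maxu -/z -/h.
  have := ln_le_max1 (u t (x + a *: w)); rewrite -(ler_pM2l p0); lra.
have gradv w : - (dot (gv t y) w / v t y) - h * (2 * dot (- z) w)
    - eps * (2 * dot y w) = 0.
  apply: (proj1 (jet2_max (jet2B (jet2B (jet2N (jetv w)) (jet2Z h (jet2_dot (- z) w)))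
    (jet2Z eps (jet2_dot y w)) ) _)) => a.
  have := tmax t x (y + a *: w) (ltW st) tt1.
  rewrite /Phi; have -> : - z + a *: w = - (x - (y + a *: w)).
    by rewrite /z !opprB addrAC.
  rewrite !scale0r !addr0 maxu dotNl dotNr opprK -/z -/h.
  rewrite dotNl dotNr opprK; lra.
have second w : p * (dot (mulmv (Hu t x) w) w / u t x
      - (dot (gu t x) w / u t x) ^+ 2) - (dot (mulmv (Hv t y) w) w / v t y
      - (dot (gv t y) w / v t y) ^+ 2)
    - eps * (2 * dot w w + 2 * dot w w) <= 0.
  apply: (proj2 (jet2_max (jet2B (jet2B (jet2Z p (jetu w)) (jetv w))
    (jet2Z eps (jet2D (jet2_dot x w) (jet2_dot y w))) ) _)) => a.
  have := tmax t (x + a *: w) (y + a *: w) (ltW st) tt1.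
  rewrite /Phi; have -> : x + a *: w - (y + a *: w) = z.
    by rewrite opprD addrACA subrr addr0.
  rewrite !scale0r !addr0 maxu -/z -/h.
  have := ln_le_max1 (u t (x + a *: w)); rewrite -(ler_pM2l p0); lra.
have time_ge0 : 0 <= p * (ut t x / u t x) - vt t y / v t y
    + h ^+ 2 / c * dot z z - eps * L.
  pose F tau := p * ln (u tau x) - ln (v tau y)
    - dot z z * c * (tau - s + eta)^-1 - (eps * L) * tau.
  have dF : is_derive (t : R) 1 F (p * (ut t x / u t x) - vt t y / v t y
      + h ^+ 2 / c * dot z z - eps * L).
    have -> : h ^+ 2 / c * dot z z = dot z z * c / (t - s + eta) ^+ 2.
      by rewrite /h expr_div_n; field; rewrite !gt_eqF.
    exact: (is_derive_doubling p _ _ u0 v0 tse (dtu t x st) (dtv t y st)).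
  apply: (left_max_derive_ge0 st dF) => tau stau taut.
  have := tmax tau x y (ltW stau) (le_trans taut tt1); rewrite /Phi maxu -/z /F.
  have := ln_le_max1 (u tau x); rewrite -(ler_pM2l p0); lra.
(* the values of p * grad u / u and grad v / v forced by the first-order
   conditions *)
pose xi := (2 * h) *: z + (2 * eps) *: x.
pose zeta := (2 * h) *: z + (- (2 * eps)) *: y.
have guE w : dot (gu t x) w / u t x = p^-1 * dot w xi.
  have E : p * (dot (gu t x) w / u t x) = dot w xi.
    by rewrite /xi dotDr !dotZr !(dotC w); have := gradu w; lra.
  by rewrite -E mulKf ?gt_eqF.
have gvE w : dot (gv t y) w / v t y = dot w zeta.
  rewrite /zeta dotDr !dotZr !(dotC w); have := gradv w; rewrite dotNl; lra.
have tr_test : p / u t x * \tr (Q t *m Hu t x)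
    + (- (v t y)^-1) * \tr (Q t *m Hv t y) <=
    p^-1 * dot (mulmv (Q t) xi) xi + (-1) * dot (mulmv (Q t) zeta) zeta
    + 4 * eps * \tr (Q t).
  apply: (trace_test Qws) => w; have := second w.
  rewrite guE gvE => H2.
  have : p * (p^-1 * dot w xi) ^+ 2 = p^-1 * dot w xi ^+ 2.
    by field; rewrite gt_eqF.
  lra.
have eu : ut t x / u t x = \tr (Q t *m Hu t x) / u t x
    + p^-1 * dot (b t x) xi.
  by rewrite equ// mulrDl (dotC (b t x)) guE.
have ev : vt t y / v t y = \tr (Q t *m Hv t y) / v t y + dot (b t y) zeta.
  by rewrite eqv// mulrDl (dotC (b t y)) gvE.
move: time_ge0; rewrite eu ev.
have -> : p * (\tr (Q t *m Hu t x) / u t x + p^-1 * dot (b t x) xi) =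
    p / u t x * \tr (Q t *m Hu t x) + dot (b t x) xi.
  by field; rewrite !gt_eqF.
have -> : dot (b t x) xi = 2 * h * dot (b t x) z + 2 * eps * dot (b t x) x.
  by rewrite /xi dotDr !dotZr.
have -> : dot (b t y) zeta = 2 * h * dot (b t y) z - 2 * eps * dot (b t y) y.
  by rewrite /zeta dotDr !dotZr mulNr.
have hb : h * dot (b t x) z - h * dot (b t y) z <= 0.
  by rewrite -mulrBr -dotBl pmulr_rle0//; exact: bxy.
have yxi := quad_young_le z x (2 * h) (2 * eps) Qws k0_gt0.
have yzeta := quad_young_ge z y (2 * h) (- (2 * eps)) Qws k0_gt0.
rewrite -/xi in yxi; rewrite -/zeta in yzeta.
set qz := dot (mulmv (Q t) z) z in yxi yzeta.
set qx := dot (mulmv (Q t) x) x in yxi.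
set qy := dot (mulmv (Q t) y) y in yzeta.
have qz_ge : eta0 * dot z z <= qz by exact: Qge.
have qx_le : qx <= Lambda * dot x x by exact: Qle.
have qy_le : qy <= Lambda * dot y y by exact: Qle.
have qx_ge : 0 <= qx by apply: le_trans (Qge x); rewrite mulr_ge0 ?dot_ge0// ltW.
have qy_ge : 0 <= qy by apply: le_trans (Qge y); rewrite mulr_ge0 ?dot_ge0// ltW.
set qxi := dot _ xi in tr_test yxi; set qzeta := dot _ zeta in tr_test yzeta.
have lead := doubling_leading_terms h p_gt1 e0 qz_ge.
rewrite -/k0 -/c in lead.
have low := doubling_penalty_terms p_gt1 k0_gt0 qx_ge qy_ge qx_le qy_le eps0
  (dot_ge0 x) (dot_ge0 y) eps_small.
have pxi : p^-1 * qxi <= p^-1 * ((1 + k0) * (2 * h) ^+ 2 * qz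
    + (1 + k0^-1) * (2 * eps) ^+ 2 * qx) by rewrite ler_pM2l ?invr_gt0.
have e1 : eps * \tr (Q t) <= eps * (Lambda * d%:R) by rewrite ler_pM2l.
have e2 : eps * dot (b t x) x <= eps * (C - kappa * dot x x).
  by rewrite ler_pM2l.
have e3 : eps * dot (b t y) y <= eps * (C - kappa * dot y y).
  by rewrite ler_pM2l.
have : eps * L = 4 * (eps * (Lambda * d%:R)) + 4 * (eps * C) + eps.
  by rewrite /L /penalty_rate; ring.
lra.
Qed.

End harnack.

Section harnack_inequality.
Context {R : realType} {d : nat}.
Local Notation V := 'rV[R]_d.
Variables (Q : R -> 'M[R]_d) (b : R -> V -> V) (s T eta0 Lambda C kappa : R).
Hypothesis coeffs : admissible Q b s T eta0 Lambda C kappa.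
Implicit Types (t : R) (x y w : V).

Variables (u v ut vt : R -> V -> R) (gu gv : R -> V -> V)
  (Hu Hv : R -> V -> 'M[R]_d).
Hypothesis solu : line_solution Q b s u ut gu Hu.
Hypothesis solv : line_solution Q b s v vt gv Hv.

(** The shift [eta] keeps [h] finite at the initial time, where the Lipschitz
    bound is absorbed by [c / eta * |x - y|^2] up to an error of order [eta];
    both [eta] and the spatial penalization [eps] then tend to zero. *)
Theorem harnack_log (p K : R) t x y :
  (forall t x, s <= t -> t <= T -> 1 <= v t x) -> 1 < p -> 0 <= K ->
  (forall x y,
     p * ln (Num.max (u s x) 1) - ln (v s y) <= K * enorm (x - y)) ->
  s < t -> t <= T ->
  p * ln (Num.max (u t x) 1) <=
    ln (v t y) + harnack_const eta0 p / (t - s) * dot (x - y) (x - y).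
Proof.
move=> v_ge1 p_gt1 K_ge0 init st tT; rewrite leNgt; apply/negP => Hlt.
have [e0 L0 C0 kap0 _] := coeffs.
pose k0 := young_gap p; pose L := penalty_rate d Lambda C.
set c := harnack_const eta0 p in Hlt *.
have k0_gt0 : 0 < k0 by exact: young_gap_gt0.
have c_gt0 : 0 < c by exact: harnack_const_gt0.
have L_gt0 : 0 < L.
  have : 0 <= Lambda * d%:R by rewrite mulr_ge0// ltW.
  by rewrite /L /penalty_rate; lra.
set lhs := p * _ in Hlt.
set gap := lhs - (ln (v t y) + c / (t - s) * dot (x - y) (x - y)).
have gap0 : 0 < gap by rewrite subr_gt0.
pose eta := gap / (2 * (K ^+ 2 / (4 * c) + 1)).
have Kc : 0 <= K ^+ 2 / (4 * c) by rewrite divr_ge0 ?sqr_ge0// mulr_ge0// ltW.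
have eta_gt0 : 0 < eta by rewrite divr_gt0// mulr_gt0//; lra.
have etaE : K ^+ 2 * eta / (4 * c) <= gap / 2.
  rewrite mulrAC /eta; set a := K ^+ 2 / (4 * c) in Kc *.
  by rewrite mulrA ler_pdivrMr; lra.
pose E := dot x x + dot y y + L * (t - s) + 1.
have E0 : 0 < E.
  have : 0 <= L * (t - s) by rewrite mulr_ge0 ?subr_ge0// ltW.
  by have := dot_ge0 x; have := dot_ge0 y; rewrite /E; lra.
pose D := 4 * (1 + k0^-1) * Lambda.
have D0 : 0 < D.
  have : 0 < k0^-1 by rewrite invr_gt0.
  by move=> ?; rewrite !mulr_gt0//; lra.
pose eps := Num.min (gap / (4 * E)) (2 * kappa / D).
have eps0 : 0 < eps.
  by rewrite lt_min; apply/andP; split; apply: divr_gt0 => //; apply: mulr_gt0.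
have epsD : 4 * eps * (1 + k0^-1) * Lambda <= 2 * kappa.
  have -> : 4 * eps * (1 + k0^-1) * Lambda = eps * D by rewrite /D; ring.
  by rewrite -ler_pdivlMr// ge_min lexx orbT.
have epsE : eps * E <= gap / 4.
  have H : eps <= gap / (4 * E) by rewrite ge_min lexx.
  apply: le_trans (ler_wpM2r (ltW E0) H) _.
  by rewrite invfM mulrA divfK ?gt_eqF.
have := doubling_bound coeffs solu solv v_ge1 p_gt1 K_ge0 init eta_gt0 eps0 epsD
  x y (ltW st) tT.
rewrite -/c -/L.
have : c / (t - s + eta) * dot (x - y) (x - y) <=
    c / (t - s) * dot (x - y) (x - y).
  apply: ler_wpM2r; first exact: dot_ge0.
  rewrite ler_pM2l// lef_pV2 ?posrE ?subr_gt0//; first lra.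
  by rewrite addr_gt0// subr_gt0.
have : eps * E = eps * (dot x x + dot y y) + eps * L * (t - s) + eps.
  by rewrite /E; ring.
rewrite -/lhs; move: gap0 etaE epsE; rewrite /gap; lra.
Qed.

End harnack_inequality.

(** * Scalar functions of the barrier *)

Section decay_rate.
Context {R : realType}.
Implicit Types (m n : nat) (X L a : R).

Lemma sqr_le_expR X : 0 <= X -> X ^+ 2 <= 16 * expR (X / 2).
Proof.
move=> X0; have X4 : 0 <= X / 4 by rewrite divr_ge0.
have : expR (X / 2) = expR (X / 4) ^+ 2.
  by rewrite expr2 -expRD; congr expR; lra.
move=> ->; have H := expR_ge1Dx (X / 4).
have : (1 + X / 4) ^+ 2 <= expR (X / 4) ^+ 2.
  by rewrite ler_pXn2r ?nnegrE ?expR_ge0//; lra.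
have := sqr_ge0 X; nra.
Qed.

(** [rate n m C] is the quotient [- h' / h] of the barrier function
    [h = exp (- m ^ n)], with [m] the inverse of the remaining time, plus the
    other terms competing with the drift. *)
Definition rate n (m C : R) := n%:R * m ^+ n.+1 + C.

Lemma rate_exp_bound n (m C : R) : (0 < n)%N -> 0 < m -> 0 <= C ->
  expR (- (m ^+ n / 2)) * rate n m C <= 17 * n%:R + C.
Proof.
move=> n0 m0 C0; set X := m ^+ n.
have X0 : 0 <= X by rewrite exprn_ge0// ltW.
have mX : m ^+ n.+1 <= 1 + X ^+ 2.
  have [m1|m1] := leP m 1.
    have : m ^+ n.+1 <= 1 by rewrite exprn_ile1// ltW.
    have := sqr_ge0 X; lra.
  have : m ^+ n.+1 <= X ^+ 2.
    by rewrite -exprM ler_eXn2l// muln2 -addnn -addn1 leq_add2l.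
  lra.
have E0 : 0 < expR (X / 2) by exact: expR_gt0.
rewrite expRN mulrC ler_pdivrMr// /rate.
have E1 : 1 <= expR (X / 2) by have := expR_ge1Dx (X / 2); lra.
have n0' : 0 <= n%:R :> R by rewrite ler0n.
have H1 := ler_wpM2l n0' mX.
have H2 := ler_wpM2l n0' (sqr_le_expR X0).
have H3 := ler_wpM2l n0' E1.
have H4 := ler_wpM2l C0 E1.
lra.
Qed.

(** Here [L] is the logarithm of [|x|].  Where the drift does not dominate the
    rate, [L] is at most [m ^ n / 4 + C']: the point is so close to the origin
    that the decay of [h] compensates.  This is where [alpha > 1] enters. *)
Lemma drift_dominates n (C K alpha : R) : (0 < n)%N -> 0 <= C -> 0 < K ->
  1 + n%:R^-1 < alpha ->
  exists2 C', 1 <= C' & forall m L : R, 0 < m -> m ^+ n / 4 + C' < L ->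
    rate n m C <= 2 * K * L `^ alpha.
Proof.
move=> n0 C0 K0 al; set be : R := 1 + n%:R^-1 in al.
have nR : 0 < n%:R :> R by rewrite ltr0n.
have be1 : 1 < be by rewrite /be ltrDl invr_gt0.
pose ga := alpha - be.
have ga0 : 0 < ga by rewrite subr_gt0.
pose A := n%:R * 4 `^ be / K.
have A0 : 0 <= A by rewrite divr_ge0 ?mulr_ge0 ?powR_ge0// ltW.
exists (1 + C / K + A `^ ga^-1).
  have : 0 <= C / K by rewrite divr_ge0// ltW.
  have := powR_ge0 A ga^-1; lra.
move=> m' L m0 XL; set X := m' ^+ n in XL.
have X0 : 0 < X by rewrite exprn_gt0.
have CK : 0 <= C / K by rewrite divr_ge0// ltW.
have Aga := powR_ge0 A ga^-1.
have L1 : 1 <= L by lra.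
have L0 : 0 < L by lra.
have mE : m' ^+ n.+1 = X `^ be.
  rewrite /X -!powR_mulrn ?ltW// -powRrM; congr (_ `^ _).
  by rewrite /be mulrDr mulr1 divff ?gt_eqF// -natr1.
have H1 : X `^ be <= 4 `^ be * L `^ be.
  rewrite -powRM ?(ltW L0)//; apply: ge0_ler_powR.
  - lra.
  - by rewrite nnegrE ltW.
  - by rewrite nnegrE mulr_ge0// ltW.
  - lra.
have H2 : A <= L `^ ga.
  have -> : A = (A `^ ga^-1) `^ ga by rewrite -powRrM mulVf ?gt_eqF// powRr1.
  by apply: ge0_ler_powR; rewrite ?nnegrE ?(ltW ga0) ?(ltW L0)//; lra.
have H3 : L `^ alpha = L `^ be * L `^ ga.
  rewrite -powRD; first by congr (_ `^ _); rewrite /ga; lra.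
  by rewrite (gt_eqF L0) implybT.
have H4 : C <= K * L `^ alpha.
  rewrite mulrC -ler_pdivrMr//; apply: (@le_trans _ _ L); first lra.
  by rewrite -[X in X <= _](powRr1 (ltW L0)); apply: ler_powR; lra.
have H5 : n%:R * m' ^+ n.+1 <= K * L `^ alpha.
  rewrite mE H3; have Lb := powR_ge0 L be.
  have : n%:R * X `^ be <= n%:R * (4 `^ be * L `^ be) by rewrite ler_pM2l.
  have : K * (L `^ be * A) <= K * (L `^ be * L `^ ga).
    by rewrite ler_pM2l// ler_wpM2l.
  have -> : K * (L `^ be * A) = n%:R * (4 `^ be * L `^ be).
    by rewrite /A; field; rewrite gt_eqF.
  lra.
rewrite /rate; lra.
Qed.

(** In the supersolution inequality [q] stands for [|x|^2], [g] and [g'] for the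
    spatial profile of the barrier and its slope, [B] for [<b, x>], and [D] for
    a bound on the trace of [Q]. *)
Lemma barrier_constant (Lambda D K alpha q0 delta l : R) :
  0 <= Lambda -> 0 <= D -> 0 < K -> 1 < alpha -> 1 < q0 -> 0 < delta -> 0 < l ->
  exists (n : nat) (c0 M : R), [/\ (0 < n)%N, 0 < c0, 0 <= M,
    c0 * expR (- (l^-1) ^+ n) = delta &
    forall m q g g' B : R, l^-1 <= m -> 0 <= q ->
      let h := c0 * expR (- m ^+ n) in
      0 <= g -> 0 <= g' -> g' <= 1 -> g <= q ->
      (q < q0 -> g = 0 /\ g' = 0) ->
      (q0 + 1 < q -> g' = 1) ->
      (q <= q0 + 1 -> g <= 1) ->
      (q0 <= q -> B <= - K * q * ln (Num.sqrt q) `^ alpha) ->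
      8 * h ^+ 2 * g' ^+ 2 * Lambda * q + h * (2 * g' * D + 4 * Lambda * q)
        + 2 * h * g' * B + n%:R * m ^+ n.+1 * h * g <= M].
Proof.
move=> La0 D0 K0 al1 q01 de0 l0.
pose n := (Num.truncn ((alpha - 1)^-1)).+1.
have n0 : (0 < n)%N by [].
have nR : 0 < n%:R :> R by rewrite ltr0n.
have nal : 1 + n%:R^-1 < alpha.
  rewrite -ltrBrDl invf_plt ?posrE ?subr_gt0//.
  by rewrite /n truncnS_gt.
pose C := 8 * delta * Lambda + 4 * Lambda.
have C0 : 0 <= C by rewrite addr_ge0 ?mulr_ge0// ltW.
have [C' C'1 HC'] := drift_dominates n0 C0 K0 nal.
pose c0 := delta * expR ((l^-1) ^+ n).
have c00 : 0 < c0 by rewrite mulr_gt0 ?expR_gt0.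
pose C9 := 17 * n%:R + C.
have C90 : 0 <= C9 by rewrite /C9 addr_ge0 ?mulr_ge0// ltW.
(* M1 bounds the points far out not yet dominated by the drift, M2 the ball *)
pose M1 := c0 * expR (2 * C') * C9.
have M10 : 0 <= M1 by rewrite /M1 !mulr_ge0 ?expR_ge0// ltW.
pose q1 := q0 + 1.
pose M2 := 8 * delta ^+ 2 * Lambda * q1 + delta * (2 * D + 4 * Lambda * q1).
have M20 : 0 <= M2.
  have q10 : 0 <= q1 by rewrite /q1; lra.
  have d0 := ltW de0; rewrite /M2; apply: addr_ge0.
    by rewrite !mulr_ge0 ?sqr_ge0.
  by rewrite mulr_ge0// addr_ge0// !mulr_ge0.
exists n, c0, (M1 + M2); split => //.
- exact: addr_ge0.
- by rewrite /c0 -mulrA -expRD subrr expR0 mulr1.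
move=> m q g g' B lm q_ge0 h g0 g'0 g'1 gq gzero g'one gsmall drift.
have m0 : 0 < m by apply: lt_le_trans lm; rewrite invr_gt0.
have X0 : 0 <= m ^+ n by rewrite exprn_ge0// ltW.
have h0 : 0 < h by rewrite mulr_gt0 ?expR_gt0.
have hde : h <= delta.
  rewrite /h /c0 -mulrA -expRD; apply: ler_piMr; first exact: ltW.
  rewrite -[leRHS]expR0 ler_expR subr_le0 ler_pXn2r ?nnegrE//.
    by rewrite invr_ge0 ltW.
  exact: ltW.
have rate0 : 0 <= rate n m C.
  by rewrite addr_ge0// mulr_ge0// exprn_ge0// ltW.
have hP a : 0 <= a -> a <= m ^+ n / 2 + 2 * C' ->
    h * expR a * rate n m C <= M1.
  move=> a0 aX; have Hr := rate_exp_bound n0 m0 C0.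
  have -> : h * expR a * rate n m C =
      c0 * (expR (a - m ^+ n / 2) * (expR (- (m ^+ n / 2)) * rate n m C)).
    rewrite /h !mulrA; congr (_ * _); rewrite -!mulrA -!expRD.
    by congr (_ * expR _); lra.
  rewrite /M1 -mulrA ler_pM2l//; apply: ler_pM => //.
    by rewrite mulr_ge0 ?expR_ge0.
  by rewrite ler_expR; lra.
have hq : 8 * h ^+ 2 * g' ^+ 2 * Lambda * q <= 8 * (delta * h) * Lambda * q.
  have : h ^+ 2 * g' ^+ 2 <= delta * h * 1.
    apply: ler_pM; rewrite ?sqr_ge0 ?expr2 ?ler_pM2r//.
    by rewrite mulr_ile1.
  move=> H; have := ler_wpM2r (mulr_ge0 La0 q_ge0) H; lra.
have gD : 2 * h * g' * D <= 2 * delta * D.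
  have : h * g' <= delta * 1 by apply: ler_pM => //; exact: ltW.
  move=> H; have := ler_wpM2r D0 H; lra.
have [q_big|q_small] := ltP (q0 + 1) q; last first.
  have Bneg : 2 * h * g' * B <= 0.
    have [qq0|qq0] := ltP q q0; first by have [_ ->] := gzero qq0; lra.
    have : B <= 0.
      apply: le_trans (drift qq0) _; rewrite !mulNr oppr_le0.
      by rewrite !mulr_ge0 ?powR_ge0// ltW.
    by move=> B0; rewrite mulr_ge0_le0// !mulr_ge0// ltW.
  have gP : n%:R * m ^+ n.+1 * h * g <= M1.
    have H0 := hP 0 (lexx 0) _; rewrite expR0 mulr1 in H0.
    have {}H0 : h * rate n m C <= M1 by apply: H0; lra.
    have P0 : 0 <= n%:R * m ^+ n.+1 by rewrite mulr_ge0// exprn_ge0// ltW.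
    have H1 : n%:R * m ^+ n.+1 * h * g <= n%:R * m ^+ n.+1 * h.
      by rewrite ler_piMr ?gsmall// mulr_ge0// ltW.
    have : 0 <= h * C by rewrite mulr_ge0// ltW.
    move: H0; rewrite /rate; lra.
  have H2 : h * (Lambda * q) <= delta * (Lambda * q1).
    apply: ler_pM => //; rewrite ?mulr_ge0//; first exact: ltW.
    by rewrite ler_wpM2l.
  have H3 := ler_wpM2l (ltW de0) H2.
  rewrite /M2; lra.
have g'E := g'one q_big; rewrite g'E expr1n mulr1 in hq gD *.
have q_gt0 : 0 < q by lra.
set La := ln (Num.sqrt q) in drift.
have qE : q = expR (2 * La).
  have -> : expR (2 * La) = expR La ^+ 2 by rewrite expr2 -expRD; congr expR; lra.
  by rewrite /La lnK ?posrE ?sqrtr_gt0// sqr_sqrtr.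
have La_ge0 : 0 <= La.
  by rewrite ln_ge0// -(sqrtr1 R) ler_wsqrtr//; lra.
have hB : h * B <= h * (- K * q * La `^ alpha).
  by rewrite ler_pM2l//; apply: drift; lra.
have hg : n%:R * m ^+ n.+1 * h * g <= n%:R * m ^+ n.+1 * h * q.
  by rewrite ler_wpM2l// !mulr_ge0// ?exprn_ge0// ltW.
have main : h * q * (rate n m C - 2 * K * La `^ alpha) <= M1.
  have [dom|ndom] := leP (rate n m C) (2 * K * La `^ alpha).
    apply: le_trans M10; rewrite mulr_ge0_le0 ?subr_le0//.
    by rewrite mulr_ge0// ltW.
  have LaX : La <= m ^+ n / 4 + C'.
    by rewrite leNgt; apply: contraTN ndom => /(HC' _ _ m0); rewrite leNgt.
  apply: (@le_trans _ _ (h * q * rate n m C)).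
    apply: ler_wpM2l; first by rewrite mulr_ge0// ltW.
    have := powR_ge0 La alpha => P0; have := mulr_ge0 (ltW K0) P0; lra.
  by rewrite {1}qE; apply: hP; lra.
move: main; rewrite /rate /C; rewrite /M2.
have : 0 <= 8 * delta ^+ 2 * Lambda * q1 by rewrite !mulr_ge0 ?sqr_ge0// /q1; lra.
have : 0 <= delta * (Lambda * q1) by rewrite !mulr_ge0// ?ltW// /q1; lra.
lra.
Qed.

End decay_rate.

Section huber_function.
Context {R : realType}.
Implicit Types (s a : R).

(** The barrier must be constant near the origin, where the drift is not
    controlled, and linear in [|x|^2] far away; a second derivative bounded by
    one makes parabolas touch it from above. *)
Definition dhuber s := Num.max 0 (Num.min s 1).
Definition huber s := dhuber s * s - dhuber s ^+ 2 / 2.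

Lemma dhuber_cases s : [\/ s <= 0 /\ dhuber s = 0,
  [/\ 0 <= s, s <= 1 & dhuber s = s] | 1 <= s /\ dhuber s = 1].
Proof.
have [s0|s0] := leP s 0.
  by constructor 1; split=> //; rewrite /dhuber min_l ?max_l//; lra.
have [s1|s1] := leP s 1.
  by constructor 2; split; rewrite ?ltW// /dhuber min_l// max_r// ltW.
by constructor 3; split; rewrite ?ltW// /dhuber min_r ?ltW// max_r.
Qed.

Lemma huber_ge0 s : 0 <= huber s.
Proof.
have [[? E]|[? ? E]|[? E]] := dhuber_cases s; rewrite /huber E; try lra.
by have := sqr_ge0 s; lra.
Qed.

Lemma huber_semiconcave s a :
  huber a <= huber s + dhuber s * (a - s) + (a - s) ^+ 2 / 2.
Proof.
have H := sqr_ge0 (a - s).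
have [[? E]|[? ? E]|[? E]] := dhuber_cases s;
  have [[? E']|[? ? E']|[? E']] := dhuber_cases a; rewrite /huber E E'; nra.
Qed.

Lemma huber_ge s : s - 1 / 2 <= huber s.
Proof.
have H := sqr_ge0 (s - 1).
by have [[? E]|[? ? E]|[? E]] := dhuber_cases s; rewrite /huber E; lra.
Qed.

Lemma huber_neg s : s < 0 -> huber s = 0 /\ dhuber s = 0.
Proof.
move=> s0; rewrite /huber.
by have [[? ->]|[? ? ->]|[? ->]] := dhuber_cases s; split; lra.
Qed.

Lemma dhuber_eq1 s : 1 < s -> dhuber s = 1.
Proof. by move=> s1; have [[? ->]|[? ? ->]|[? ->]] := dhuber_cases s; lra. Qed.

Lemma huber_le1 s : s <= 1 -> huber s <= 1.
Proof.
move=> s1; rewrite /huber.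
by have [[? ->]|[? ? ->]|[? ->]] := dhuber_cases s; nra.
Qed.

Lemma huber_le s a : s <= a -> 0 <= a -> huber s <= a.
Proof.
move=> sa a0; rewrite /huber.
by have [[? ->]|[? ? ->]|[? ->]] := dhuber_cases s; nra.
Qed.

Lemma huber_continuous : continuous huber.
Proof.
suff cd : continuous dhuber.
  by move=> s; apply: cvgB; [apply: cvgM => //; exact: cd|
    apply: cvgMr_tmp; apply: (cvgM (cd s) (cd s))].
move=> s; apply: (@continuous_max R R (cst 0) (fun s => Num.min s 1)).
  exact: cvg_cst.
by apply: (@continuous_min R R id (cst 1)); [exact: cvg_id|exact: cvg_cst].
Qed.

End huber_function.

(** * Supersolution coming down from infinity *)

Section barrier.
Context {R : realType} {d : nat}.
Local Notation V := 'rV[R]_d.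
Implicit Types (x y w : V).

Lemma jet2_sqr (F : R -> R) (b c : R) : jet2 F b c ->
  jet2 (fun s => F s ^+ 2) (2 * F 0 * b) (2 * b ^+ 2 + 2 * F 0 * c).
Proof.
move=> [F' [dF <- dF']].
have dF0 : is_derive (0 : R) 1 F (F' 0) by exact: nbhs_singleton dF.
exists (fun s => 2 * F s * F' s); split => //.
  apply: filterS dF => s dFs.
  have := @is_deriveX R R F 2 s 1 _ dFs.
  by rewrite expr1.
have := @is_deriveM R R _ _ _ _ _ _ (@is_deriveZ R R R _ 2 _ _ _ dF0) dF'.
set D1 := (X in is_derive _ _ _ X -> _) => H.
have -> : 2 * F' 0 ^+ 2 + 2 * F 0 * c = D1.
  rewrite /D1 /GRing.scale/= -[2 *: F 0]/(2 * F 0); ring.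
exact: H.
Qed.

Definition barrier_slope (c0 t : R) n (tau : R) : R :=
  c0 * expR (- ((t - tau)^-1) ^+ n).

Lemma is_derive_barrier_slope (c0 t : R) n tau : tau < t -> (0 < n)%N ->
  is_derive (tau : R) 1 (barrier_slope c0 t n)
    (- (n%:R * ((t - tau)^-1) ^+ n.+1 * barrier_slope c0 t n tau)).
Proof.
move=> taut n0.
have neq0 : t - tau != 0 by rewrite gt_eqF// subr_gt0.
have dlin : is_derive (tau : R) 1 (fun r : R => t - r) (-1).
  have := @is_deriveB R R R _ _ tau 1 _ _ (is_derive_cst t tau 1)
    (is_derive_id tau 1).
  by rewrite sub0r.
have dinv := @is_deriveV R (fun r => t - r) tau (-1) 1 neq0 dlin.
have dX := @is_deriveX R R _ n tau 1 _ dinv.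
rewrite exprfctE in dX.
have dpow := @is_deriveN R R R _ tau 1 _ dX.
have dexp := @is_derive1_comp R (@expR R) _ tau _ _ (is_derive_expR _) dpow.
have := @is_deriveZ R R R _ c0 tau 1 _ dexp.
set D1 := (X in is_derive _ _ _ X -> _) => H.
suff -> : - (n%:R * ((t - tau)^-1) ^+ n.+1 * barrier_slope c0 t n tau) = D1.
  exact: H.
rewrite /D1 /barrier_slope opprfctE /GRing.scale/=.
have -> : (t - tau) ^- 2 = (t - tau)^-1 ^+ 2 by rewrite exprVn.
case: n n0 {dX dpow dexp D1 H} => // n _ /=.
move: ((t - tau)^-1) => m; rewrite !exprS expr0; ring.
Qed.

Lemma barrier_slope_le (c0 t : R) n tau : 0 < c0 -> (0 < n)%N -> tau < t ->
  t - tau <= 1 -> barrier_slope c0 t n tau <= c0 * (t - tau).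
Proof.
move=> c00 n0 taut t1; rewrite /barrier_slope ler_pM2l//.
have st0 : 0 < t - tau by rewrite subr_gt0.
set m := (t - tau)^-1.
have m1 : 1 <= m by rewrite invf_ge1.
have m0 : 0 < m by lra.
have mn : m <= m ^+ n by rewrite ler_eXnr.
rewrite expRN -[t - tau]invrK lef_pV2 ?posrE ?expR_gt0 ?invr_gt0//.
have := expR_ge1Dx (m ^+ n); rewrite -/m; lra.
Qed.

Variables (Q : R -> 'M[R]_d) (b : R -> V -> V).
Variables (r t eta0 Lambda C kappa : R).
Hypothesis coeffs : admissible Q b r t eta0 Lambda C kappa.
Variables (u ut : R -> V -> R) (gu : R -> V -> V) (Hu : R -> V -> 'M[R]_d).
Hypothesis solu : line_solution Q b r u ut gu Hu.

(** The spatial profile is not twice differentiable, but at each point a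
    quadratic polynomial in [|x|^2] touches it from above, and testing with that
    polynomial is enough for a comparison from above. *)
Lemma barrier_comparison n (c0 M k q0 K alpha : R) :
  (forall tau x, r <= tau -> tau <= t -> q0 <= dot x x ->
     dot (b tau x) x <= - K * dot x x * ln (Num.sqrt (dot x x)) `^ alpha) ->
  (0 < n)%N -> 0 < c0 -> 0 <= M -> 0 <= k -> 1 < q0 -> r < t ->
  (forall m q g g' B : R, (t - r)^-1 <= m -> 0 <= q ->
      let h := c0 * expR (- m ^+ n) in
      0 <= g -> 0 <= g' -> g' <= 1 -> g <= q ->
      (q < q0 -> g = 0 /\ g' = 0) ->
      (q0 + 1 < q -> g' = 1) ->
      (q <= q0 + 1 -> g <= 1) ->
      (q0 <= q -> B <= - K * q * ln (Num.sqrt q) `^ alpha) ->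
      8 * h ^+ 2 * g' ^+ 2 * Lambda * q
        + h * (2 * g' * (Lambda * d%:R) + 4 * Lambda * q)
        + 2 * h * g' * B + n%:R * m ^+ n.+1 * h * g <= M) ->
  (forall x, ln (Num.max (u r x) 1) <=
     k + barrier_slope c0 t n r * huber (dot x x - q0)) ->
  forall t' x, r <= t' -> t' < t -> ln (Num.max (u t' x) 1) <=
     k + M * (t' - r) + barrier_slope c0 t n t' * huber (dot x x - q0).
Proof.
move=> growth n0 c00 M0 k_ge0 q01 rt Hrate init t1 x1 rt1 t1t.
rewrite leNgt; apply/negP => Hgap.
have [e0 L0 C0 kap0 HQb] := coeffs.
have [[_ [Mu HM]] dtu _ _ equ] := solu.
set h := barrier_slope c0 t n in init Hgap *.
pose g x := huber (dot x x - q0).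
rewrite -/(g x1) in Hgap.
have h_gt0 tau : 0 < h tau by rewrite mulr_gt0// expR_gt0.
pose gap := ln (Num.max (u t1 x1) 1) - (k + M * (t1 - r) + h t1 * g x1).
have gap0 : 0 < gap by rewrite subr_gt0.
pose D := Lambda * d%:R.
have D0 : 0 <= D by rewrite mulr_ge0// ltW.
pose L := 2 * D + 2 * C + 1.
have L_gt0 : 0 < L by rewrite /L; lra.
pose E := dot x1 x1 + L * (t1 - r) + 1.
have E0 : 0 < E.
  have : 0 <= L * (t1 - r) by rewrite mulr_ge0 ?subr_ge0// ltW.
  by have := dot_ge0 x1; rewrite /E; lra.
pose eps := Num.min (gap / (2 * E)) (kappa / (4 * Lambda)).
have eps0 : 0 < eps.
  by rewrite lt_min; apply/andP; split; apply: divr_gt0 => //; apply: mulr_gt0.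
have epsL : 8 * eps * Lambda <= 2 * kappa.
  have : eps <= kappa / (4 * Lambda) by rewrite ge_min lexx orbT.
  by rewrite ler_pdivlMr ?mulr_gt0//; lra.
have epsE : eps * E <= gap / 2.
  have H : eps <= gap / (2 * E) by rewrite ge_min lexx.
  apply: le_trans (ler_wpM2r (ltW E0) H) _.
  by rewrite invfM mulrA divfK ?gt_eqF.
have max1_gt0 (a : R) : 0 < Num.max a 1 by rewrite lt_max ltr01 orbT.
have g_ge0 x : 0 <= g x by exact: huber_ge0.
pose Phi tau x := ln (Num.max (u tau x) 1) - M * (tau - r) - h tau * g x
  - eps * dot x x - eps * L * (tau - r).
have [||tau [x [rtau taut1 tmax]]] := @penalized_max R d r t1 eps
    (ln (Num.max Mu 1)) Phi rt1 eps0.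
- move=> S F ta xi tau x FF tin taun cta cxi.
  have tin' : r <= tau <= t by case/andP: tin => -> /le_trans->//; exact: ltW.
  have taun' : \forall a \near F, r <= ta a <= t.
    by apply: filterS taun => a /andP[-> /le_trans->//]; exact: ltW.
  have ctar : ta a - r @[a --> F] --> tau - r.
    by apply: cvgB => //; exact: cvg_cst.
  have cu : ln (Num.max (u (ta a) (xi a)) 1) @[a --> F]
      --> ln (Num.max (u tau x) 1).
    have cu := line_solution_slab solu FF tin' taun' cta cxi.
    have cmax : Num.max (u (ta a) (xi a)) 1 @[a --> F] --> Num.max (u tau x) 1.
      rewrite maxr_absE; under eq_fun => a do rewrite maxr_absE.
      apply: cvgMr_tmp; apply: cvgD; first by apply: cvgD => //; exact: cvg_cst.
      by apply: cvg_norm; apply: cvgB => //; exact: cvg_cst.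
    by apply: (cvg_comp _ _ cmax); exact: continuous_ln.
  have cd := cvg_dot FF cxi cxi.
  have ch : h (ta a) @[a --> F] --> h tau.
    apply: (cvg_comp _ _ cta).
    apply: differentiable_continuous; apply/derivable1_diffP.
    have tt : tau < t by case/andP: tin => _ /le_lt_trans; exact.
    by case: (is_derive_barrier_slope c0 tt n0).
  have cg : g (xi a) @[a --> F] --> g x.
    have cd' : dot (xi a) (xi a) - q0 @[a --> F] --> dot x x - q0.
      by apply: cvgB => //; exact: cvg_cst.
    by apply: (cvg_comp _ _ cd'); exact: huber_continuous.
  apply: cvgB; last by apply: cvgMl_tmp; exact: ctar.
  apply: cvgB; last by apply: cvgMl_tmp; exact: cd.
  apply: cvgB; last exact: cvgM.
  by apply: cvgB => //; apply: cvgMl_tmp; exact: ctar.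
- move=> tau x rtau _; rewrite /Phi.
  have : 0 <= eps * L * (tau - r).
    by rewrite mulr_ge0 ?subr_ge0// mulr_ge0// ltW.
  have : 0 <= M * (tau - r) by rewrite mulr_ge0 ?subr_ge0.
  have : 0 <= h tau * g x by rewrite mulr_ge0// ltW.
  have : ln (Num.max (u tau x) 1) <= ln (Num.max Mu 1).
    rewrite ler_ln ?posrE// ge_max !le_max lexx orbT andbT.
    by have := HM tau x rtau; rewrite ler_norml => /andP[_ ->].
  lra.
have Phi_tx : k < Phi tau x.
  apply: lt_le_trans (tmax t1 x1 rt1 (lexx _)); rewrite /Phi.
  have : eps * E = eps * dot x1 x1 + eps * L * (t1 - r) + eps.
    by rewrite /E; ring.
  move: gap0 epsE; rewrite /gap; lra.
have taut : tau < t by exact: le_lt_trans t1t.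
have {}rtau : r < tau.
  rewrite lt_def rtau andbT; apply/eqP => ts; move: Phi_tx; rewrite ts /Phi.
  rewrite subrr !mulr0; have := init x; rewrite -/(g x).
  have : 0 <= eps * dot x x by rewrite mulr_ge0 ?dot_ge0// ltW.
  lra.
have [[[ws Qws] trQ] _ Qle bx _] := HQb tau (ltW rtau) (ltW taut).
have u1 : 1 < u tau x.
  rewrite ltNge; apply/negP => u1; move: Phi_tx; rewrite /Phi max_r// ln1.
  have : 0 <= eps * L * (tau - r).
    by rewrite mulr_ge0 ?subr_ge0 1?ltW// mulr_gt0.
  have : 0 <= M * (tau - r) by rewrite mulr_ge0// subr_ge0 ltW.
  have : 0 <= h tau * g x by rewrite mulr_ge0// ltW.
  have : 0 <= eps * dot x x by rewrite mulr_ge0 ?dot_ge0// ltW.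
  lra.
have u0 : 0 < u tau x by exact: lt_trans ltr01 u1.
have maxu : Num.max (u tau x) 1 = u tau x by rewrite max_l// ltW.
pose q := dot x x.
pose g' := dhuber (q - q0).
pose m := (t - tau)^-1.
have hE : h tau = c0 * expR (- m ^+ n) by [].
have h0 := h_gt0 tau.
(* test with huber s0 + g' * (q' - q) + (q' - q) ^ 2 / 2, where q' is the value
   of |.|^2 along the line *)
have touch w : dot (gu tau x) w / u tau x
      - h tau * (g' * (2 * dot x w) + 2^-1 * (2 * (q - q) * (2 * dot x w)))
      - eps * (2 * dot x w) = 0 /\
    dot (mulmv (Hu tau x) w) w / u tau x - (dot (gu tau x) w / u tau x) ^+ 2
      - h tau * (g' * (2 * dot w w) + 2^-1 * (2 * (2 * dot x w) ^+ 2
          + 2 * (q - q) * (2 * dot w w)))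
      - eps * (2 * dot w w) <= 0.
  have ju := jet2_ln _ (line_solution_jet2 x w solu rtau).
  rewrite scale0r addr0 in ju.
  have jq : jet2 (fun a : R => dot (x + a *: w) (x + a *: w) - q)
      (2 * dot x w) (2 * dot w w).
    have := jet2B (jet2_dot x w) (jet2_quadratic q 0 0).
    rewrite mulr0 !subr0; congr (jet2 _ _ _).
    by apply/funext => a; rewrite !mul0r !addr0.
  have jq2 := jet2_sqr jq; rewrite scale0r addr0 -/q in jq2.
  have jall := jet2B (jet2B (ju u0) (jet2Z (h tau)
    (jet2D (jet2Z g' jq) (jet2Z 2^-1 jq2)))) (jet2Z eps (jet2_dot x w)).
  apply: (jet2_max jall) => a.
  rewrite !scale0r !addr0 -/q subrr expr0n/= !mulr0 addr0 mulr0 subr0.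
  have := tmax tau (x + a *: w) (ltW rtau) taut1; rewrite /Phi maxu -/q.
  have := ln_le_max1 (u tau (x + a *: w)).
  set q' := dot (x + a *: w) (x + a *: w).
  have := huber_semiconcave (q - q0) (q' - q0); rewrite -/g'.
  rewrite (_ : q' - q0 - (q - q0) = q' - q); last by ring.
  rewrite -[huber (q - q0)]/(g x) -[huber (q' - q0)]/(g (x + a *: w)).
  by move=> /(ler_wpM2l (ltW h0)); lra.
have guE w : dot (gu tau x) w / u tau x = 2 * (h tau * g' + eps) * dot w x.
  by rewrite (dotC w); have [] := touch w; lra.
have time_ge0 : 0 <= ut tau x / u tau x - M
    + n%:R * m ^+ n.+1 * h tau * g x - eps * L.
  pose F s := ln (u s x) - g x * h s - (M + eps * L) * s.
  have dF : is_derive (tau : R) 1 F (ut tau x / u tau x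
      - g x * (- (n%:R * m ^+ n.+1 * h tau)) - (M + eps * L)).
    have du := is_derive_ln_comp u0 (dtu tau x rtau).
    have dh := is_derive_barrier_slope c0 taut n0.
    have := @is_deriveB R R R _ _ tau 1 _ _ (@is_deriveB R R R _ _ tau 1 _ _ du
      (@is_deriveZ R R R _ (g x) tau 1 _ dh))
      (@is_deriveZ R R R id (M + eps * L) tau 1 _ (is_derive_id tau 1)).
    by rewrite [_ *: 1]mulr1.
  have H : 0 <= ut tau x / u tau x
      - g x * (- (n%:R * m ^+ n.+1 * h tau)) - (M + eps * L).
    apply: (left_max_derive_ge0 rtau dF) => s rs stau.
    have := tmax s x (ltW rs) (le_trans stau taut1); rewrite /Phi maxu /F.
    have := ln_le_max1 (u s x); lra.
  lra.
have tr_test : (u tau x)^-1 * \tr (Q tau *m Hu tau x)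
    + 0 * \tr (Q tau *m Hu tau x) <=
    (4 * (h tau * g' + eps) ^+ 2 + 4 * h tau) * dot (mulmv (Q tau) x) x
    + 0 * dot (mulmv (Q tau) x) x + 2 * (h tau * g' + eps) * \tr (Q tau).
  apply: (trace_test Qws) => w; have [_] := touch w.
  by rewrite guE subrr (dotC w x) !mulr0 mul0r; lra.
have g'0 : 0 <= g' by rewrite le_max lexx.
have g'1 : g' <= 1 by rewrite ge_max ler01 ge_min lexx orbT.
have q_ge0 : 0 <= q by exact: dot_ge0.
have key : 8 * h tau ^+ 2 * g' ^+ 2 * Lambda * q
    + h tau * (2 * g' * D + 4 * Lambda * q)
    + 2 * h tau * g' * dot (b tau x) x + n%:R * m ^+ n.+1 * h tau * g x <= M.
  apply: (Hrate m q (g x) g' (dot (b tau x) x)) => //.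
  - by rewrite /m lef_pV2 ?posrE ?subr_gt0// lerD2l lerN2 ltW.
  - by rewrite /g -/q; apply: huber_le => //; lra.
  - by move=> qq0; rewrite /g /g' -/q; apply: huber_neg; rewrite subr_lt0.
  - by move=> qq0; apply: dhuber_eq1; lra.
  - by move=> qq0; rewrite /g -/q; apply: huber_le1; lra.
  - by move=> qq0; apply: growth => //; exact: ltW.
move: time_ge0; rewrite equ// mulrDl (dotC (b tau x)) guE -/q.
set T1 := \tr (Q tau *m Hu tau x) in tr_test *.
set qx := dot (mulmv (Q tau) x) x in tr_test.
have qx_le : qx <= Lambda * q by exact: Qle.
have bxC : dot (b tau x) x <= C - kappa * q by exact: bx.
have hg0 : 0 <= h tau * g' by rewrite mulr_ge0// ltW.
have H1 : (4 * (h tau * g' + eps) ^+ 2 + 4 * h tau) * qx <=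
    (8 * (h tau * g') ^+ 2 + 8 * eps ^+ 2 + 4 * h tau) * (Lambda * q).
  have qx0 : 0 <= qx.
    by rewrite /qx (dot_sum_rank1 _ Qws) sumr_ge0// => w _; exact: sqr_ge0.
  have S1 := sqr_ge0 (h tau * g' - eps).
  have S2 := sqr_ge0 (h tau * g' + eps).
  apply: ler_pM => //; [clear -S2 h0|clear -S1]; lra.
have H2 : 2 * (h tau * g' + eps) * \tr (Q tau) <= 2 * (h tau * g' + eps) * D.
  by rewrite ler_wpM2l// mulr_ge0// addr_ge0// ltW.
have H3 : eps * dot (b tau x) x <= eps * (C - kappa * q) by rewrite ler_pM2l.
have H4 : eps * q * (8 * eps * Lambda) <= eps * q * (2 * kappa).
  by rewrite ler_wpM2l// mulr_ge0// ltW.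
have H5 : eps * L = 2 * (eps * D) + 2 * (eps * C) + eps by rewrite /L; ring.
lra.
Qed.

End barrier.

Section come_down.
Context {R : realType} {d : nat}.
Local Notation V := 'rV[R]_d.
Implicit Types (x y w : V).

(** As the final time is approached the slope of the barrier tends to zero, so
    only its constant part survives, uniformly in space. *)
Lemma barrier_limit (u ut : R -> V -> R) (r t c0 A B : R) n x :
  is_derive t 1 (u ^~ x) (ut t x) ->
  r < t -> 0 < c0 -> (0 < n)%N -> 0 <= B ->
  (forall t', r <= t' -> t' < t ->
     ln (Num.max (u t' x) 1) <= A + barrier_slope c0 t n t' * B) ->
  ln (Num.max (u t x) 1) <= A.
Proof.
move=> du rt c00 n0 B0 H; rewrite leNgt; apply/negP => Alt.
have cu : u s x @[s --> t] --> u t x.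
  have : {for t, continuous (u ^~ x)}.
    by apply: differentiable_continuous; apply/derivable1_diffP; case: du.
  exact.
have max1_gt0 (a : R) : 0 < Num.max a 1 by rewrite lt_max ltr01 orbT.
have cl : ln (Num.max (u s x) 1) - c0 * (t - s) * B @[s --> t] -->
    ln (Num.max (u t x) 1) - c0 * (t - t) * B.
  apply: cvgB.
    have cmax : Num.max (u s x) 1 @[s --> t] --> Num.max (u t x) 1.
      rewrite maxr_absE; under eq_fun => a do rewrite maxr_absE.
      apply: cvgMr_tmp; apply: cvgD; first by apply: cvgD => //; exact: cvg_cst.
      by apply: cvg_norm; apply: cvgB => //; exact: cvg_cst.
    by apply: (cvg_comp _ _ cmax); exact: continuous_ln.
  apply: cvgMr_tmp; apply: cvgMl_tmp; apply: cvgB; first exact: cvg_cst.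
  exact: cvg_id.
rewrite subrr mulr0 mul0r subr0 in cl.
have [e /= e0 He] := (nbhs_ballP _ _).1 (cvgr_gt _ cl _ Alt).
pose m := Num.min e (Num.min 1 (t - r)) / 2.
have mm : 0 < Num.min e (Num.min 1 (t - r)).
  by rewrite !lt_min e0 ltr01 subr_gt0.
have : [/\ Num.min e (Num.min 1 (t - r)) <= e,
    Num.min e (Num.min 1 (t - r)) <= 1 &
    Num.min e (Num.min 1 (t - r)) <= t - r].
  by split; rewrite !ge_min lexx ?orbT.
move=> [m1 m2 m3]; have [m4 m5] : 0 < m /\ m < Num.min e (Num.min 1 (t - r)).
  by rewrite /m; split; lra.
have := He (t - m); rewrite /ball/= opprB addrCA subrr addr0 gtr0_norm//.
move=> /(_ (lt_le_trans m5 m1)).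
have := H (t - m) _ _.
move=> /(_ ltac:(lra) ltac:(lra)).
(* at the time t - m the slope is at most c0 * m, so He contradicts H *)
have bs : barrier_slope c0 t n (t - m) * B <= c0 * (t - (t - m)) * B.
  by apply: ler_wpM2r => //; apply: barrier_slope_le => //; lra.
rewrite opprB addrCA subrr addr0 in bs; lra.
Qed.

(** Coming down from infinity in a time [l]: the bound [M] does not depend on
    the coefficients beyond the ellipticity and growth constants. *)
Lemma come_down (Lambda K alpha R0 delta l : R) :
  0 < Lambda -> 0 < K -> 1 < alpha -> 1 < R0 -> 0 < delta -> 0 < l ->
  exists2 M : R, 0 <= M &
  forall (Q : R -> 'M[R]_d) (b : R -> V -> V) (t eta0 C kappa : R)
    (u ut : R -> V -> R) (gu : R -> V -> V) (Hu : R -> V -> 'M[R]_d) (k : R),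
  admissible Q b (t - l) t eta0 Lambda C kappa ->
  line_solution Q b (t - l) u ut gu Hu ->
  (forall tau x, t - l <= tau -> tau <= t -> R0 <= enorm x ->
     dot (b tau x) x <= - K * enorm x ^+ 2 * ln (enorm x) `^ alpha) ->
  0 <= k ->
  (forall x, ln (Num.max (u (t - l) x) 1) <=
     k + delta * huber (dot x x - R0 ^+ 2)) ->
  forall x, ln (Num.max (u t x) 1) <= k + M.
Proof.
move=> L0 K0 al1 R01 de0 l0.
have q01 : 1 < R0 ^+ 2 by rewrite expr2; nra.
have D0 : 0 <= Lambda * d%:R by rewrite mulr_ge0// ltW.
have [n [c0 [M [n0 c00 M0 c0E rate]]]] :=
  barrier_constant (ltW L0) D0 K0 al1 q01 de0 l0.
exists (M * l); first by rewrite mulr_ge0// ltW.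
move=> Q b t eta0 C kappa u ut gu Hu k coeffs solu growth k0 init x.
have rt : t - l < t by rewrite gtrBl.
have tl : t - (t - l) = l by ring.
have slope0 : barrier_slope c0 t n (t - l) = delta by rewrite /barrier_slope tl.
have [_ du _ _ _] := solu.
apply: (@barrier_limit u ut (t - l) t c0 (k + M * l)
  (huber (dot x x - R0 ^+ 2)) n x) => //.
- exact: du.
- exact: huber_ge0.
move=> t' rt' t't.
have := @barrier_comparison R d Q b (t - l) t eta0 Lambda C kappa coeffs u ut gu
  Hu solu n c0 M k (R0 ^+ 2) K alpha _ n0 c00 M0 k0 q01 rt _ _ t' x rt' t't.
have H1 : M * (t' - (t - l)) <= M * l by rewrite ler_wpM2l//; lra.
rewrite tl slope0 => H.
apply: (@le_trans _ _ (k + M * (t' - (t - l)) +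
  barrier_slope c0 t n t' * huber (dot x x - R0 ^+ 2))); last lra.
apply: H => // tau y rtau taut R0y.
rewrite -enorm_sqr sqrtr_sqr ger0_norm ?sqrtr_ge0//; apply: growth => //.
rewrite -enorm_sqr ler_pXn2r ?nnegrE ?sqrtr_ge0// in R0y.
by move: R01; lra.
Qed.

End come_down.

(** * Density of bounded Lipschitz functions *)

Section lipschitz_functions.
Context {R : realType} {d : nat}.
Local Notation W := 'rV[R]_d.
Implicit Types (f g : W -> R) (x y : W).

Definition bounded_lipschitz f := (exists2 K : R, 0 <= K &
  forall x y, `|f x - f y| <= K * `|x - y|) /\ (exists M : R, forall x, `|f x| <= M).

Lemma bounded_lipschitz_continuous f : bounded_lipschitz f -> continuous f.
Proof.
move=> [[K K0 fK] _].
suff H (x : W) : {for x, continuous f} by move=> x; exact: H.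
apply/(@cvgrPdist_le _ _ _ (nbhs x) (nbhs_filter x)) => eps eps0.
have K1 : 0 < K + 1 by lra.
apply/nbhs_ballP; exists (eps / (K + 1)) => /=; first by rewrite divr_gt0.
move=> y; rewrite -ball_normE /ball_/= ltr_pdivlMr// => xy.
apply: le_trans (fK x y) _.
have : 0 <= `|x - y| by []. lra.
Qed.

Lemma bounded_lipschitz_cst (c : R) : bounded_lipschitz (fun=> c).
Proof.
split; last by exists `|c|.
by exists 0 => // x y; rewrite subrr normr0 mul0r.
Qed.

Lemma bounded_lipschitzD f g : bounded_lipschitz f -> bounded_lipschitz g ->
  bounded_lipschitz (fun x => f x + g x).
Proof.
move=> [[K K0 fK] [M fM]] [[K' K'0 gK] [M' gM]]; split.
  exists (K + K'); first exact: addr_ge0.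
  move=> x y; rewrite opprD addrACA mulrDl; apply: le_trans (ler_normD _ _) _.
  exact: lerD.
by exists (M + M') => x; apply: le_trans (ler_normD _ _) _; exact: lerD.
Qed.

Lemma bounded_lipschitzZ (c : R) f : bounded_lipschitz f ->
  bounded_lipschitz (fun x => c * f x).
Proof.
move=> [[K K0 fK] [M fM]]; split.
  exists (`|c| * K); first exact: mulr_ge0.
  by move=> x y; rewrite -mulrBr normrM -mulrA ler_wpM2l.
by exists (`|c| * M) => x; rewrite normrM ler_wpM2l.
Qed.

Lemma ler_dist_max (a b c e : R) :
  `|Num.max a b - Num.max c e| <= `|a - c| + `|b - e|.
Proof.
rewrite ler_norml.
have := ler_norm (a - c); have := ler_norm (b - e).
have := ler_norm (- (a - c)); have := ler_norm (- (b - e)); rewrite !normrN.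
have [ab|ab] := leP a b; have [ce|ce] := leP c e => ? ? ? ?;
  apply/andP; split; lra.
Qed.

Lemma bounded_lipschitz_max f g : bounded_lipschitz f -> bounded_lipschitz g ->
  bounded_lipschitz (fun x => Num.max (f x) (g x)).
Proof.
move=> [[K K0 fK] [M fM]] [[K' K'0 gK] [M' gM]]; split.
  exists (K + K'); first exact: addr_ge0.
  move=> x y; apply: le_trans (ler_dist_max _ _ _ _) _.
  by rewrite mulrDl; exact: lerD.
exists (M + M') => x.
have := ler_dist_max (f x) (g x) 0 0; rewrite maxxx !subr0.
by move=> /le_trans; apply; exact: lerD.
Qed.

Definition clamp (M a : R) := Num.max (- M) (Num.min M a).

Lemma clampE (M a : R) : clamp M a = Num.max (- M) (- Num.max (- M) (- a)).
Proof. by rewrite /clamp oppr_max !opprK. Qed.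

Lemma ler_dist_clamp (M a c : R) : `|clamp M a - clamp M c| <= `|a - c|.
Proof.
rewrite !clampE; apply: le_trans (ler_dist_max _ _ _ _) _.
rewrite subrr normr0 add0r -opprD normrN.
apply: le_trans (ler_dist_max _ _ _ _) _.
by rewrite subrr normr0 add0r -opprD normrN.
Qed.

Lemma clamp_le (M a : R) : 0 <= M -> `|clamp M a| <= M.
Proof.
move=> M0; rewrite ler_norml le_max lexx/= ge_max ge_min lexx andbT.
by rewrite ge0_cp.
Qed.

Lemma clamp_id (M a : R) : `|a| <= M -> clamp M a = a.
Proof. by rewrite ler_norml => /andP[h1 h2]; rewrite /clamp min_r// max_r. Qed.

Lemma norm_clamp_le (M a : R) : 0 <= M -> `|clamp M a| <= `|a|.
Proof.
move=> M0; have := ler_dist_clamp M a 0.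
by rewrite (@clamp_id M 0) ?normr0// !subr0.
Qed.

Lemma bounded_lipschitz_clamp (M : R) f : 0 <= M -> bounded_lipschitz f ->
  bounded_lipschitz (fun x => clamp M (f x)).
Proof.
move=> M0 [[K K0 fK] _]; split; last by exists M => x; exact: clamp_le.
by exists K => // x y; apply: le_trans (ler_dist_clamp _ _ _) (fK x y).
Qed.

(** The value 1 truncates the distance and keeps the infimum meaningful for the
    empty set. *)
Definition set_dist (A : set W) x : R :=
  inf [set r | r = 1 \/ exists2 y, A y & r = `|x - y|].

Let S (A : set W) x := [set r : R | r = 1 \/ exists2 y, A y & r = `|x - y|].

Let S_lb A x : has_lbound (S A x).
Proof. by exists 0 => r [->//|[y _ ->]]. Qed.

Lemma set_dist_ge0 A x : 0 <= set_dist A x.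
Proof.
by apply: lb_le_inf; [exists 1; left|move=> r [->//|[y _ ->]]].
Qed.

Lemma set_dist_le1 A x : set_dist A x <= 1.
Proof. by apply: ge_inf; [exact: S_lb|left]. Qed.

Lemma set_dist_lip A x y : set_dist A x <= set_dist A y + `|x - y|.
Proof.
rewrite -lerBlDr; apply: lb_le_inf; first by exists 1; left.
move=> r [->|[a Aa ->]]; rewrite lerBlDr.
  by apply: le_trans (set_dist_le1 A x) _; rewrite lerDl.
have : set_dist A x <= `|x - a|.
  by apply: ge_inf; [exact: S_lb|right; exists a].
move=> /le_trans; apply; rewrite [leRHS]addrC.
exact: ler_distD.
Qed.

Lemma set_dist_eq0 A x : A x -> set_dist A x = 0.
Proof.
move=> Ax; apply/eqP; rewrite eq_le set_dist_ge0 andbT.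
apply: ge_inf; first exact: S_lb.
by right; exists x; rewrite // subrr normr0.
Qed.

Lemma set_dist_gt0 A x : open (~` A) -> ~ A x -> 0 < set_dist A x.
Proof.
move=> oA nAx.
have /nbhs_ballP[e /= e0 He] : nbhs x (~` A) by exact: open_nbhs_nbhs.
have : 0 < Num.min e 1 by rewrite lt_min e0 ltr01.
move=> /lt_le_trans; apply; apply: lb_le_inf; first by exists 1; left.
move=> r [->|[a Aa ->]]; first by rewrite ge_min lexx orbT.
rewrite ge_min; apply/orP; left; rewrite leNgt; apply/negP => xa.
by apply: (He a) => //; rewrite -ball_normE.
Qed.

Lemma bounded_lipschitz_set_dist A : bounded_lipschitz (set_dist A).
Proof.
split; last by exists 1 => x; rewrite ger0_norm ?set_dist_ge0// set_dist_le1.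
exists 1 => // x y; rewrite mul1r ler_norml.
have := set_dist_lip A x y; have := set_dist_lip A y x.
by rewrite (distrC y); lra.
Qed.

End lipschitz_functions.

Section density.
Context {R : realType} {d : nat}.
Local Notation V := (borel_rV R d).
Variable mu : probability V R.
Implicit Types (f g h : V -> R) (A : set V).

Lemma continuous_measurable_rV (f : 'rV[R]_d -> R) :
  continuous f -> measurable_fun [set: V] (f : V -> R).
Proof.
move=> cf; apply: (measurability _ (RGenOpens.measurableE R)).
move=> _ [_ [a [b ->]] <-]; rewrite setTI; apply: sub_sigma_algebra.
by move/continuousP: cf; apply; exact: interval_open.
Qed.

Lemma bounded_lipschitz_measurable (f : 'rV[R]_d -> R) : bounded_lipschitz f ->
  measurable_fun [set: V] (f : V -> R).
Proof. by move=> /bounded_lipschitz_continuous; exact: continuous_measurable_rV. Qed.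

Definition absdiff f g : V -> R := fun x => `|f x - g x|.

Lemma absdiff_ge0 f g x : (0 <= (absdiff f g x)%:E)%E.
Proof. by rewrite lee_fin /absdiff. Qed.

Definition L1dist f g : \bar R :=
  (\int[mu]_(x in [set: V]) (absdiff f g x)%:E)%E.

Lemma measurable_dist f g : measurable_fun [set: V] f ->
  measurable_fun [set: V] g ->
  measurable_fun [set: V] (fun x => (absdiff f g x)%:E).
Proof.
move=> mf mg; apply/measurable_EFinP.
by apply: measurableT_comp => //; exact: measurable_funB.
Qed.

Lemma L1dist_triangle f g h : measurable_fun [set: V] f ->
  measurable_fun [set: V] g -> measurable_fun [set: V] h ->
  (L1dist f h <= L1dist f g + L1dist g h)%E.
Proof.
move=> mf mg mh; rewrite /L1dist -ge0_integralD//; last 4 first.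
- by move=> x _; exact: absdiff_ge0.
- exact: measurable_dist.
- by move=> x _; exact: absdiff_ge0.
- exact: measurable_dist.
apply: ge0_le_integral => //.
- by move=> x _; exact: absdiff_ge0.
- exact: measurable_dist.
- by apply: emeasurable_funD; exact: measurable_dist.
- by move=> x _; rewrite -EFinD lee_fin /absdiff; exact: ler_distD.
Qed.

Definition L1_approximable f := measurable_fun [set: V] f /\
  forall eps : R, 0 < eps -> exists2 phi : V -> R,
    bounded_lipschitz (phi : 'rV[R]_d -> R) & (L1dist f phi <= eps%:E)%E.

Lemma L1_approximable_lipschitz f : bounded_lipschitz (f : 'rV[R]_d -> R) ->
  L1_approximable f.
Proof.
move=> lf; split; first exact: bounded_lipschitz_measurable.
move=> eps eps0; exists f => //; rewrite /L1dist integral0_eq ?lee_fin ?ltW//.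
by move=> x _; rewrite /absdiff subrr normr0.
Qed.

Lemma L1_approximable_near f : measurable_fun [set: V] f ->
  (forall eps : R, 0 < eps -> exists2 g, L1_approximable g &
     (L1dist f g <= eps%:E)%E) -> L1_approximable f.
Proof.
move=> mf H; split => // eps eps0.
have e2 : 0 < eps / 2 by rewrite divr_gt0.
have [g [mg ag] fg] := H _ e2.
have [phi lphi gphi] := ag _ e2.
exists phi => //.
apply: le_trans (L1dist_triangle mf mg (bounded_lipschitz_measurable lphi)) _.
by rewrite (splitr eps) EFinD leeD.
Qed.

Lemma L1dist_cvg (F : nat -> V -> R) f (G : V -> R) :
  (forall n, measurable_fun [set: V] (F n)) -> measurable_fun [set: V] f ->
  (forall x, F n x @[n --> \oo] --> f x) -> mu.-integrable [set: V] (EFin \o G) ->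
  (forall n x, `|F n x| <= G x) ->
  forall eps : R, 0 < eps -> exists n, (L1dist f (F n) <= eps%:E)%E.
Proof.
move=> mF mf Ff iG FG eps eps0.
have [|||||_ + _] := @dominated_convergence _ V R mu [set: V] measurableT
    (fun n x => (F n x)%:E) (fun x => (f x)%:E) (EFin \o G).
- by move=> n; apply/measurable_EFinP.
- exact/measurable_EFinP.
- by apply: aeW => x _; apply: cvg_EFin; [exact: nearW|exact: Ff].
- exact: iG.
- by apply: aeW => x n _; rewrite lee_fin.
move=> /fine_cvgP[fin /cvgrPdist_le/(_ _ eps0) near].
have [n [/= finn distn]] := filter_ex (filterI fin near).
exists n; rewrite /= in finn distn.
have -> : L1dist f (F n) = (\int[mu]_(x in [set: V]) `|(F n x)%:E - (f x)%:E|)%E.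
  by apply: eq_integral => x _; rewrite -EFinB abse_EFin /absdiff distrC.
rewrite -(fineK finn) lee_fin; move: distn; rewrite sub0r normrN.
by apply: le_trans; exact: ler_norm.
Qed.

Lemma L1_approximable_lim (F : nat -> V -> R) f (M : R) :
  (forall n, L1_approximable (F n)) -> measurable_fun [set: V] f ->
  (forall x, F n x @[n --> \oo] --> f x) -> (forall n x, `|F n x| <= M) ->
  L1_approximable f.
Proof.
move=> aF mf Ff FM; apply: L1_approximable_near => // eps eps0.
have iM : mu.-integrable [set: V] (EFin \o cst M).
  exact: finite_measure_integrable_cst.
have [n Hn] := L1dist_cvg (fun n => (aF n).1) mf Ff iM FM eps0.
by exists (F n).
Qed.

Lemma L1_approximableD f g : L1_approximable f -> L1_approximable g ->
  L1_approximable (fun x => f x + g x).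
Proof.
move=> [mf af] [mg ag]; split; first exact: measurable_funD.
move=> eps eps0; have e2 : 0 < eps / 2 by rewrite divr_gt0.
have [phi lphi fphi] := af _ e2; have [psi lpsi gpsi] := ag _ e2.
exists (fun x => phi x + psi x); first exact: bounded_lipschitzD.
have mphi := bounded_lipschitz_measurable lphi.
have mpsi := bounded_lipschitz_measurable lpsi.
apply: (@le_trans _ _ (L1dist f phi + L1dist g psi)%E); last first.
  by rewrite (splitr eps) EFinD leeD.
rewrite /L1dist -ge0_integralD//; last 4 first.
- by move=> x _; exact: absdiff_ge0.
- exact: measurable_dist.
- by move=> x _; exact: absdiff_ge0.
- exact: measurable_dist.
apply: ge0_le_integral => //.
- by move=> x _; exact: absdiff_ge0.
- by apply: measurable_dist; exact: measurable_funD.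
- by apply: emeasurable_funD; exact: measurable_dist.
- by move=> x _; rewrite -EFinD lee_fin /absdiff opprD addrACA ler_normD.
Qed.

Lemma L1_approximableZ (c : R) f : L1_approximable f ->
  L1_approximable (fun x => c * f x).
Proof.
move=> [mf af]; split; first exact: measurable_funM.
move=> eps eps0.
have c1 : 0 < `|c| + 1 by rewrite ltr_wpDl.
have [phi lphi fphi] := af (eps / (`|c| + 1)) (divr_gt0 eps0 c1).
exists (fun x => c * phi x); first exact: bounded_lipschitzZ.
have mphi := bounded_lipschitz_measurable lphi.
have -> : L1dist (fun x => c * f x) (fun x => c * phi x) =
    (`|c|%:E * L1dist f phi)%E.
  rewrite /L1dist -ge0_integralZl_EFin//; last 2 first.
  - by move=> x _; exact: absdiff_ge0.
  - exact: measurable_dist.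
  by apply: eq_integral => x _; rewrite /absdiff -mulrBr normrM EFinM.
apply: (@le_trans _ _ (`|c|%:E * (eps / (`|c| + 1))%:E)%E).
  by rewrite lee_wpmul2l// lee_fin.
by rewrite -EFinM lee_fin mulrA ler_pdivrMr// mulrC ler_pM2l//; lra.
Qed.

Lemma L1_approximable_max f g : L1_approximable f -> L1_approximable g ->
  L1_approximable (fun x => Num.max (f x) (g x)).
Proof.
move=> [mf af] [mg ag]; split; first exact: measurable_maxr.
move=> eps eps0; have e2 : 0 < eps / 2 by rewrite divr_gt0.
have [phi lphi fphi] := af _ e2; have [psi lpsi gpsi] := ag _ e2.
exists (fun x => Num.max (phi x) (psi x)); first exact: bounded_lipschitz_max.
have mphi := bounded_lipschitz_measurable lphi.
have mpsi := bounded_lipschitz_measurable lpsi.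
apply: (@le_trans _ _ (L1dist f phi + L1dist g psi)%E); last first.
  by rewrite (splitr eps) EFinD leeD.
rewrite /L1dist -ge0_integralD//; last 4 first.
- by move=> x _; exact: absdiff_ge0.
- exact: measurable_dist.
- by move=> x _; exact: absdiff_ge0.
- exact: measurable_dist.
apply: ge0_le_integral => //.
- by move=> x _; exact: absdiff_ge0.
- by apply: measurable_dist; exact: measurable_maxr.
- by apply: emeasurable_funD; exact: measurable_dist.
- by move=> x _; rewrite -EFinD lee_fin /absdiff; exact: ler_dist_max.
Qed.

End density.

Import HBSimple.

Section density_Lp.
Context {R : realType} {d : nat}.
Local Notation V := (borel_rV R d).
Variable mu : probability V R.
Implicit Types (f g h : V -> R) (A : set V).

(** The truncations of [n] times the distance to the complement increase to the
    indicator. *)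
Lemma L1_approximable_open A : open (A : set 'rV[R]_d) ->
  L1_approximable mu (\1_A : V -> R).
Proof.
move=> oA; have mA : measurable A by exact: sub_sigma_algebra.
pose D : V -> R := set_dist (~` A : set 'rV[R]_d).
apply: (@L1_approximable_lim _ _ mu (fun n x => clamp 1 (n%:R * D x)) _ 1).
- move=> n; apply: L1_approximable_lipschitz.
  apply: bounded_lipschitz_clamp => //; apply: bounded_lipschitzZ.
  exact: bounded_lipschitz_set_dist.
- exact: measurable_indic.
- move=> x; rewrite indicE.
  have D0 : 0 <= D x by exact: set_dist_ge0.
  have [xA|xA] := boolP (x \in A); last first.
    have -> : D x = 0 by apply: set_dist_eq0 => Ax; move: xA; rewrite mem_set.
    under eq_fun do rewrite mulr0 clamp_id ?normr0//.
    exact: cvg_cst.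
  have {}D0 : 0 < D x.
    by apply: set_dist_gt0; rewrite ?setCK//= => nAx; apply: nAx; rewrite inE in xA.
  apply: cvg_near_cst; exists (Num.truncn (D x)^-1).+1 => // n /= nD.
  rewrite /clamp min_l; first by rewrite max_r//; lra.
  rewrite -ler_pdivrMr// mul1r; apply: ltW; apply: lt_le_trans (truncnS_gt _) _.
  by rewrite ler_nat.
- by move=> n x; exact: clamp_le.
Qed.

(** The sets with approximable indicator form a sigma-algebra: complements and
    finite unions come from [1 - phi] and maxima, countable unions from
    dominated convergence. *)
Lemma L1_approximable_indic A : measurable A ->
  L1_approximable mu (\1_A : V -> R).
Proof.
pose C := [set A : set V | measurable A /\ L1_approximable mu (\1_A : V -> R)].
have sC : sigma_algebra [set: V] C.
  split.
  - split; first exact: measurable0.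
    rewrite (_ : \1_set0 = fun=> 0 :> R); last first.
      by apply/funext => x; rewrite indicE in_set0.
    by apply: L1_approximable_lipschitz; exact: bounded_lipschitz_cst.
  - move=> B [mB aB]; split; first exact: measurableD.
    rewrite (_ : \1_(_ `\` _) = fun x => 1 + (-1) * \1_B x :> R); last first.
      apply/funext => x; rewrite setTD !indicE in_setC.
      by case: (x \in B) => /=; lra.
    apply: L1_approximableD; last exact: L1_approximableZ.
    by apply: L1_approximable_lipschitz; exact: bounded_lipschitz_cst.
  - move=> B HB; split; first by apply: bigcup_measurable => i _; exact: (HB i).1.
    pose g n (x : V) : R := iteri n (fun i r => Num.max r (\1_(B i) x)) 0.
    have gS n x : g n.+1 x = Num.max (g n x) (\1_(B n) x) by [].
    have g_ge0 n x : 0 <= g n x.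
      by elim: n => // n IH; rewrite gS le_max IH.
    have g_le1 n x : g n x <= 1.
      by elim: n => // n IH; rewrite gS ge_max IH indicE lern1 leq_b1.
    apply: (@L1_approximable_lim _ _ mu g _ 1).
    + elim=> [|n IH].
        by apply: L1_approximable_lipschitz; exact: bounded_lipschitz_cst.
      by apply: L1_approximable_max => //; exact: (HB n).2.
    + by apply: measurable_indic; apply: bigcup_measurable => i _; exact: (HB i).1.
    + move=> x; rewrite indicE.
      have [xB|xB] := boolP (x \in _); last first.
        rewrite (_ : g ^~ x = fun=> 0); first exact: cvg_cst.
        apply/funext; elim => // n IH; rewrite gS IH indicE memNset ?maxxx//.
        by move=> Bnx; move: xB; rewrite mem_set//; exists n.
      move: xB; rewrite inE => -[i _ Bix].
      apply: cvg_near_cst; exists i.+1 => // n /= ni.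
      apply/eqP; rewrite eq_le g_le1/=; elim: n ni => // n IH.
      rewrite ltnS gS le_max leq_eqVlt => /orP[/eqP <-|/IH -> //].
      by rewrite indicE mem_set// lexx orbT.
    + by move=> n x; rewrite ger0_norm ?g_le1.
have openC : (@open 'rV[R]_d) `<=` C.
  move=> B oB; split; first exact: sub_sigma_algebra.
  exact: L1_approximable_open.
by move=> mA; exact: (smallest_sub sC openC mA).2.
Qed.

Lemma L1_approximable_integrable f : mu.-integrable [set: V] (EFin \o f) ->
  L1_approximable mu f.
Proof.
move=> intf; have mf : measurable_fun [set: V] f.
  by apply/measurable_EFinP; exact: measurable_int intf.
apply: L1_approximable_near => // eps eps0.
have [g [intg _ gf]] := approximation_sfun_integrable measurableT intf.
have [fin /cvgrPdist_le/(_ _ eps0) near] := (fine_cvgP _ _).1 gf.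
have [n [/= finn distn]] := filter_ex (filterI fin near).
exists (g n : V -> R).
  have [N [c [B [mB gE]]]] : exists (N : nat) (c : nat -> R) (B : nat -> set V),
      (forall i, measurable (B i)) /\
      (forall x, g n x = \sum_(i < N) c i * \1_(B i) x).
    eexists; exists (fun i => (finmap.enum_fset (fset_set (range (g n))))`_i), (fun i =>
      g n @^-1` [set (finmap.enum_fset (fset_set (range (g n))))`_i]).
    split; last exact: fimfunEord.
    move=> i; rewrite -[X in measurable X]setTI.
    by apply: measurable_funPT => //; exact: measurable_set1.
  have -> : (g n : V -> R) = (fun x => \sum_(i < N) c i * \1_(B i) x).
    exact/funext.
  elim: N {gE} => [|N IH].
    rewrite (_ : (fun _ => _) = (fun=> 0)); last first.
      by apply/funext => x; rewrite big_ord0.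
    by apply: L1_approximable_lipschitz; exact: bounded_lipschitz_cst.
  under eq_fun do rewrite big_ord_recr/=.
  apply: L1_approximableD => //; apply: L1_approximableZ.
  exact: L1_approximable_indic.
move: distn; rewrite sub0r normrN => /(le_trans (ler_norm _)).
by rewrite -lee_fin fineK.
Qed.

Lemma powRD_le (a c p : R) : 0 <= a -> 0 <= c -> 0 <= p ->
  (a + c) `^ p <= 2 `^ p * (a `^ p + c `^ p).
Proof.
move=> a0 c0 p0.
have H (m : R) : 0 <= m -> a + c <= 2 * m -> (a + c) `^ p <= 2 `^ p * m `^ p.
  move=> m0 acm; rewrite -powRM//.
  by apply: ge0_ler_powR; rewrite ?nnegrE// ?addr_ge0 ?mulr_ge0.
have [ac|ca] := leP a c.
  apply: le_trans (H c c0 _) _; first by lra.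
  by rewrite ler_wpM2l ?powR_ge0// lerDr powR_ge0.
apply: le_trans (H a a0 _) _; first by lra.
by rewrite ler_wpM2l ?powR_ge0// lerDl powR_ge0.
Qed.

Lemma powR_le_linear (z B p : R) : 0 <= z -> z <= B -> 1 <= p ->
  z `^ p <= B `^ (p - 1) * z.
Proof.
move=> z0 zB p1; have [->|z_neq0] := eqVneq z 0.
  by rewrite mulr0 powR0// gt_eqF//; lra.
have zE : z `^ p = z `^ (p - 1) * z.
  rewrite -[X in _ = _ * X]powRr1// -powRD ?subrK//.
  by rewrite z_neq0 implybT.
rewrite zE ler_wpM2r//; apply: ge0_ler_powR; rewrite ?nnegrE//; last lra.
by rewrite subr_ge0.
Qed.

(** Only the boundedness of the approximants in [L^p] is recorded; convergence
    in [L^1] is enough to pass pointwise bounds to the limit. *)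
Lemma Lp_lipschitz_approximation (p : R) f eps : 1 <= p -> f \in Lfun mu p%:E ->
  (\int[mu]_(x in [set: V]) (`|f x| `^ p)%:E <= 1)%E -> 0 < eps ->
  exists phi : V -> R, [/\ bounded_lipschitz (phi : 'rV[R]_d -> R),
    (\int[mu]_(x in [set: V]) (`|phi x| `^ p)%:E <= (2 `^ p * 2)%:E)%E &
    (L1dist mu f phi <= eps%:E)%E].
Proof.
move=> p1 fLp fp1 eps0.
have p0 : 0 <= p by lra.
have mf : measurable_fun [set: V] f.
  by move: fLp; rewrite inE => /andP[]; rewrite inE.
have f_int : mu.-integrable [set: V] (EFin \o f).
  apply/Lfun1_integrable; apply: (Lfun_subset _ _ _ _ fLp) => //.
  exact: fin_num_measure.
have af_int : mu.-integrable [set: V] (EFin \o (fun x => `|f x|)).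
  exact: integrable_abse f_int.
pose g M x := clamp M (f x).
have mg M : measurable_fun [set: V] (g M).
  apply: measurable_maxr; first exact: measurable_cst.
  by apply: measurable_minr => //; exact: measurable_cst.
have e20 : 0 < eps / 2 by rewrite divr_gt0.
have [||n fn] := L1dist_cvg (fun n => mg n%:R) mf _ af_int _ e20.
- move=> x; apply: cvg_near_cst.
  exists (Num.truncn `|f x|).+1 => // n /= nfx; rewrite /g clamp_id//.
  by apply: ltW; apply: lt_le_trans (truncnS_gt _) _; rewrite ler_nat.
- by move=> n x; exact: norm_clamp_le.
set M : R := n%:R in fn; pose B := 2 * M + 1.
have M0 : 0 <= M by rewrite ler0n.
have B0 : 0 < B by rewrite /B; lra.
have g_int : mu.-integrable [set: V] (EFin \o g M).
  apply: le_integrable f_int => //; first exact/measurable_EFinP.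
  by move=> x _; rewrite lee_fin norm_clamp_le.
(* the second bound makes the p-th power of the error have integral at most 1 *)
pose e' := Num.min (eps / 2) (B `^ (1 - p)).
have e'0 : 0 < e' by rewrite lt_min e20 powR_gt0.
have [_ ag] := L1_approximable_integrable g_int.
have [phi lphi gphi] := ag e' e'0.
pose psi x := clamp M (phi x).
have lpsi : bounded_lipschitz (psi : 'rV[R]_d -> R).
  exact: bounded_lipschitz_clamp.
have mphi := bounded_lipschitz_measurable lphi.
have mpsi := bounded_lipschitz_measurable lpsi.
have gpsi : (L1dist mu (g M) psi <= e'%:E)%E.
  apply: le_trans gphi; apply: ge0_le_integral => //.
  - by move=> x _; exact: absdiff_ge0.
  - exact: measurable_dist.
  - exact: measurable_dist.
  - move=> x _; rewrite lee_fin /absdiff /psi.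
    by rewrite -[X in `|X - _|](@clamp_id _ M) ?clamp_le// ler_dist_clamp.
exists psi; split => //; last first.
  apply: le_trans (L1dist_triangle mu mf (mg M) mpsi) _.
  rewrite (splitr eps) EFinD leeD//; apply: le_trans gpsi _.
  by rewrite lee_fin ge_min lexx.
have mpow (h : V -> R) : measurable_fun [set: V] h ->
    measurable_fun [set: V] (fun x => (`|h x| `^ p)%:E).
  move=> mh; apply/measurable_EFinP.
  apply: (@measurableT_comp _ _ _ _ _ _ (@powR R ^~ p)) => //.
  exact: measurableT_comp.
apply: (@le_trans _ _ (\int[mu]_(x in [set: V])
    ((2 `^ p)%:E * ((`|f x| `^ p)%:E +
      (B `^ (p - 1))%:E * (absdiff (g M) psi x)%:E)))%E).
  apply: ge0_le_integral => //.
  - exact: mpow.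
  - apply: emeasurable_funM => //; apply: emeasurable_funD; first exact: mpow.
    by apply: emeasurable_funM => //; exact: measurable_dist.
  - move=> x _; rewrite -[leRHS]/((2 `^ p * (`|f x| `^ p +
      B `^ (p - 1) * absdiff (g M) psi x))%:E) lee_fin.
    have psi_le : `|psi x| <= `|f x| + `|g M x - psi x|.
      have : `|psi x| <= `|g M x| + `|g M x - psi x|.
        by rewrite distrC -{1}(subrK (g M x) (psi x)) addrC ler_normD.
      by move/le_trans; apply; rewrite lerD2r norm_clamp_le.
    have dB : `|g M x - psi x| <= B.
      have := ler_normB (g M x) (psi x).
      have := clamp_le (f x) M0; have := clamp_le (phi x) M0.
      by rewrite /B -/(g M x) -/(psi x); lra.
    have H1 : `|psi x| `^ p <= (`|f x| + `|g M x - psi x|) `^ p.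
      by apply: ge0_ler_powR; rewrite ?nnegrE ?addr_ge0.
    apply: le_trans H1 _; apply: le_trans (powRD_le _ _ p0) _ => //.
    rewrite ler_wpM2l ?powR_ge0// lerD2l /absdiff.
    exact: powR_le_linear.
rewrite ge0_integralZl_EFin ?powR_ge0//; last 2 first.
- move=> x _; apply: adde_ge0; first by rewrite lee_fin powR_ge0.
  by apply: mule_ge0; [rewrite lee_fin powR_ge0|exact: absdiff_ge0].
- apply: emeasurable_funD; first exact: mpow.
  by apply: emeasurable_funM => //; exact: measurable_dist.
rewrite EFinM lee_wpmul2l ?lee_fin ?powR_ge0//.
rewrite ge0_integralD//; last 3 first.
- exact: mpow.
- move=> x _; apply: mule_ge0; first by rewrite lee_fin powR_ge0.
  exact: absdiff_ge0.
- by apply: emeasurable_funM => //; exact: measurable_dist.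
rewrite ge0_integralZl_EFin ?powR_ge0//; last 2 first.
- by move=> x _; exact: absdiff_ge0.
- exact: measurable_dist.
rewrite (_ : (2 : R) = 1 + 1) ?EFinD; last by lra.
rewrite leeD//; apply: (@le_trans _ _ ((B `^ (p - 1))%:E * e'%:E)%E).
  by rewrite lee_wpmul2l// lee_fin powR_ge0.
rewrite -EFinM lee_fin.
apply: (@le_trans _ _ (B `^ (p - 1) * B `^ (1 - p))).
  by rewrite ler_wpM2l ?powR_ge0// ge_min lexx orbT.
rewrite -powRD; last by rewrite (gt_eqF B0) implybT.
by rewrite (_ : p - 1 + (1 - p) = 0) ?powRr0//; lra.
Qed.

End density_Lp.

(** * Uniform bound for Lipschitz data *)

Section uniform_bound.
Context {R : realType} {d : nat}.
Local Notation W := 'rV[R]_d.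
Local Notation V := (borel_rV R d).
Implicit Types (x y : W).

Lemma norm_le_enorm x : `|x| <= enorm x.
Proof.
rewrite [leLHS]/Num.norm/= mx_normrE; apply: bigmax_le; first exact: sqrtr_ge0.
move=> [i j] _ /=; rewrite ord1 -sqrtr_sqr ler_wsqrtr//.
exact: abs_coord_sqr_le.
Qed.

Lemma dotB_le x y : dot (x - y) (x - y) <= 2 * (dot x x + dot y y).
Proof.
have := dot_ge0 (x + y).
by rewrite !dotDl !dotDr !dotNl !dotNr (dotC y x); lra.
Qed.

Lemma eball_open (rho : R) : open (@eball R d rho).
Proof.
have [rho0|rho0] := leP rho 0.
  rewrite (_ : eball rho = set0); first exact: open0.
  by apply/seteqP; split => // x /= /lt_le_trans/(_ rho0); rewrite ltNge sqrtr_ge0.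
have cd : continuous (fun x : W => dot x x).
  suff H (x : W) : {for x, continuous (fun x : W => dot x x)} by move=> x; exact: H.
  exact: (@cvg_dot R d W (nbhs x) id id x x (nbhs_filter x) cvg_id cvg_id).
rewrite (_ : eball rho = (fun x : W => dot x x) @^-1` [set a | a < rho ^+ 2]).
  by move/continuousP: cd; apply; exact: open_lt.
apply/seteqP; split => x /=; rewrite /eball/= -enorm_sqr.
  by rewrite ltr_pXn2r ?nnegrE ?sqrtr_ge0// ltW.
by rewrite ltr_pXn2r ?nnegrE ?sqrtr_ge0// ltW.
Qed.

Lemma line_solution_restrict (Q : R -> 'M[R]_d) (b : R -> W -> W) (s r : R)
    u ut g H : s <= r -> line_solution Q b s u ut g H ->
  line_solution Q b r u ut g H.
Proof.
move=> sr [[cu [M uM]] dt d1 d2 eqn].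
have lt_sr t : r < t -> s < t by exact: le_lt_trans.
split.
- split; last by exists M => t x rt; apply: uM; exact: le_trans rt.
  apply: continuous_subspaceW cu => -[t x] [/= rt _]; split => //=.
  exact: le_trans rt.
- by move=> t x /lt_sr; exact: dt.
- by move=> t x w /lt_sr; exact: d1.
- by move=> t x w /lt_sr; exact: d2.
- by move=> t x /lt_sr; exact: eqn.
Qed.

Lemma ln_lipschitz_at_ge1 (A B D : R) : 1 <= B -> 0 <= D -> 0 < A -> A <= B + D ->
  ln A - ln B <= D.
Proof.
move=> B1 D0 A0 ABD.
have B0 : 0 < B by lra.
have DB : 0 <= D / B by rewrite divr_ge0// ltW.
have : ln A <= ln (B * (1 + D / B)).
  rewrite ler_ln ?posrE//; first by rewrite mulrDr mulr1 mulrCA divff ?gt_eqF// mulr1.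
  by rewrite mulr_gt0//; lra.
rewrite lnM ?posrE//; last lra.
have := @le_ln1Dx R (D / B); have : D / B <= D.
  by rewrite ler_pdivrMr// ler_peMr.
move=> H1 H2; have : -1 < D / B by lra.
by move=> /H2; lra.
Qed.

Variables (I : set R) (theta : R) (Q : R -> 'M[R]_d) (b : R -> W -> W).
Hypothesis I_halfline : open_right_halfline I.
Hypothesis standing : standing_assumptions I theta Q b.

Lemma standing_admissible : exists eta0 Lambda, [/\ 0 < eta0, 0 < Lambda &
  forall s T, I s -> exists C kappa, admissible Q b s T eta0 Lambda C kappa].
Proof.
have [/andP[th0 _] [_ hb] ell _ diss] := standing.
have [eta0 [L [e0 L0 HQ]]] := elliptic_bounds ell.
exists eta0, L; split => // s T Is.
have [C [k [C0 k0 Hb]]] := drift_coercive I_halfline T th0 diss hb Is.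
have [k' k'0 Hd] := drift_strictly_monotone th0 diss.
exists C, k; split => // t st tT.
have It : I t by exact: halfline_ge st.
have [ws tr lo up] := HQ t It; split => //.
- by move=> x; exact: Hb.
- move=> x y; apply: le_trans (Hd t x y It) _.
  by rewrite mulNr oppr_le0 mulr_ge0 ?dot_ge0// ltW.
Qed.

Lemma Cb_powR_abs1 (p : R) (phi : W -> R) : 0 <= p ->
  bounded_lipschitz phi -> Cb (fun x => (`|phi x| + 1) `^ p).
Proof.
move=> p0 lphi; have [_ [M phiM]] := lphi; split.
  have cphi := bounded_lipschitz_continuous lphi.
  suff H (x : W) : {for x, continuous (fun x => (`|phi x| + 1) `^ p)}.
    by move=> x; exact: H.
  have c1 : `|phi y| + 1 @[y --> nbhs x] --> `|phi x| + 1.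
    apply: (@cvgD _ _ _ (nbhs x) (nbhs_filter x)); last exact: cvg_cst.
    exact: (@cvg_norm _ _ _ (nbhs x) (nbhs_filter x) _ _ (cphi x)).
  have pos : 0 < `|phi x| + 1 by rewrite ltr_wpDl.
  have cp : {for `|phi x| + 1, continuous (fun a : R => a `^ p)}.
    apply: differentiable_continuous; apply/derivable1_diffP.
    by case: (@is_derive1_powR R p _ pos).
  exact: (cvg_comp _ _ c1 cp).
exists ((M + 1) `^ p) => x; rewrite ger0_norm ?powR_ge0//.
apply: ge0_ler_powR; rewrite ?nnegrE// ?addr_ge0//; last by rewrite lerD2r.
by apply: le_trans (phiM x).
Qed.

Lemma bounded_lipschitz_Cb (phi : W -> R) : bounded_lipschitz phi -> Cb phi.
Proof.
by move=> lphi; split; [exact: bounded_lipschitz_continuous|case: lphi].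
Qed.

Variable (G : R -> R -> (W -> R) -> W -> R).
Hypothesis G_evol : is_evolution_operator I theta Q b G.
Variable mu : R -> probability V R.
Hypothesis mu_evol : tight_evolution_system I mu G.

(** Harnack's inequality is integrated in [y] over a ball carrying half of the
    mass of [mu r]; invariance turns the integral of [v] into a norm of the
    initial datum. *)
Lemma integrated_harnack (p eta0 Lambda C kappa rho N0 s r : R) (phi : W -> R)
    u ut gu Hu : 1 < p ->
  admissible Q b s r eta0 Lambda C kappa -> I s -> s < r ->
  ((1 - 1 / 2)%:E <= mu r (eball rho))%E ->
  bounded_lipschitz phi ->
  (\int[mu s]_(x in [set: V]) ((`|phi x| + 1) `^ p)%:E <= N0%:E)%E ->
  line_solution Q b s u ut gu Hu -> (forall x, u s x <= `|phi x|) ->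
  forall x, p * ln (Num.max (u r x) 1) <=
    ln (2 * N0) + 2 * (harnack_const eta0 p / (r - s)) * (dot x x + rho ^+ 2).
Proof.
move=> p1 coeffs Is sr tight_r lphi intphi solu u_init x.
have p0 : 0 <= p by lra.
have Ir : I r by apply: halfline_ge (ltW sr).
have e0 : 0 < eta0 by case: coeffs.
pose F x := (`|phi x| + 1) `^ p.
have CbF : Cb F by exact: Cb_powR_abs1.
have [Gsol _ _] := G_evol Is CbF.
have [vt [gv [Hv solv]]] := classical_line_solution Gsol.
pose v t x := G t s F x; rewrite -/v in solv.
have v_init y : v s y = F y by case: Gsol => _ _ _; exact.
have F_ge1 y : 1 <= F y.
  have one : 1 = 1 `^ p :> R by rewrite powR1.
  rewrite /F [X in X <= _]one.
  by apply: ge0_ler_powR; rewrite ?nnegrE ?addr_ge0// lerDr.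
have v_ge1 t y : s <= t -> t <= r -> 1 <= v t y.
  apply: (min_principle coeffs solv) => z.
  by rewrite v_init.
have [[K K0 phiK] _] := lphi.
have init y z : p * ln (Num.max (u s y) 1) - ln (v s z) <= p * K * enorm (y - z).
  rewrite v_init /F ln_powR -mulrBr -mulrA ler_wpM2l//.
  apply: ln_lipschitz_at_ge1.
  - by rewrite lerDr.
  - by rewrite mulr_ge0 ?sqrtr_ge0.
  - by rewrite lt_max ltr01 orbT.
  have H1 : `|phi y| <= `|phi z| + K * enorm (y - z).
    have : `|phi y| <= `|phi y - phi z| + `|phi z|.
      by rewrite -{1}(subrK (phi z) (phi y)) ler_normD.
    have := phiK y z; have := ler_wpM2l K0 (norm_le_enorm (y - z)); lra.
  have := u_init y; have : 0 <= `|phi z| by [].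
  have : 0 <= K * enorm (y - z) by rewrite mulr_ge0 ?sqrtr_ge0.
  by rewrite ge_max => ? ? ?; apply/andP; split; lra.
pose c := harnack_const eta0 p / (r - s).
have c0 : 0 < c by rewrite divr_gt0 ?subr_gt0// harnack_const_gt0.
have pK : 0 <= p * K by rewrite mulr_ge0.
have harn y := harnack_log coeffs solu solv x y v_ge1 p1 pK init sr (lexx r).
pose a := p * ln (Num.max (u r x) 1) - 2 * c * (dot x x + rho ^+ 2).
have rho_ball y : eball rho y -> dot y y <= rho ^+ 2.
  rewrite /eball/= -enorm_sqr => yr.
  have y0 : 0 <= enorm y by exact: sqrtr_ge0.
  have rho0 : 0 <= rho by apply: ltW; exact: le_lt_trans yr.
  by rewrite ler_pXn2r ?nnegrE// ltW.
have a_le y : eball rho y -> expR a <= v r y.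
  move=> /rho_ball yr.
  have vy : 0 < v r y by apply: lt_le_trans ltr01 _; exact: v_ge1 (ltW sr) _.
  rewrite -(lnK vy) ler_expR; apply: le_trans (_ : a <= _) _ => //.
  have := harn y; have := ler_wpM2l (ltW c0) (dotB_le x y).
  have : c * dot y y <= c * rho ^+ 2 by rewrite ler_wpM2l// ltW.
  by rewrite /a -/c; lra.
have mball : measurable (eball rho : set V).
  by apply: sub_sigma_algebra; exact: eball_open.
have cv : continuous (v r).
  have [[cv _] _ _ _ _] := solv.
  suff H (y : W) : {for y, continuous (v r)} by move=> y; exact: H.
  have sr' : [set t | s <= t] r by exact: ltW.
  apply: (@continuous_on_cvg R d _ v r y W (nbhs y) (fun=> r) id
    (nbhs_filter y) cv sr').
  - by apply: filterE => _; exact: ltW.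
  - exact: cvg_cst.
  - exact: cvg_id.
have mv : measurable_fun [set: V] (v r : V -> R).
  exact: continuous_measurable_rV.
have int_le : ((expR a)%:E * mu r (eball rho) <= N0%:E)%E.
  apply: le_trans intphi.
  have [_ inv] := mu_evol.
  rewrite -(inv s r F Is Ir sr CbF) -/(v r).
  rewrite -[eball rho]setIT -integral_indic// -ge0_integralZl_EFin ?expR_ge0//; last first.
    by apply/measurable_EFinP; exact: measurable_indic.
  apply: ge0_le_integral => //.
  - by apply: emeasurable_funM => //; apply/measurable_EFinP; exact: measurable_indic.
  - by apply/measurable_EFinP.
  - move=> y _; rewrite -EFinM lee_fin indicE.
    have [yB|yB] := boolP (y \in _); rewrite ?mulr1 ?mulr0.
      by apply: a_le; rewrite inE in yB.
    by apply: le_trans ler01 _; exact: v_ge1 (ltW sr) _.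
have expa : expR a <= 2 * N0.
  have : ((expR a)%:E * (1 - 1 / 2)%:E <= N0%:E)%E.
    by apply: le_trans int_le; rewrite lee_wpmul2l// lee_fin expR_ge0.
  by rewrite -EFinM lee_fin; lra.
have N00 : 0 < 2 * N0 by apply: lt_le_trans expa; exact: expR_gt0.
have : a <= ln (2 * N0) by rewrite -ler_expR lnK.
by rewrite /a -/c; lra.
Qed.

(** The first step ends at [r = t - l / 2], so that both steps last at least
    [l / 2]; [2 ^ p * 2] is the bound satisfied by the approximants of the unit
    ball of [L^p]. *)
Theorem Lipschitz_uniform_bound (K2 alpha R0 p l : R) :
  0 < K2 -> 1 < alpha -> 1 < R0 ->
  (forall t x, I t -> R0 <= enorm x ->
     dot (b t x) x <= - K2 * enorm x ^+ 2 * ln (enorm x) `^ alpha) ->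
  1 < p -> 0 < l ->
  exists B : R, forall s t, I s -> s + l <= t -> forall phi : W -> R,
    bounded_lipschitz phi ->
    (\int[mu s]_(x in [set: V]) (`|phi x| `^ p)%:E <= (2 `^ p * 2)%:E)%E ->
    forall x, `|G t s phi x| <= B.
Proof.
move=> K20 al1 R01 growth p1 l0.
have [eta0 [Lambda [e0 L0 adm]]] := standing_admissible.
have [tight_mu _] := mu_evol.
have half0 : 0 < 1 / 2 :> R by lra.
have [rho [rho0 Hrho]] := tight_mu _ half0.
pose c := harnack_const eta0 p; pose N0 := 2 `^ p * (2 `^ p * 2 + 1) : R.
have c0 : 0 < c by exact: harnack_const_gt0.
have p0 : 0 < p by lra.
have N01 : 1 <= N0.
  have : 1 <= 2 `^ p :> R.
    have one : 1 = 1 `^ p :> R by rewrite powR1.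
    rewrite [X in X <= _]one; apply: ge0_ler_powR; rewrite ?nnegrE//; lra.
  by move=> H; rewrite /N0; nra.
pose delta := 4 * c / (l * p).
have delta0 : 0 < delta by apply: divr_gt0; apply: mulr_gt0.
have l20 : 0 < l / 2 by rewrite divr_gt0.
have [M M0 HM] := @come_down R d Lambda K2 alpha R0 delta (l / 2) L0 K20 al1 R01
  delta0 l20.
pose k := ln (2 * N0) / p + delta * (rho ^+ 2 + R0 ^+ 2 + 1 / 2).
have k0 : 0 <= k.
  apply: addr_ge0; first by rewrite divr_ge0 ?ln_ge0// ?ltW//; lra.
  by apply: mulr_ge0; [exact: ltW|rewrite !addr_ge0 ?sqr_ge0// ltW].
exists (expR (k + M)) => s t Is slt phi lphi intphi.
set r := t - l / 2.
have sr : s < r by rewrite /r; lra.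
have Ir : I r by apply: halfline_ge (ltW sr).
have intphi1 : (\int[mu s]_(x in [set: V]) ((`|phi x| + 1) `^ p)%:E <= N0%:E)%E.
  have mphi := bounded_lipschitz_measurable lphi.
  have mpow : measurable_fun [set: V] (fun x : V => (`|phi x| `^ p)%:E).
    apply/measurable_EFinP.
    apply: (@measurableT_comp _ _ _ _ _ _ (@powR R ^~ p)) => //.
    exact: measurableT_comp.
  apply: (@le_trans _ _ (\int[mu s]_(x in [set: V])
    ((2 `^ p)%:E * ((`|phi x| `^ p)%:E + 1%:E)))%E).
    apply: ge0_le_integral => //.
    - have [cF _] := Cb_powR_abs1 (ltW p0) lphi.
      by apply/measurable_EFinP; exact: continuous_measurable_rV.
    - by apply: emeasurable_funM => //; exact: emeasurable_funD.
    - move=> x _; rewrite -[leRHS]/((2 `^ p * (`|phi x| `^ p + 1))%:E) lee_fin.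
      by have := powRD_le (normr_ge0 (phi x)) ler01 (ltW p0); rewrite powR1.
  rewrite ge0_integralZl_EFin ?powR_ge0//; last 2 first.
  - by move=> x _; rewrite adde_ge0// lee_fin powR_ge0.
  - exact: emeasurable_funD.
  rewrite /N0 EFinM lee_wpmul2l ?lee_fin ?powR_ge0//.
  rewrite ge0_integralD//.
  rewrite integral_cst// mul1e [X in (_ + X)%E](_ : _ = 1%E).
    by rewrite EFinD leeD.
  exact: probability_setT.
have [C1 [k1 adm1]] := adm s r Is.
have [C2 [k2 adm2]] := adm r t Ir.
have key u ut gu Hu : line_solution Q b s u ut gu Hu ->
    (forall x, u s x <= `|phi x|) -> forall x, u t x <= expR (k + M).
  move=> solu u_init x.
  have lnB : ln (Num.max (u t x) 1) <= k + M.
    apply: (HM Q b t eta0 C2 k2 u ut gu Hu k) => //.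
    - apply: line_solution_restrict solu; exact: ltW.
    - move=> tau y rtau _; apply: growth; exact: halfline_ge rtau.
    move=> y; rewrite -(ler_pM2l p0).
    apply: le_trans (integrated_harnack p1 adm1 Is sr (Hrho r Ir) lphi intphi1
      solu u_init y) _.
    have sE : 2 * (harnack_const eta0 p / (r - s)) <= p * delta.
      have -> : p * delta = 2 * (c / (l / 2)).
        by rewrite /delta; field; rewrite !gt_eqF.
      rewrite ler_pM2l// ler_pM2l// lef_pV2 ?posrE ?subr_gt0//.
      by rewrite /r; lra.
    have Y0 : 0 <= dot y y + rho ^+ 2 by rewrite addr_ge0 ?dot_ge0 ?sqr_ge0.
    have H1 := ler_wpM2r Y0 sE.
    have H2 : p * k = ln (2 * N0) + p * delta * (rho ^+ 2 + R0 ^+ 2 + 1 / 2).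
      by rewrite /k; field; rewrite gt_eqF.
    have H3 := ler_wpM2l (ltW (mulr_gt0 p0 delta0)) (huber_ge (dot y y - R0 ^+ 2)).
    by lra.
  have max0 : 0 < Num.max (u t x) 1 by rewrite lt_max ltr01 orbT.
  apply: (@le_trans _ _ (Num.max (u t x) 1)); first by rewrite le_max lexx.
  by rewrite -[leLHS](lnK max0) ler_expR.
have [Gsol _ _] := G_evol Is (bounded_lipschitz_Cb lphi).
have [ut [gu [Hu solu]]] := classical_line_solution Gsol.
have G_init y : G s s phi y = phi y by case: Gsol => _ _ _; exact.
move=> x; rewrite ler_norml lerNl; apply/andP; split.
  apply: (key _ _ _ _ (line_solutionN solu)) => y /=.
  by rewrite G_init -normrN ler_norm.
by apply: (key _ _ _ _ solu) => y; rewrite G_init ler_norm.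
Qed.

End uniform_bound.

(** * Extension to Lp and ultraboundedness *)

Section Lp_extension.
Context {R : realType} {d : nat}.
Local Notation V := (borel_rV R d).
Variables (m m' : probability V R).
Implicit Types (f g : V -> R).

Lemma Lnorm_le1_integral (p : R) f : 1 <= p ->
  ('N[m]_(p%:E)[EFin \o f] <= 1)%E ->
  (\int[m]_(x in [set: V]) (`|f x| `^ p)%:E <= 1)%E.
Proof.
move=> p1 fp; have p_neq0 : p != 0 by rewrite gt_eqF//; lra.
have -> : (\int[m]_(x in [set: V]) (`|f x| `^ p)%:E =
    'N[m]_(p%:E)[EFin \o f] `^ p)%E by rewrite poweR_Lnorm.
rewrite -(poweR1r p); apply: gt0_ler_poweR => //.
- lra.
- by rewrite in_itv/= Lnorm_ge0 leey.
- by rewrite in_itv/= leey andbT.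
Qed.

Lemma Lnorm_infty_le f (B : R) : {ae m', forall x, `|f x| <= B} ->
  ('N[m']_(+oo%E)[EFin \o f] <= B%:E)%E.
Proof.
move=> fB; rewrite unlock /Lnorm ifT; last first.
  by rewrite [X in (_ < X)%E](_ : _ = 1%E) ?lte01//; exact: probability_setT.
apply/ess_supP; move: fB; apply: filterS => x /=.
by rewrite lee_fin.
Qed.

Lemma bounded_lipschitz_Lfun1 (phi : V -> R) :
  bounded_lipschitz (phi : 'rV[R]_d -> R) -> phi \in Lfun m 1.
Proof.
move=> lphi; apply/Lfun1_integrable.
have [_ [M phiM]] := lphi.
have iM : m.-integrable [set: V] (EFin \o cst M).
  exact: finite_measure_integrable_cst.
apply: le_integrable iM => //.
  by apply/measurable_EFinP; exact: bounded_lipschitz_measurable.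
by move=> x _; rewrite lee_fin; apply: le_trans (phiM x) (ler_norm _).
Qed.

(** Contractivity in [L^1] transports the approximation by Lipschitz functions
    to the images; a bound that is uniform along the approximants therefore
    holds almost everywhere. *)
Lemma ae_bound_of_lipschitz (p B : R) (T : ('rV[R]_d -> R) -> 'rV[R]_d -> R)
    (E : (V -> R) -> V -> R) :
  1 <= p -> is_Lp_extension 1 m m' T E ->
  (forall phi : 'rV[R]_d -> R, bounded_lipschitz phi ->
     (\int[m]_(x in [set: V]) (`|phi x| `^ p)%:E <= (2 `^ p * 2)%:E)%E ->
     forall x, `|T phi x| <= B) ->
  forall f, f \in Lfun m p%:E ->
    (\int[m]_(x in [set: V]) (`|f x| `^ p)%:E <= 1)%E ->
  {ae m', forall x, `|E f x| <= B}.
Proof.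
move=> p1 [Emem Elin Econtr ET] TB f fLp fp1.
have fL1 : f \in Lfun m 1.
  apply: (Lfun_subset _ _ _ _ fLp) => //; exact: fin_num_measure.
have mE g : g \in Lfun m 1 -> measurable_fun [set: V] (E g).
  by move=> /Emem; rewrite inE => /andP[]; rewrite inE.
(* the excess over B has integral at most eps, for every eps *)
pose F : V -> R := fun x => Num.max 0 (`|E f x| - B).
have mF : measurable_fun [set: V] F.
  apply: measurable_maxr; first exact: measurable_cst.
  apply: measurable_funB; last exact: measurable_cst.
  by apply: measurableT_comp => //; exact: mE.
have F0 x : (0 <= (F x)%:E)%E by rewrite lee_fin le_max lexx.
have Fle eps : 0 < eps -> (\int[m']_(x in [set: V]) (F x)%:E <= eps%:E)%E.
  move=> eps0.
  have [phi [lphi phip fphi]] := Lp_lipschitz_approximation p1 fLp fp1 eps0.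
  have phiL1 := bounded_lipschitz_Lfun1 lphi.
  pose h : V -> R := fun y => (-1) * phi y + f y.
  have hL1 : h \in Lfun m 1.
    apply/Lfun1_integrable.
    have -> : EFin \o h = (fun x => (EFin \o f) x - (EFin \o phi) x)%E.
      by apply/funext => x; rewrite /h/= EFinD mulN1r EFinN addeC.
    by apply: integrableB => //; exact/Lfun1_integrable.
  have aeh : {ae m', forall x, F x <= `|E h x|}.
    have H1 := Elin (-1) phi f phiL1 fL1.
    have H2 := ET phi (bounded_lipschitz_Cb lphi).
    move: H1 H2; apply: filterS2 => x H1 H2.
    have -> : E h x = - T phi x + E f x by rewrite H1 H2 mulN1r.
    rewrite ge_max normr_ge0/=.
    have := TB phi lphi phip x.
    have : `|E f x| <= `|- T phi x + E f x| + `|T phi x|.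
      have := ler_normD (- T phi x + E f x) (T phi x).
      by rewrite (_ : - T phi x + E f x + T phi x = E f x); last lra.
    lra.
  apply: (@le_trans _ _ (\int[m']_(x in [set: V]) `|(E h x)%:E|)%E).
    apply: ae_ge0_le_integral => //.
    - exact/measurable_EFinP.
    - apply: measurableT_comp => //; apply/measurable_EFinP; exact: mE.
    - by move: aeh; apply: filterS => x Fx _; rewrite lee_fin.
  have := Econtr h hL1; rewrite !Lnorm1 => /le_trans; apply.
  apply: le_trans fphi; rewrite le_eqVlt; apply/orP; left; apply/eqP.
  apply: eq_integral => x _; rewrite /h/= /absdiff; congr (_%:E).
  by rewrite mulN1r addrC.
have int0 : (\int[m']_(x in [set: V]) `|(F x)%:E| = 0)%E.
  under eq_integral do rewrite gee0_abs//.
  apply/eqP; rewrite eq_le integral_ge0// andbT.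
  by apply/lee_addgt0Pr => eps eps0; rewrite add0e; exact: Fle.
have mFE : measurable_fun [set: V] (fun x => (F x)%:E) by exact/measurable_EFinP.
have := (ae_eq_integral_abs m' measurableT mFE).1 int0.
apply: filterS => x /(_ I)/= [] Fx0.
have : `|E f x| - B <= F x by rewrite le_max lexx orbT.
by rewrite Fx0; lra.
Qed.

(** Scaling into the unit ball and adding the image of 0, which linearity almost
    everywhere leaves as an extra term. *)
Lemma Lfun_infty_of_bound (p B : R) (E : (V -> R) -> V -> R)
    (T : ('rV[R]_d -> R) -> 'rV[R]_d -> R) :
  1 <= p -> is_Lp_extension p m m' T E ->
  (forall f, f \in Lfun m p%:E ->
    (\int[m]_(x in [set: V]) (`|f x| `^ p)%:E <= 1)%E ->
    {ae m', forall x, `|E f x| <= B}) ->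
  forall f, f \in Lfun m p%:E -> E f \in Lfun m' +oo%E.
Proof.
move=> p1 [Emem Elin _ _] EB f fLp.
have p0 : p != 0 by rewrite gt_eqF//; lra.
have zeroLp : (fun=> 0 : R) \in Lfun m p%:E by exact: Lfun_cst.
have zero1 : (\int[m]_(x in [set: V]) (`|0 : R| `^ p)%:E <= 1)%E.
  by rewrite integral0_eq// => x _; rewrite normr0 powR0.
have int_fin : (\int[m]_(x in [set: V]) (`|f x| `^ p)%:E < +oo)%E.
  by have := Lfun_integrable p1 fLp; exact: integrable_lty.
have int_ge0 : (0 <= \int[m]_(x in [set: V]) (`|f x| `^ p)%:E)%E.
  by apply: integral_ge0 => x _; rewrite lee_fin powR_ge0.
pose N := fine (\int[m]_(x in [set: V]) (`|f x| `^ p)%:E).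
have NE : (\int[m]_(x in [set: V]) (`|f x| `^ p)%:E = N%:E)%E.
  by rewrite /N fineK// ge0_fin_numE.
have N0 : 0 <= N by rewrite fine_ge0.
pose a := N + 1; have a1 : 1 <= a by rewrite /a; lra.
have a0 : 0 < a by lra.
pose g : V -> R := a^-1 \o* f.
have gLp : g \in Lfun m p%:E by exact: Lfun_scale.
have gE x : g x = f x / a by [].
have g1 : (\int[m]_(x in [set: V]) (`|g x| `^ p)%:E <= 1)%E.
  have mfp : measurable_fun [set: V] (fun x => (`|f x| `^ p)%:E).
    exact: measurable_int (Lfun_integrable p1 fLp).
  have -> : (\int[m]_(x in [set: V]) (`|g x| `^ p)%:E =
      ((a^-1) `^ p)%:E * \int[m]_(x in [set: V]) (`|f x| `^ p)%:E)%E.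
    rewrite -ge0_integralZl_EFin ?powR_ge0//.
    apply: eq_integral => x _; rewrite gE normrM powRM// EFinM muleC.
    by rewrite ger0_norm ?invr_ge0// ltW.
  rewrite NE -EFinM lee_fin.
  have ainv : (a^-1) `^ p <= a^-1.
    have := @powR_le_linear R a^-1 1 p; rewrite powR1 mul1r; apply => //.
      by rewrite invr_ge0 ltW.
    by rewrite invf_le1.
  apply: (@le_trans _ _ (a^-1 * N)); first by rewrite ler_wpM2r.
  by rewrite mulrC ler_pdivrMr// mul1r /a; lra.
have fE : (fun y => a * g y + 0) = f.
  by apply/funext => y; rewrite gE addr0 mulrC divfK// gt_eqF.
have bound : {ae m', forall x, `|E f x| <= a * B + B}.
  have H1 := Elin a g (fun=> 0) gLp zeroLp; rewrite fE in H1.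
  have H2 := EB g gLp g1; have H3 := EB _ zeroLp zero1.
  move: H1 H2 H3; apply: filterS3 => x -> H2x H3x.
  apply: le_trans (ler_normD _ _) _; rewrite normrM gtr0_norm//.
  by apply: lerD => //; rewrite ler_wpM2l// ltW.
apply/andP; split; rewrite inE/=.
  by have := Emem f fLp; rewrite inE => /andP[]; rewrite inE.
by apply: le_lt_trans (Lnorm_infty_le bound) _; rewrite ltry.
Qed.

End Lp_extension.

(** A bound that is valid for all times beyond each [1 / n.+1] is dominated by a
    decreasing function exploding at zero. *)
Lemma decreasing_majorant (R : realType) (Bf : nat -> R) :
  exists C : R -> R,
  [/\ forall r : R, 0 < r -> 0 < C r,
      forall r1 r2 : R, 0 < r1 -> r1 < r2 -> C r2 < C r1,
      C r @[r --> 0^'+] --> +oo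
    & forall r : R, 0 < r -> exists2 n : nat, n.+1%:R^-1 <= r & Bf n <= C r].
Proof.
pose S (n : nat) := \sum_(i < n) `|Bf i|.
have S_mono : {homo S : i j / (i <= j)%N >-> i <= j}.
  apply: homo_leq => [//||n]; first exact: le_trans.
  by rewrite /S big_ord_recr/= lerDl.
have S_ge0 n : 0 <= S n by apply: sumr_ge0.
(* the inverse gives strict monotonicity and the explosion at 0 *)
pose C (r : R) := r^-1 + S (Num.truncn r^-1).+1.
have C_ge r : r^-1 <= C r by rewrite lerDl.
exists C; split.
- by move=> r r0; apply: lt_le_trans (C_ge r); rewrite invr_gt0.
- move=> r1 r2 r10 r12; have r20 : 0 < r2 by exact: lt_trans r12.
  apply: ltr_leD; first by rewrite ltf_pV2.
  by apply: S_mono; rewrite ltnS; apply: le_truncn; rewrite lef_pV2// ltW.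
- apply/cvgryPge => A; have A1 : 0 < `|A| + 1 by rewrite ltr_wpDl.
  near=> r; apply: le_trans (C_ge r); apply: le_trans (ler_norm A) _.
  have r0 : 0 < r by near: r; exact: nbhs_right_gt.
  have rA : r < (`|A| + 1)^-1.
    by near: r; apply: nbhs_right_lt; rewrite invr_gt0.
  apply: (@le_trans _ _ (`|A| + 1)); first by rewrite lerDl.
  by rewrite -[leLHS]invrK lef_pV2 ?posrE ?invr_gt0// ltW.
- move=> r r0; exists (Num.truncn r^-1).
    rewrite -[leRHS]invrK lef_pV2 ?posrE ?invr_gt0//.
    exact: ltW (truncnS_gt _).
  apply: le_trans (ler_norm _) _; rewrite /C /S big_ord_recr/=.
  rewrite addrA lerDr addr_ge0 ?sumr_ge0// invr_ge0 ltW//.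
Unshelve. all: by end_near. Qed.

Theorem theorem4p3 (R : realType) (d : nat) (d_gt0 : (0 < d)%N)
    (I : set R) (I_halfline : open_right_halfline I)
    (theta : R) (Q : R -> 'M[R]_d) (b : R -> 'rV[R]_d -> 'rV[R]_d)
    (Qb_standing : standing_assumptions I theta Q b)
    (G : R -> R -> ('rV[R]_d -> R) -> 'rV[R]_d -> R)
    (G_evol : is_evolution_operator I theta Q b G)
    (mu : R -> probability (borel_rV R d) R)
    (mu_evol : tight_evolution_system I mu G)
    (GL : R -> R -> (borel_rV R d -> R) -> borel_rV R d -> R)
    (GL_ext : extends_to_Lp I mu G GL)
    (K2 alpha R0 : R) (K2_gt0 : 0 < K2) (alpha_gt1 : 1 < alpha)
    (R0_gt1 : 1 < R0)
    (b_growth : forall t x, I t -> R0 <= enorm x ->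
       dot (b t x) x <= - K2 * enorm x ^+ 2 * ln (enorm x) `^ alpha) :
  ultrabounded I mu GL.
Proof.
move=> p p1; have p1' : 1 <= p by exact: ltW.
have bounds n : exists B : R, forall s t, I s -> s + n.+1%:R^-1 <= t ->
    forall phi : 'rV[R]_d -> R, bounded_lipschitz phi ->
    (\int[mu s]_(x in [set: borel_rV R d]) (`|phi x| `^ p)%:E
      <= (2 `^ p * 2)%:E)%E ->
    forall x, `|G t s phi x| <= B.
  apply: (Lipschitz_uniform_bound I_halfline Qb_standing G_evol mu_evol
    K2_gt0 alpha_gt1 R0_gt1 b_growth p1).
  by rewrite invr_gt0 ltr0n.
have {bounds}/boolp.choice[Bf HBf] := bounds.
have [C [C_gt0 C_decr C_infty HC]] := decreasing_majorant Bf.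
have ae_bound s t : I s -> I t -> s < t ->
    forall f, f \in Lfun (mu s) p%:E ->
    (\int[mu s]_(x in [set: borel_rV R d]) (`|f x| `^ p)%:E <= 1)%E ->
    {ae mu t, forall x, `|GL t s f x| <= C (t - s)}.
  move=> Is It st; have ts : 0 < t - s by rewrite subr_gt0.
  have [n nts BC] := HC _ ts.
  move=> f fLp fp.
  apply: (@ae_bound_of_lipschitz R d (mu s) (mu t) p (C (t - s)) (G t s)
    (GL t s) p1' (GL_ext 1 s t (lexx 1) Is It st) _ f fLp fp) => phi lphi phip x.
  apply: le_trans BC; apply: (HBf n s t Is _ phi lphi phip x).
  by rewrite addrC -lerBrDr.
split.
  move=> s t Is It st; apply: (Lfun_infty_of_bound p1' (GL_ext p s t p1' Is It st)).
  exact: ae_bound.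
exists C; split => // s t Is It st.
apply: ge_ereal_sup => _ [f [fLp fp] <-].
apply: Lnorm_infty_le; apply: ae_bound => //.
exact: Lnorm_le1_integral.
Qed.
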